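(* Let $(d_n)_{n\ge1}$ be a sequence of positive integers with $d_n\to\infty$ as $n\to\infty$. For each $n$, let $\boldsymbol{X}_{n,1},\ldots,\boldsymbol{X}_{n,n}$ be mutually independent random vectors, each uniformly distributed on $\mathbb{S}^{d_n}=\{\boldsymbol{x}\in\mathbb{R}^{d_n+1}:\boldsymbol{x}^\top\boldsymbol{x}=1\}$. For a real sequence of weights $(v_{k,d_n})_{k\ge1}$, let $\psi_n$ and $T_n$ be as defined in the context. Assume: (i) for every $n\ge1$, $$\sigma_n^2:=2\,\mathrm{E}\big[\psi_n^2(\boldsymbol{X}_{n,1}^\top\boldsymbol{X}_{n,2})\big]=2\sum_{k=1}^\infty v_{k,d_n}^4 d_{k,d_n}<\infty;$$ (ii) as $n\to\infty$, $$\sigma_n^{-4}\sum_{k=1}^\infty v_{k,d_n}^8 d_{k,d_n}=o(1)\quad\text{and}\quad \sigma_n^{-4}\,\mathrm{E}\big[\psi_n^4(\boldsymbol{X}_{n,1}^\top\boldsymbol{X}_{n,2})\big]=O(1).$$ Then $\sigma_n^{-1}T_n$ converges weakly to $\mathcal{N}(0,1)$ as $n\to\infty$.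
   Context: $C_k^{(\lambda)}$ denotes the Gegenbauer polynomial of degree $k$ and index $\lambda$ (orthogonal on $[-1,1]$ with respect to the weight $(1-x^2)^{\lambda-1/2}$). For $d\ge2$, $\psi_n:[-1,1]\to\mathbb{R}$ is defined (almost everywhere, as an $L^2$ series) by $\psi_n(x)=\sum_{k=1}^\infty\big(1+\frac{2k}{d_n-1}\big)v_{k,d_n}^2C_k^{(d_n-1)/2}(x)$ when $d_n\ge2$, and $\psi_n(x)=\sum_{k=1}^\infty 2v_{k,1}^2\cos(k\cos^{-1}(x))$ when $d_n=1$. The statistic is $T_n:=\frac{2}{n}\sum_{1\le i<j\le n}\psi_n(\boldsymbol{X}_{n,i}^\top\boldsymbol{X}_{n,j})$. For integers $k\ge1$, $d\ge1$, $d_{k,d}:=\binom{d+k-2}{d-1}+\binom{d+k-1}{d-1}$ (the dimension of the space of spherical harmonics of degree $k$ on $\mathbb{S}^d$); for $d\ge2$ it equals $\big(1+\frac{2k}{d-1}\big)\frac{\Gamma(d-1+k)}{\Gamma(d-1)k!}$. *)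

(* Defs.v *)
From HB Require Import structures.
From mathcomp Require Import all_boot all_order all_algebra.
From mathcomp Require Import all_classical all_reals all_analysis.
Set Implicit Arguments. Unset Strict Implicit. Unset Printing Implicit Defensive.
Import Order.TTheory GRing.Theory Num.Theory.
Import numFieldNormedType.Exports.
Local Open Scope classical_set_scope.
Local Open Scope ring_scope.

Section Defs.
Context {R : realType}.

(* Gegenbauer polynomials C_k^(lam)(x), standard normalisation (DLMF 18.9.1):
   C_0 = 1, C_1 = 2 lam x,
   n C_n = 2 x (n + lam - 1) C_(n-1) - (n + 2 lam - 2) C_(n-2).
   gegen_pair lam x k = (C_k(x), C_(k+1)(x)). *)
Fixpoint gegen_pair (lam x : R) (k : nat) : R * R :=
  match k with
  | 0 => (1, 2 * lam * x)
  | k'.+1 =>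
      let p := gegen_pair lam x k' in
      (p.2, (2 * x * (k'.+1%:R + lam) * p.2 - (k'%:R + 2 * lam) * p.1)
              / k'.+2%:R)
  end.

Definition gegenbauer (k : nat) (lam : R) (x : R) : R := (gegen_pair lam x k).1.

Definition dkd (k d : nat) : nat := 'C(d + k - 2, d - 1) + 'C(d + k - 1, d - 1).

Definition psi_term (v : nat -> nat -> R) (d k : nat) (x : R) : R :=
  if (2 <= d)%N then
    (1 + 2 * k%:R / (d%:R - 1)) * (v k d) ^+ 2
      * gegenbauer k ((d%:R - 1) / 2) x
  else 2 * (v k d) ^+ 2 * cos (k%:R * acos x).

Definition psi_partial (v : nat -> nat -> R) (d K : nat) (x : R) : R :=
  \sum_(1 <= k < K.+1) psi_term v d k x.

Definition inner (m : nat) (x y : m.-tuple R) : R :=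
  \sum_(j < m) tnth x j * tnth y j.

Definition unit_sphere (m : nat) : set (m.+1.-tuple R) :=
  [set x | inner x x = 1].

Definition mat_act (m : nat) (Q : 'M[R]_m) (x : m.-tuple R) : m.-tuple R :=
  [tuple \sum_(j < m) Q i j * tnth x j | i < m].

Definition orthogonal_mx (m : nat) (Q : 'M[R]_m) : Prop := Q^T *m Q = 1%:M.

Context {d0 : measure_display} {Omega : measurableType d0}.

(* X is uniformly distributed on S^m: a measurable random vector concentrated
   on S^m whose law is invariant under every orthogonal transformation
   (normalised rotation-invariant / Haar measure on the sphere). *)
Definition uniform_on_sphere (P : probability Omega R) (m : nat)
    (X : Omega -> m.+1.-tuple R) : Prop :=
  [/\ measurable_fun setT X,
      P (X @^-1` (@unit_sphere m)) = 1%E &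
      forall Q : 'M[R]_m.+1, orthogonal_mx Q ->
        forall A : set (m.+1.-tuple R), measurable A ->
          P (X @^-1` A) = P ((mat_act Q \o X) @^-1` A)].

Definition mutually_independent (P : probability Omega R) (m n : nat)
    (X : nat -> Omega -> m.-tuple R) : Prop :=
  forall A : 'I_n -> set (m.-tuple R), (forall i, measurable (A i)) ->
    P (\bigcap_(i in [set: 'I_n]) (X i @^-1` A i)) =
    (\prod_(i < n) P (X i @^-1` A i))%E.

Definition Tstat (n m : nat) (psi : R -> R) (X : nat -> Omega -> m.-tuple R)
    (w : Omega) : R :=
  2 / n%:R * \sum_(i < n) \sum_(j < n | (i < j)%N) psi (inner (X i w) (X j w)).

End Defs.

(* Main.v *)
(** The statistic is a degenerate U-statistic [W = \sum_(i < j) h x_i x_j]. With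
    [W_i = \sum_(j != i) h x_i x_j], the difference [W - W_i] does not involve
    the i-th variable, so [E (W_i g (W - W_i)) = 0]; expanding [g] around [W]
    gives [E (W g W) = E (U g' W) + o(1)] with [U = 1/2 \sum_i W_i ^ 2]. Hence
    [W] is asymptotically normal by Stein's method as soon as [E (U - 1) ^ 2]
    tends to 0. The Hoeffding decomposition of [U] involves only kernels that are
    centred in each variable, whose sums are controlled by the fourth moment of
    [h] and by [E (G ^ 2)], where [G x y = E (h x Z * h y Z)].

    On the sphere, planar rotations parametrised rationally yield two integration
    by parts formulas for zonal polynomials. Together with the Gegenbauer
    recurrences they give the orthogonality of the [C_k] and, by induction on [k],
    [E (C_k (x.Z) * C_k (y.Z)) = lam / (k + lam) * C_k (x.y)], so that
    [E (G ^ 2)] is bounded by twice the eighth-power sum of the weights. *)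
Require Import Defs.
From HB Require Import structures.
From mathcomp Require Import all_boot all_order all_algebra.
From mathcomp Require Import all_classical all_reals all_analysis.
From mathcomp Require Import measurable_realfun zify ring lra.
Set Implicit Arguments. Unset Strict Implicit. Unset Printing Implicit Defensive.
Import Order.TTheory GRing.Theory Num.Theory.
Import numFieldNormedType.Exports.
Local Open Scope classical_set_scope.
Local Open Scope ring_scope.

(** * Integrability and moments on a probability space *)

Section moments.
Context {R : realType} {d : measure_display} {T : measurableType d}.
Variable P : probability T R.
Implicit Types f g : T -> R.

(** The scaling explains the bounds. After normalisation the kernel has variance 2 / n^2, fourth
    moment O(n^-4) and E (G ^ 2) = O(q_n / n^4), where q_n is the eighth-power ratio assumed to tend
    to 0. Counting indices freely would lose powers of n; orthogonality of centred kernels brings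
    the errors down to n^3 B = O(1/n) and n^4 Q = O(q_n), with B and Q the bounds on the two
    moments. Two obstacles shape the statements. Uniformity is given as invariance, so the laws of
    the variables are not known to coincide; uniqueness of the invariant law is established on zonal
    functions, which is what the kernel consists of. And [psi] is only an L^2 sum, while leaving one
    variable out needs estimates for each fixed value of the others; invariance makes the section
    integrals independent of the fixed point, so these estimates hold everywhere and not merely
    almost everywhere. Stein's equation is solved for test functions of compact support and mean
    zero; a truncation argument recovers bounded continuous ones. *)

Definition L1 f := P.-integrable setT (EFin \o f).
Definition L2 f := measurable_fun setT f /\ L1 (fun x => f x ^+ 2).
Definition L4 f := measurable_fun setT f /\ L1 (fun x => f x ^+ 4).

Lemma L1_measurable f : L1 f -> measurable_fun setT f.
Proof. by move=> /measurable_int/measurable_EFinP. Qed.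

Lemma L1_ext f g : L1 f -> f =1 g -> L1 g.
Proof. by move=> Hf /funext <-. Qed.

Lemma L2_ext f g : L2 f -> f =1 g -> L2 g.
Proof. by move=> Hf /funext <-. Qed.

Lemma L4_ext f g : L4 f -> f =1 g -> L4 g.
Proof. by move=> Hf /funext <-. Qed.

Lemma L1_dom f g : measurable_fun setT f -> L1 g ->
  (forall x, `|f x| <= g x) -> L1 f.
Proof.
move=> mf ig fg; apply: le_integrable ig => //; first exact/measurable_EFinP.
by move=> x _ /=; rewrite lee_fin (le_trans (fg x))// ler_norm.
Qed.

Lemma L1_cst (c : R) : L1 (fun=> c).
Proof. exact: finite_measure_integrable_cst. Qed.

Lemma L1D f g : L1 f -> L1 g -> L1 (fun x => f x + g x).
Proof. by move=> hf hg; exact: (integrableD measurableT hf hg). Qed.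

Lemma L1B f g : L1 f -> L1 g -> L1 (fun x => f x - g x).
Proof. by move=> hf hg; exact: (integrableB measurableT hf hg). Qed.

Lemma L1Z (c : R) f : L1 f -> L1 (fun x => c * f x).
Proof. by move=> hf; exact: (integrableZl measurableT c hf). Qed.

Lemma L1_sum (I : Type) (s : seq I) (p : pred I) (F : I -> T -> R) :
  (forall i, p i -> L1 (F i)) -> L1 (fun x => \sum_(i <- s | p i) F i x).
Proof.
move=> H; elim: s => [|i s IH].
  by apply: (L1_ext (L1_cst 0)) => x; rewrite big_nil.
case pi : (p i); last by apply: (L1_ext IH) => x; rewrite big_cons pi.
by apply: (L1_ext (L1D (H _ pi) IH)) => x; rewrite big_cons pi.
Qed.

Lemma L1_norm f : L1 f -> L1 (fun x => `|f x|).
Proof. by move=> /integrable_norm. Qed.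

Lemma Ex_sum (I : Type) (s : seq I) (p : pred I) (F : I -> T -> R) :
  (forall i, p i -> L1 (F i)) ->
  \int[P]_x (\sum_(i <- s | p i) F i x) = \sum_(i <- s | p i) \int[P]_x F i x.
Proof.
move=> H; elim: s => [|i s IH].
  under eq_Rintegral do rewrite big_nil.
  by rewrite Rintegral_cst//= mul0r big_nil.
under eq_Rintegral do rewrite big_cons.
rewrite big_cons; case: ifP => // pi.
by rewrite RintegralD ?IH//; [exact: H|exact: L1_sum].
Qed.

Lemma Ex_cst (c : R) : \int[P]_x c = c.
Proof. by rewrite Rintegral_cst// [X in fine X](probability_setT P) mulr1. Qed.

Lemma le_Ex f g : L1 f -> L1 g -> (forall x, f x <= g x) ->
  \int[P]_x f x <= \int[P]_x g x.
Proof. by move=> *; apply: le_Rintegral. Qed.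

Lemma normr_Ex_le f g : L1 f -> L1 g -> (forall x, `|f x| <= g x) ->
  `|\int[P]_x f x| <= \int[P]_x g x.
Proof.
move=> if_ ig fg; apply: le_trans (le_normr_Rintegral measurableT if_) _.
by apply: le_Ex => //; exact: L1_norm.
Qed.

Lemma L2_cst (c : R) : L2 (fun=> c).
Proof. by split => //; exact: L1_cst. Qed.

Lemma L4_cst (c : R) : L4 (fun=> c).
Proof. by split => //; exact: L1_cst. Qed.

Lemma L2D f g : L2 f -> L2 g -> L2 (fun x => f x + g x).
Proof.
move=> [mf if_] [mg ig]; split; first exact: measurable_funD.
apply: (@L1_dom _ (fun x => 2 * f x ^+ 2 + 2 * g x ^+ 2)).
- by apply: measurable_funX; exact: measurable_funD.
- by apply: L1D; exact: L1Z.
- by move=> x; rewrite ger0_norm ?sqr_ge0//; have := sqr_ge0 (f x - g x); nra.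
Qed.

Lemma L2Z (c : R) f : L2 f -> L2 (fun x => c * f x).
Proof.
move=> [mf if_]; split; first exact: measurable_funM.
by apply: (L1_ext (L1Z _ if_)) => x; rewrite exprMn.
Qed.

Lemma L2B f g : L2 f -> L2 g -> L2 (fun x => f x - g x).
Proof.
move=> Hf Hg; apply: (L2_ext (L2D Hf (L2Z (-1) Hg))) => x.
by rewrite mulN1r.
Qed.

Lemma L4Z (c : R) f : L4 f -> L4 (fun x => c * f x).
Proof.
move=> [mf if_]; split; first exact: measurable_funM.
by apply: (L1_ext (L1Z _ if_)) => x; rewrite exprMn.
Qed.

Lemma ler_normM2 (a b : R) : `|a * b| <= a ^+ 2 + b ^+ 2.
Proof.
rewrite ler_norml; have := sqr_ge0 (a - b); have := sqr_ge0 (a + b).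
have := sqr_ge0 a; have := sqr_ge0 b; nra.
Qed.

Lemma L2M f g : L2 f -> L2 g -> L1 (fun x => f x * g x).
Proof.
move=> [mf if_] [mg ig].
apply: (@L1_dom _ (fun x => f x ^+ 2 + g x ^+ 2)) => //.
- exact: measurable_funM.
- exact: L1D.
- by move=> x; exact: ler_normM2.
Qed.

Lemma L4M f g : L4 f -> L4 g -> L2 (fun x => f x * g x).
Proof.
move=> [mf if_] [mg ig]; split; first exact: measurable_funM.
apply: (@L1_dom _ (fun x => f x ^+ 4 + g x ^+ 4)) => //.
- by apply: measurable_funX; exact: measurable_funM.
- exact: L1D.
- move=> x; rewrite exprMn; apply: le_trans (ler_normM2 _ _) _.
  by rewrite -!exprM.
Qed.

Lemma L4_sqr f : L4 f -> L2 (fun x => f x ^+ 2).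
Proof. by move=> Hf; exact: (L2_ext (L4M Hf Hf)). Qed.

Lemma L4W f : L4 f -> L2 f.
Proof.
by move=> Hf; apply: (L2_ext (L4M Hf (L4_cst 1))) => x; rewrite mulr1.
Qed.

Lemma L2W f : L2 f -> L1 f.
Proof.
by move=> Hf; apply: (L1_ext (L2M Hf (L2_cst 1))) => x; rewrite mulr1.
Qed.

Lemma L4D f g : L4 f -> L4 g -> L4 (fun x => f x + g x).
Proof.
move=> Hf Hg; split; first by apply: measurable_funD; [case: Hf|case: Hg].
have [_ H] : L2 (fun x => (f x + g x) ^+ 2).
  apply: (L2_ext (L2D (L2D (L4_sqr Hf) (L2Z 2 (L4M Hf Hg))) (L4_sqr Hg))) => x.
  by rewrite sqrrD mulr_natl.
by apply: (L1_ext H) => x; rewrite -exprM.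
Qed.

Lemma L2_sum (I : Type) (s : seq I) (p : pred I) (F : I -> T -> R) :
  (forall i, p i -> L2 (F i)) -> L2 (fun x => \sum_(i <- s | p i) F i x).
Proof.
move=> H; elim: s => [|i s IH].
  by apply: (L2_ext (L2_cst 0)) => x; rewrite big_nil.
case pi : (p i); last by apply: (L2_ext IH) => x; rewrite big_cons pi.
by apply: (L2_ext (L2D (H _ pi) IH)) => x; rewrite big_cons pi.
Qed.

Lemma L4_sum (I : Type) (s : seq I) (p : pred I) (F : I -> T -> R) :
  (forall i, p i -> L4 (F i)) -> L4 (fun x => \sum_(i <- s | p i) F i x).
Proof.
move=> H; elim: s => [|i s IH].
  by apply: (L4_ext (L4_cst 0)) => x; rewrite big_nil.
case pi : (p i); last by apply: (L4_ext IH) => x; rewrite big_cons pi.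
by apply: (L4_ext (L4D (H _ pi) IH)) => x; rewrite big_cons pi.
Qed.

Lemma L1_bounded f (M : R) : measurable_fun setT f ->
  (forall x, `|f x| <= M) -> L1 f.
Proof. by move=> mf fM; apply: (@L1_dom _ (fun=> M)) => //; exact: L1_cst. Qed.

Lemma L2_bounded f (M : R) : measurable_fun setT f ->
  (forall x, `|f x| <= M) -> L2 f.
Proof.
move=> mf fM; split=> //; apply: (@L1_bounded _ (M ^+ 2)).
  exact: measurable_funX.
move=> x; rewrite normrX lerXn2r// ?nnegrE//.
exact: le_trans (fM x).
Qed.

Lemma L1_bounded_mul f g (M : R) : measurable_fun setT f ->
  (forall x, `|f x| <= M) -> L1 g -> L1 (fun x => f x * g x).
Proof.
move=> mf fM ig; apply: (@L1_dom _ (fun x => M * `|g x|)).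
- by apply: measurable_funM => //; exact: L1_measurable.
- by apply: L1Z; exact: L1_norm.
- by move=> x; rewrite normrM ler_wpM2r.
Qed.

Lemma ge0_L1 f (B : R) : measurable_fun setT f -> (forall x, 0 <= f x) ->
  (\int[P]_x (f x)%:E <= B%:E)%E -> L1 f.
Proof.
move=> mf f0 fB; apply/integrableP; split; first exact/measurable_EFinP.
under eq_integral do rewrite /= ger0_norm//.
exact: le_lt_trans fB (ltry _).
Qed.

Lemma ge0_Ex_le f (B : R) : measurable_fun setT f -> (forall x, 0 <= f x) ->
  (\int[P]_x (f x)%:E <= B%:E)%E -> \int[P]_x f x <= B.
Proof.
move=> mf f0 fB; rewrite -lee_fin /Rintegral fineK//.
exact: integrable_fin_num (ge0_L1 mf f0 fB).
Qed.

Lemma Ex_EFin f : L1 f -> (\int[P]_x f x)%:E = (\int[P]_x (f x)%:E)%E.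
Proof. by move=> if_; rewrite /Rintegral fineK//; exact: integrable_fin_num. Qed.

End moments.

(** * Integration by resampling one coordinate *)

Section resampling.
Context {R : realType} {d : measure_display} {T : measurableType d} {n : nat}.

Definition upd (i : 'I_n) (x : n.-tuple T) (y : T) : n.-tuple T :=
  [tuple if j == i then y else tnth x j | j < n].

Lemma tnth_upd i x y j : tnth (upd i x y) j = if j == i then y else tnth x j.
Proof. by rewrite tnth_mktuple. Qed.

Lemma tnth_upd_eq i x y : tnth (upd i x y) i = y.
Proof. by rewrite tnth_upd eqxx. Qed.

Lemma tnth_upd_neq i x y j : j != i -> tnth (upd i x y) j = tnth x j.
Proof. by rewrite tnth_upd => /negbTE ->. Qed.

Lemma measurable_upd i :
  measurable_fun setT (fun p : n.-tuple T * T => upd i p.1 p.2).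
Proof.
apply/measurable_fun_tnthP => j.
rewrite (_ : _ \o _ = (fun p => if j == i then p.2 else tnth p.1 j)); last first.
  by apply/funext => p /=; rewrite tnth_upd.
case: (j == i); first exact: measurable_snd.
by apply: (measurableT_comp (@measurable_tnth _ T n j)); exact: measurable_fst.
Qed.

Variables (nu : probability (n.-tuple T) R) (mu : 'I_n -> probability T R).

(** The form in which independence is used: coordinate i is independent of the others with law
    [mu i]. It gives Fubini in that coordinate without rearranging a tuple into a product. *)
Definition resampled := forall i A, measurable A ->
  nu A = (nu \x mu i)%E ((fun p => upd i p.1 p.2) @^-1` A).

Hypothesis nuE : resampled.

Let updp i := fun p : n.-tuple T * T => upd i p.1 p.2.

Lemma resample_ge0 i (F : n.-tuple T -> \bar R) : measurable_fun setT F ->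
  (forall x, 0 <= F x)%E ->
  (\int[nu]_x F x = \int[nu]_x \int[mu i]_y F (upd i x y))%E.
Proof.
move=> mF F0; have mu_ := measurable_upd i.
transitivity (\int[pushforward (nu \x mu i)%E (updp i)]_x F x)%E.
  apply: eq_measure_integral => A mA _.
  exact: (nuE i mA).
rewrite ge0_integral_pushforward//.
rewrite preimage_setT.
rewrite (fubini_tonelli1 (m1 := nu) (m2 := mu i) (F \o updp i))//.
- exact: measurableT_comp.
- by move=> x; exact: F0.
Qed.

(** Stated with extended real integrals so that it can serve to prove integrability, not only to
    estimate afterwards. *)
Lemma resample_le i (F : n.-tuple T -> R) (B : R) : measurable_fun setT F ->
  (forall x, 0 <= F x) ->
  (forall x, (\int[mu i]_y (F (upd i x y))%:E <= B%:E)%E) ->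
  (\int[nu]_x (F x)%:E <= B%:E)%E.
Proof.
move=> mF F0 FB.
have mEF : measurable_fun setT (EFin \o F) by exact/measurable_EFinP.
rewrite (resample_ge0 i mEF); last by move=> x; rewrite lee_fin.
apply: (@le_trans _ _ (\int[nu]_x B%:E)%E).
- apply: ge0_le_integral => //.
  + by move=> x _; apply: integral_ge0 => y _; rewrite lee_fin.
  + apply: (measurable_fun_fubini_tonelli_F (m2 := mu i)
      (fun p => (F (upd i p.1 p.2))%:E)).
    apply/measurable_EFinP.
    apply: (measurableT_comp mF); exact: measurable_upd.
    by move=> p; rewrite lee_fin.
  + by move=> x _; exact: FB.
- rewrite -[leLHS]/(\int[nu]_x cst B%:E x)%E integral_cst//.
  by rewrite [X in (_ * X)%E](probability_setT nu) mule1.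
Qed.

Lemma Ex_resample_eq0 i (F : n.-tuple T -> R) : L1 nu F ->
  (forall x, \int[mu i]_y F (upd i x y) = 0) -> \int[nu]_x F x = 0.
Proof.
move=> iF F0; have mF := L1_measurable iF; have mu_ := measurable_upd i.
have mFu : measurable_fun setT (F \o updp i) by exact: measurableT_comp.
have iFu : (nu \x mu i)%E.-integrable setT (EFin \o (F \o updp i)).
  apply/integrable12ltyP; first exact/measurable_EFinP.
  rewrite -(@resample_ge0 i (fun x => `|(F x)%:E|)%E)//.
  - by case/integrableP : iF.
  - by apply: measurableT_comp => //; exact/measurable_EFinP.
have -> : \int[nu]_x F x = \int[pushforward (nu \x mu i)%E (updp i)]_x F x.
  move=> ?; rewrite /Rintegral; apply: (f_equal fine).
  apply: eq_measure_integral => A mA _; exact: (nuE i mA).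
rewrite /Rintegral integral_pushforward//; last exact/measurable_EFinP.
rewrite preimage_setT -(integral12_prod_meas1 iFu) /fubini_F.
rewrite [X in fine X](_ : _ = \int[nu]_x cst 0 x)%E; first by rewrite integral0.
(* Only almost every section is known to be integrable. On the others [F0] concerns the default
   value of [Rintegral], so the inner integrals are compared almost everywhere. *)
apply: ae_eq_integral => //; first exact: measurable_fubini_F iFu.
have := ae_integrable1 iFu; apply: filterS => x /= ix _.
by transitivity ((\int[mu i]_y F (upd i x y))%:E); [rewrite Ex_EFin|rewrite F0].
Qed.

Lemma Ex_resample_cst i (F : n.-tuple T -> R) (c : R) : L1 nu F ->
  (forall x, L1 (mu i) (fun y => F (upd i x y))) ->
  (forall x, \int[mu i]_y F (upd i x y) = c) -> \int[nu]_x F x = c.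
Proof.
move=> iF iFx Fc; apply/eqP; rewrite -subr_eq0 -[X in _ - X](Ex_cst nu).
rewrite -RintegralB//; last exact: L1_cst.
apply/eqP/(@Ex_resample_eq0 i) => [|x]; first exact: (L1B iF (L1_cst nu c)).
by rewrite RintegralB ?Ex_cst ?Fc ?subrr//; [exact: iFx|exact: L1_cst].
Qed.

End resampling.

Definition mfun_of d1 d2 (T1 : measurableType d1) (T2 : measurableType d2)
  (f : T1 -> T2) (mf : measurable_fun setT f) : {mfun T1 >-> T2} :=
  mfun_Sub (mem_set mf).

(** * The joint law of an independent sample *)

Section joint_law.
Context {R : realType} {d0 : measure_display} {Omega : measurableType d0}.
Context {m n : nat}.
Let T := m.-tuple R.
Variables (P : probability Omega R) (X : nat -> Omega -> T).
Hypothesis mX : forall i : 'I_n, measurable_fun setT (X i).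
Hypothesis indX : mutually_independent P n X.

Let V (w : Omega) : n.-tuple T := [tuple X i w | i < n].

Lemma measurable_joint : measurable_fun setT V.
Proof.
apply/measurable_fun_tnthP => j.
rewrite (_ : _ \o _ = X j)//.
by apply/funext => w /=; rewrite tnth_mktuple.
Qed.

Definition joint_law : probability (n.-tuple T) R :=
  distribution P (mfun_of measurable_joint).

Definition marginal (i : 'I_n) : probability T R :=
  distribution P (mfun_of (mX i)).

Let rect (B : 'I_n -> set T) : set (n.-tuple T) :=
  [set x | forall i, B i (tnth x i)].

Let rectE B : rect B = \bigcap_(i in [set: 'I_n]) ((@tnth n T) ^~ i @^-1` B i).
Proof. by apply/seteqP; split => x /= H i; [move=> _|]; exact: H. Qed.

Let measurable_rect B : (forall i, measurable (B i)) -> measurable (rect B).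
Proof.
move=> mB; rewrite rectE; apply: fin_bigcap_measurable => // i _.
by rewrite -[X in measurable X]setTI; exact: measurable_tnth.
Qed.

Let joint_law_rect B : (forall i, measurable (B i)) ->
  joint_law (rect B) = (\prod_(i < n) P (X i @^-1` B i))%E.
Proof.
move=> mB; rewrite -indX// /joint_law/= /distribution /pushforward.
congr (P _); apply/seteqP; split => w /=.
  by move=> H i _ /=; have := H i; rewrite tnth_mktuple.
by move=> H i; rewrite tnth_mktuple; exact: H.
Qed.

(** Rectangles are stable under intersection and generate the sigma-algebra of tuples, so it
    suffices to compare both measures on them. The preimage of a rectangle no longer constrains the
    overwritten coordinate i (this is [B']); its factor comes back from the fresh draw. *)
Lemma joint_law_resampled : resampled joint_law marginal.
Proof.
move=> i A mA.
pose updp := fun p : n.-tuple T * T => upd i p.1 p.2.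
pose G := [set A | exists2 B : 'I_n -> set T,
  (forall i, measurable (B i)) & A = rect B].
have mu_ : measurable_fun setT updp := measurable_upd i.
rewrite -[RHS]/(pushforward (joint_law \x marginal i)%E updp A).
apply: (measure_unique G (fun=> setT)) => //.
- apply/seteqP; split; last first.
    apply: smallest_sub; first exact: sigma_algebra_measurable.
    by move=> _ [B mB ->]; exact: measurable_rect.
  apply: smallest_sub; first exact: smallest_sigma_algebra.
  rewrite -(@bigcup_seq _ _ (index_enum 'I_n)
    (fun i0 => preimage_set_system setT ((@tnth n T) ^~ i0) measurable)).
  move=> B [j _ [C mC <-]]; apply: sub_sigma_algebra.
  exists (fun k => if k == j then C else setT); first by move=> k; case: ifP.
  rewrite setTI; apply/seteqP; split => x /=; first by move=> ? k; case: eqP => [->|].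
  by move=> /(_ j); rewrite eqxx.
- move=> _ _ [B mB ->] [C mC ->]; exists (fun k => B k `&` C k).
    by move=> k; exact: measurableI.
  apply/seteqP; split=> x /=; first by move=> [H1 H2] k; split.
  by move=> H; split=> k; have [] := H k.
- by move=> _; exists (fun=> setT) => //; apply/seteqP; split.
- by rewrite bigcup_const//; exact: set0P.
- move=> _ [B mB ->]; rewrite [LHS](joint_law_rect mB).
  pose B' k := if k == i then setT else B k.
  have mB' k : measurable (B' k) by rewrite /B'; case: ifP.
  have updE : updp @^-1` rect B = rect B' `*` B i.
    apply/seteqP; split=> -[x y] /=; rewrite /rect /B' /=.
      move=> H; split; last by have := H i; rewrite tnth_upd_eq.
      by move=> k; case: eqP => // /eqP ki; have := H k; rewrite tnth_upd_neq.
    by move=> [H yi] k; rewrite tnth_upd; have := H k; case: eqP => // ->.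
  rewrite -[RHS]/((joint_law \x marginal i)%E (updp @^-1` rect B)) updE.
  rewrite [RHS](product_measure1E joint_law (marginal i) (measurable_rect mB') (mB i)).
  rewrite [X in (X * _)%E](joint_law_rect mB') (bigD1 i)//= [in RHS](bigD1 i)//=.
  rewrite {1}/B' eqxx preimage_setT probability_setT mul1e muleC; congr (_ * _)%E.
  by apply: eq_bigr => k /negbTE ki; rewrite /B' ki.
- by move=> _; rewrite -ge0_fin_numE// fin_num_measure.
Qed.

End joint_law.

(** * Kernels centred in a variable and their orthogonality *)

Section degenerate_ustatistic.
Context {R : realType} {d : measure_display} {T : measurableType d} {n : nat}.
Variables (nu : probability (n.-tuple T) R) (mu : 'I_n -> probability T R).
Hypothesis nuE : resampled nu mu.
Implicit Types F : n.-tuple T -> R.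

Definition indep i F := forall x y, F (upd i x y) = F x.

(** The integrability conjunct prevents the default value 0 of a divergent [Rintegral] from counting
    as centring. Asking it for every x makes the property stable under multiplication by functions
    that do not involve coordinate i. *)
Definition degen i F := forall x, L1 (mu i) (fun y => F (upd i x y)) /\
  \int[mu i]_y F (upd i x y) = 0.

Lemma indepM i F F' : indep i F -> indep i F' -> indep i (fun x => F x * F' x).
Proof. by move=> H H' x y; rewrite H H'. Qed.

Lemma degenMr i F F' : degen i F -> indep i F' -> degen i (fun x => F x * F' x).
Proof.
move=> DF iF x; have [L0 E0] := DF x.
have eqF : (fun y => F (upd i x y) * F' (upd i x y)) =
    (fun y => F' x * F (upd i x y)).
  by apply/funext => y; rewrite iF mulrC.
rewrite eqF; split; first exact: L1Z.
by rewrite RintegralZl// E0 mulr0.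
Qed.

Lemma degen_sum i (I : Type) (s : seq I) (p : pred I) (F : I -> n.-tuple T -> R) :
  (forall a, p a -> degen i (F a)) -> degen i (fun x => \sum_(a <- s | p a) F a x).
Proof.
move=> DF x; split; first by apply: L1_sum => a pa; have [] := DF _ pa x.
rewrite Ex_sum; first by rewrite big1// => a pa; have [] := DF _ pa x.
by move=> a pa; have [] := DF _ pa x.
Qed.

Lemma degenB i F F' : degen i F -> degen i F' -> degen i (fun x => F x - F' x).
Proof.
move=> DF DF' x; have [L0 E0] := DF x; have [L0' E0'] := DF' x.
by split; [exact: L1B|rewrite RintegralB// E0 E0' subrr].
Qed.

Lemma degenZ i (k : R) F : degen i F -> degen i (fun x => k * F x).
Proof.
move=> DF x; have [L0 E0] := DF x.
by split; [exact: L1Z|rewrite RintegralZl// E0 mulr0].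
Qed.

Lemma Ex_degen i F : L1 nu F -> degen i F -> \int[nu]_x F x = 0.
Proof. by move=> LF DF; apply: (Ex_resample_eq0 nuE (i := i)) => // x; case: (DF x). Qed.

Lemma Ex_sqrD (F F' : n.-tuple T -> R) (S : R) : L2 nu F -> L2 nu F' ->
  \int[nu]_x F x ^+ 2 <= S -> \int[nu]_x F' x ^+ 2 <= S ->
  \int[nu]_x (F x * F' x) <= S.
Proof.
move=> HF HF' FS FS'.
have L := L1Z (2^-1) (L1D HF.2 HF'.2).
apply: (@le_trans _ _ (\int[nu]_x (2^-1 * (F x ^+ 2 + F' x ^+ 2)))).
  apply: le_Ex => //; first exact: L2M.
  by move=> x; have := sqr_ge0 (F x - F' x); rewrite sqrrB; lra.
rewrite RintegralZl// ?RintegralD//; last by apply: L1D; [exact: HF.2|exact: HF'.2].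
- lra.
- exact: HF.2.
- exact: HF'.2.
Qed.

(* Kernels that are centred in each variable of their support are orthogonal
   unless the supports coincide. *)
Lemma Ex_sqr_sum_orth (I : finType) (p : pred I) (q : I -> n.-tuple T -> R)
    (supp : I -> {set 'I_n}) (m : nat) (S : R) : 0 <= S ->
  (forall a, p a -> L2 nu (q a)) ->
  (forall a i, p a -> i \in supp a -> degen i (q a)) ->
  (forall a b i, p a -> p b -> i \in supp a -> i \notin supp b ->
    indep i (q b)) ->
  (forall a, p a -> \int[nu]_x q a x ^+ 2 <= S) ->
  (forall a, p a -> (#|[pred b | supp b == supp a]| <= m)%N) ->
  \int[nu]_x (\sum_(a | p a) q a x) ^+ 2 <= m%:R * #|I|%:R * S.
Proof.
move=> S0 Lq Dq Iq qS cq.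
have sqE x : (\sum_(a | p a) q a x) ^+ 2 =
    \sum_(a | p a) \sum_(b | p b) (q a x * q b x).
  by rewrite expr2 mulr_suml; apply: eq_bigr => a _; rewrite mulr_sumr.
have L a b : p a -> p b -> L1 nu (fun x => q a x * q b x).
  by move=> pa pb; apply: L2M; exact: Lq.
under eq_Rintegral do rewrite sqE.
rewrite Ex_sum => [|a pa]; last by apply: L1_sum => b pb; exact: L.
apply: (@le_trans _ _ (\sum_(a | p a) \sum_(b | supp b == supp a) S)).
  apply: ler_sum => a pa; rewrite Ex_sum => [|b pb]; last exact: L.
  rewrite big_mkcond [leRHS]big_mkcond; apply: ler_sum => b _.
  case: ifP => pb; last by case: ifP.
  case: ifPn => ab; first by apply: Ex_sqrD; [exact: Lq|exact: Lq|exact: qS|exact: qS].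
  suff /existsP[i /orP[/andP[ia ib]|/andP[ia ib]]] : [exists i,
      (i \in supp a) && (i \notin supp b) || (i \in supp b) && (i \notin supp a)].
  - by rewrite (@Ex_degen i)//; [exact: L|apply: degenMr; [exact: Dq|exact: (Iq a)]].
  - under eq_Rintegral do rewrite mulrC.
    by rewrite (@Ex_degen i)//; [exact: L|apply: degenMr; [exact: Dq|exact: (Iq b)]].
  apply: contraR ab => /existsPn H; apply/eqP/setP => i.
  by have := H i; case: (i \in supp a); case: (i \in supp b).
rewrite -mulrA [leRHS]mulrCA; apply: (@le_trans _ _ (\sum_(a | p a) m%:R * S)).
  apply: ler_sum => a pa; rewrite sumr_const -[leLHS]mulr_natl ler_wpM2r// ler_nat.
  exact: cq.
rewrite sumr_const -[leLHS]mulr_natl ler_wpM2r ?mulr_ge0// ler_nat.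
exact: max_card.
Qed.

End degenerate_ustatistic.

Lemma sqr_sum_le (R : realDomainType) (I : finType) (a : I -> R) :
  (\sum_i a i) ^+ 2 <= #|I|%:R * \sum_i a i ^+ 2.
Proof.
have E : \sum_i \sum_j (a i ^+ 2 + a j ^+ 2) = 2 * (#|I|%:R * \sum_i a i ^+ 2).
  under eq_bigr do rewrite big_split/= sumr_const -[X in X + _]mulr_natl.
  by rewrite big_split/= -mulr_sumr sumr_const -[X in _ + X]mulr_natl; ring.
rewrite -(@ler_pM2l _ 2)// -E expr2 mulr_suml mulr_sumr; apply: ler_sum => i _.
rewrite mulr_sumr mulr_sumr; apply: ler_sum => j _.
by have := sqr_ge0 (a i - a j); rewrite sqrrB mulr2n; lra.
Qed.

(** * Moments of the degenerate U-statistic and Stein's bound *)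

Section kernel.
Context {R : realType} {d : measure_display} {T : measurableType d} {n : nat}.
Variables (nu : probability (n.-tuple T) R) (mu : 'I_n -> probability T R).
Hypothesis nuE : resampled nu mu.
(** [G] is the convolution square of [h], and [c] is the variance of [h]. The laws [mu i] are not
    assumed equal: [h_conv] asks that they all produce the same [G]. The bounds are uniform in the
    fixed argument. *)
Variables (h G : T -> T -> R) (c B Q : R).
Hypothesis mh : measurable_fun setT (fun p : T * T => h p.1 p.2).
Hypothesis mG : measurable_fun setT (fun p : T * T => G p.1 p.2).
Hypothesis hC : forall x y, h x y = h y x.
Hypothesis h_int0 : forall i x, \int[mu i]_y h x y = 0.
Hypothesis h_conv : forall i x y, \int[mu i]_z (h x z * h y z) = G x y.
Hypothesis G_diag : forall x, G x x = c.
Hypothesis h_L4 : forall i x, (\int[mu i]_y (h x y ^+ 4)%:E <= B%:E)%E.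
Hypothesis G_L2 : forall i x, (\int[mu i]_y (G x y ^+ 2)%:E <= Q%:E)%E.
Hypothesis G_int0 : forall i x, \int[mu i]_y G x y = 0.
Hypotheses (B0 : 0 <= B) (Q0 : 0 <= Q).

Notation V := (n.-tuple T).

(** The zero diagonal lets sums run over all ordered pairs; each unordered pair then occurs twice,
    hence the factor 1/2 in [ustat]. *)
Definition hij (i j : 'I_n) (x : V) : R :=
  if i == j then 0 else h (tnth x i) (tnth x j).

Definition Gij (i j : 'I_n) (x : V) : R := G (tnth x i) (tnth x j).

Definition row_sum (i : 'I_n) (x : V) : R := \sum_j hij i j x.

Definition ustat (x : V) : R := 2^-1 * \sum_i row_sum i x.

Let measurable_sectl (k : T -> T -> R) y :
  measurable_fun setT (fun p : T * T => k p.1 p.2) -> measurable_fun setT (k y).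
Proof.
move=> mk; apply: (measurableT_comp mk (g := fun z => (y, z))).
exact: measurable_fun_pair.
Qed.

Let measurable_pair (k : T -> T -> R) i j :
  measurable_fun setT (fun p : T * T => k p.1 p.2) ->
  measurable_fun setT (fun x : V => k (tnth x i) (tnth x j)).
Proof.
move=> mk; apply: (measurableT_comp mk (g := fun x : V => (tnth x i, tnth x j))).
by apply: measurable_fun_pair; exact: measurable_tnth.
Qed.

Let L4_h i x : L4 (mu i) (h x).
Proof.
have mhx := measurable_sectl x mh.
split => //; apply: (@ge0_L1 _ _ _ _ _ B) => //; first exact: measurable_funX.
by move=> y; rewrite exprn_even_ge0.
Qed.

Let L2_G i x : L2 (mu i) (G x).
Proof.
have mGx := measurable_sectl x mG.
split => //; apply: (@ge0_L1 _ _ _ _ _ Q) => //; first exact: measurable_funX.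
by move=> y; rewrite sqr_ge0.
Qed.

Lemma GC (i0 : 'I_n) x y : G x y = G y x.
Proof.
by rewrite -!(h_conv i0); apply: eq_Rintegral => z _; rewrite mulrC.
Qed.

Lemma hijC i j x : hij i j x = hij j i x.
Proof. by rewrite /hij eq_sym; case: ifP => // _; rewrite hC. Qed.

Lemma hij_neq i j x : i != j -> hij i j x = h (tnth x i) (tnth x j).
Proof. by rewrite /hij => /negbTE ->. Qed.

Lemma hijii i x : hij i i x = 0.
Proof. by rewrite /hij eqxx. Qed.

Lemma hij_updr i j x y : i != j -> hij i j (upd j x y) = h (tnth x i) y.
Proof. by move=> ij; rewrite hij_neq// tnth_upd_eq tnth_upd_neq. Qed.

Lemma hij_updl i j x y : i != j -> hij i j (upd i x y) = h (tnth x j) y.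
Proof. by move=> ij; rewrite hijC hij_updr// eq_sym. Qed.

Lemma indep_hij k i j : k != i -> k != j -> indep k (hij i j).
Proof.
by move=> ki kj x y; rewrite /hij; case: ifP => // _;
  rewrite !tnth_upd_neq// eq_sym.
Qed.

Lemma indep_Gij k i j : k != i -> k != j -> indep k (Gij i j).
Proof. by move=> ki kj x y; rewrite /Gij !tnth_upd_neq// eq_sym. Qed.

Lemma degen_hijr i j : i != j -> degen mu j (hij i j).
Proof.
move=> ij x; rewrite (_ : (fun y => _) = h (tnth x i)).
  by split=> //; apply/L2W/L4W/L4_h.
by apply/funext => y; rewrite hij_updr.
Qed.

Lemma degen_hijl i j : i != j -> degen mu i (hij i j).
Proof.
move=> ij; rewrite (_ : hij i j = hij j i); first by apply: degen_hijr; rewrite eq_sym.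
by apply/funext => x; rewrite hijC.
Qed.

Lemma degen_Gijr i j : i != j -> degen mu j (Gij i j).
Proof.
move=> ij x; rewrite (_ : (fun y => _) = G (tnth x i)).
  by split=> //; apply/L2W/L2_G.
by apply/funext => y; rewrite /Gij tnth_upd_eq tnth_upd_neq.
Qed.

Lemma degen_Gijl i j : i != j -> degen mu i (Gij i j).
Proof.
move=> ij; rewrite (_ : Gij i j = Gij j i); first by apply: degen_Gijr; rewrite eq_sym.
by apply/funext => x; rewrite /Gij (GC i).
Qed.

Lemma hij_L4_le i j : (\int[nu]_x (hij i j x ^+ 4)%:E <= B%:E)%E.
Proof.
have [->|ij] := eqVneq i j.
  under eq_integral do rewrite hijii expr0n/=.
  by rewrite integral0 lee_fin.
apply: (resample_le nuE (i := j)).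
- rewrite (_ : (fun x => _) = fun x : V => h (tnth x i) (tnth x j) ^+ 4).
    by apply: measurable_funX; exact: (measurable_pair i j mh).
  by apply/funext => x; rewrite hij_neq.
- by move=> x; rewrite exprn_even_ge0.
- by move=> x; under eq_integral do rewrite hij_updr//; exact: h_L4.
Qed.

Lemma measurable_hij i j : measurable_fun setT (hij i j).
Proof.
rewrite /hij; case: (i == j); first exact: measurable_cst.
exact: (measurable_pair i j mh).
Qed.

Lemma L4_hij i j : L4 nu (hij i j).
Proof.
split; first exact: measurable_hij.
apply: (@ge0_L1 _ _ _ _ _ B); last exact: hij_L4_le.
  by apply: measurable_funX; exact: measurable_hij.
by move=> x; rewrite exprn_even_ge0.
Qed.

Lemma Ex_hij4 i j : \int[nu]_x hij i j x ^+ 4 <= B.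
Proof.
apply: ge0_Ex_le; last exact: hij_L4_le.
  by apply: measurable_funX; exact: measurable_hij.
by move=> x; rewrite exprn_even_ge0.
Qed.

Lemma Ex_hij2 i j : i != j -> \int[nu]_x hij i j x ^+ 2 = c.
Proof.
move=> ij; apply: (Ex_resample_cst nuE (i := j)) => [|x|x].
- exact: (L4W (L4_hij i j)).2.
- by apply: (L1_ext (L4W (L4_h j (tnth x i))).2) => y; rewrite hij_updr.
- under eq_Rintegral do rewrite hij_updr// expr2.
  by rewrite h_conv G_diag.
Qed.

Lemma L2_hijM i j k l : L2 nu (fun x => hij i j x * hij k l x).
Proof. by apply: L4M; exact: L4_hij. Qed.

Lemma Ex_hijM2 i j k l : \int[nu]_x (hij i j x * hij k l x) ^+ 2 <= B.
Proof.
under eq_Rintegral do rewrite exprMn.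
apply: Ex_sqrD; try exact: L4_sqr (L4_hij _ _).
- by under eq_Rintegral do rewrite -exprM; exact: Ex_hij4.
- by under eq_Rintegral do rewrite -exprM; exact: Ex_hij4.
Qed.

Lemma Gij_L2_le i j : i != j -> (\int[nu]_x (Gij i j x ^+ 2)%:E <= Q%:E)%E.
Proof.
move=> ij; apply: (resample_le nuE (i := j)).
- by apply: measurable_funX; exact: (measurable_pair i j mG).
- by move=> x; rewrite sqr_ge0.
- move=> x; under eq_integral do rewrite /Gij tnth_upd_eq tnth_upd_neq//.
  exact: G_L2.
Qed.

Lemma L2_Gij i j : i != j -> L2 nu (Gij i j).
Proof.
move=> ij; split; first exact: (measurable_pair i j mG).
apply: (@ge0_L1 _ _ _ _ _ Q); last exact: Gij_L2_le.
  by apply: measurable_funX; exact: (measurable_pair i j mG).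
by move=> x; rewrite sqr_ge0.
Qed.

Lemma Ex_Gij2 i j : i != j -> \int[nu]_x Gij i j x ^+ 2 <= Q.
Proof.
move=> ij; apply: ge0_Ex_le; last exact: Gij_L2_le.
  by apply: measurable_funX; exact: (measurable_pair i j mG).
by move=> x; rewrite sqr_ge0.
Qed.

Lemma c_ge0 (i0 : 'I_n) (x0 : T) : 0 <= c.
Proof.
rewrite -(G_diag x0) -(h_conv i0); apply: Rintegral_ge0 => y _.
by rewrite -expr2 sqr_ge0.
Qed.

Lemma L4_row_sum i : L4 nu (row_sum i).
Proof. by apply: L4_sum => j _; exact: L4_hij. Qed.

Lemma L4_ustat : L4 nu ustat.
Proof. by apply: L4Z; apply: L4_sum => i _; exact: L4_row_sum. Qed.

Lemma degen_row_sum i : degen mu i (row_sum i).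
Proof.
apply: degen_sum => j _; have [<-|ij] := eqVneq i j; last exact: degen_hijl.
move=> x; rewrite (_ : (fun y => _) = cst 0).
  by split; [exact: L1_cst|exact: Ex_cst].
by apply/funext => y; rewrite hijii.
Qed.

(** Index i occurs in the full double sum once as a row and once as a column, and by symmetry both
    contribute [row_sum i]. Half of the total minus [row_sum i] therefore keeps exactly the pairs
    avoiding i. *)
Lemma ustatB_row_sum i x :
  ustat x - row_sum i x = 2^-1 * \sum_(j | j != i) \sum_(k | k != i) hij j k x.
Proof.
rewrite /ustat (bigD1 i)//= [X in _ * (_ + X)](_ : _ = \sum_(j | j != i) hij j i x +
  \sum_(j | j != i) \sum_(k | k != i) hij j k x); last first.
  by rewrite -big_split/=; apply: eq_bigr => j _; rewrite /row_sum (bigD1 i).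
rewrite [X in _ * (_ + (X + _))](_ : _ = row_sum i x); first lra.
rewrite /row_sum [RHS](bigD1 i)//= hijii add0r.
by apply: eq_bigr => j _; rewrite hijC.
Qed.

Lemma indep_ustatB_row_sum i : indep i (fun x => ustat x - row_sum i x).
Proof.
move=> x y; rewrite !ustatB_row_sum; congr (_ * _); apply: eq_bigr => j ji.
by apply: eq_bigr => k ki; apply: indep_hij; rewrite eq_sym.
Qed.

Lemma Ex_row_sum2 (x0 : T) i : \int[nu]_x row_sum i x ^+ 2 <= n%:R * c.
Proof.
have c0 := c_ge0 i x0.
have E x : row_sum i x = \sum_(j | j != i) hij i j x.
  by rewrite /row_sum (bigD1 i)//= hijii add0r.
under eq_Rintegral do rewrite E.
rewrite -[n%:R]mul1r -[in leRHS](card_ord n).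
(* The row index i is treated as a parameter: centring in j alone already separates distinct terms,
   so the supports are singletons and the bound is linear in n. *)
apply: (Ex_sqr_sum_orth nuE (supp := fun j => [set j]%SET) (m := 1)) => //.
- by move=> j _; exact: L4W (L4_hij _ _).
- by move=> j k ji; rewrite inE => /eqP ->; apply: degen_hijr; rewrite eq_sym.
- move=> j k l ji ki; rewrite !inE => /eqP -> jk.
  by apply: indep_hij => //.
- by move=> j ji; rewrite Ex_hij2// eq_sym.
- move=> j _; rewrite (eq_card (B := pred1 j)) ?card1// => k.
  by rewrite !inE; apply/eqP/eqP => [/set1_inj|->].
Qed.

(** Equality of supports forces every entry of b into the given set. The crude counts 2^2 here and
    3^3 for triples below are the source of the constants 4 and 27. *)
Lemma card_same_pair (i j : 'I_n) :
  (#|[pred b : 'I_n * 'I_n | [set b.1; b.2]%SET == [set i; j]%SET]| <= 4)%N.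
Proof.
pose S := [set i; j]%SET.
apply: (@leq_trans #|finset.setX S S|).
  apply: subset_leq_card; apply/fintype.subsetP => -[k l]; rewrite !inE/= => /eqP /setP H.
  by have := H k; have := H l; rewrite !inE !eqxx ?orbT => <- <-.
rewrite cardsX -[4%N]/(2 * 2)%N; apply: leq_mul; rewrite cards2; case: (_ != _) => //.
Qed.

Lemma card_same_triple (i j k : 'I_n) :
  (#|[pred b : 'I_n * 'I_n * 'I_n |
     [set b.1.1; b.1.2; b.2]%SET == [set i; j; k]%SET]| <= 27)%N.
Proof.
pose S := [set i; j; k]%SET.
have S3 : (#|S| <= 3)%N.
  rewrite /S -finset.setUA cardsU1 cards2.
  by case: (_ \notin _); case: (_ != _).
apply: (@leq_trans #|finset.setX (finset.setX S S) S|).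
  apply: subset_leq_card; apply/fintype.subsetP => -[[a b] e]; rewrite !inE/= => /eqP /setP H.
  have := H a; have := H b; have := H e; rewrite !inE !eqxx ?orbT/=.
  by move=> <- <- <-.
by rewrite !cardsX -[27%N]/(3 * 3 * 3)%N; do 2! apply: leq_mul => //.
Qed.

Lemma Ex_ustat2 (x0 : T) : \int[nu]_x ustat x ^+ 2 <= n%:R ^+ 2 * c.
Proof.
(* Without an index there is no law from which to deduce that c is nonnegative; the statistic is
   then an empty sum. *)
have [i0|n0] := pickP [pred i : 'I_n | true]; last first.
  have E x : ustat x = 0 by rewrite /ustat big1 ?mulr0// => i; have := n0 i.
  under eq_Rintegral do rewrite E expr0n/=.
  rewrite Ex_cst; case: (posnP n) => [->|n1]; first by rewrite expr0n mul0r.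
  by have := n0 (Ordinal n1).
move=> _; have c0 := c_ge0 i0 x0.
have E x : ustat x = 2^-1 * \sum_(a : 'I_n * 'I_n | a.1 != a.2) hij a.1 a.2 x.
  rewrite /ustat pair_big_dep/= [in RHS]big_mkcond/=; congr (_ * _).
  by apply: eq_bigr => -[i j] _ /=; case: ifPn => // /negPn/eqP ->; rewrite hijii.
under eq_Rintegral do rewrite E exprMn.
have L : L2 nu (fun x => \sum_(a : 'I_n * 'I_n | a.1 != a.2) hij a.1 a.2 x).
  by apply: L2_sum => a _; exact: L4W (L4_hij _ _).
rewrite RintegralZl//; last exact: L.2.
suff : \int[nu]_x (\sum_(a : 'I_n * 'I_n | a.1 != a.2) hij a.1 a.2 x) ^+ 2 <=
   4%:R * #|{: 'I_n * 'I_n}|%:R * c.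
  by rewrite card_prod card_ord natrM; lra.
apply: (Ex_sqr_sum_orth nuE (supp := fun a => [set a.1; a.2]%SET)) => //.
- by move=> a _; exact: L4W (L4_hij _ _).
- move=> a i aa; rewrite !inE => /orP[]/eqP ->; [exact: degen_hijl|exact: degen_hijr].
- move=> a b i _ _ _; rewrite !inE negb_or => /andP[? ?]; exact: indep_hij.
- by move=> a aa; rewrite Ex_hij2.
- by move=> a _; exact: card_same_pair.
Qed.
Lemma row_sum_sqr i x : row_sum i x ^+ 2 = \sum_j hij i j x ^+ 2 +
  \sum_(a : 'I_n * 'I_n | [&& a.1 != a.2, a.1 != i & a.2 != i])
     hij i a.1 x * hij i a.2 x.
Proof.
rewrite /row_sum expr2 big_distrlr/=.
transitivity (\sum_j (hij i j x ^+ 2 +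
    \sum_(k | k != j) hij i j x * hij i k x)).
  by apply: eq_bigr => j _; rewrite (bigD1 j)//= expr2.
rewrite big_split/=; congr (_ + _); rewrite pair_big_dep/=.
rewrite big_mkcond [RHS]big_mkcond/=; apply: eq_bigr => -[j k] _ /=.
rewrite [k == j]eq_sym; case: (j != k) => //=.
have [->|] := eqVneq j i; first by rewrite hijii mul0r.
by have [->|//] := eqVneq k i; rewrite hijii mulr0.
Qed.

(** The square of the row sum splits into its diagonal [D], handled by Cauchy-Schwarz (n^2 B), and
    its off-diagonal part [O], handled by orthogonality in the two column variables (4 n^2 B).
    Doubling both gives 10. The order n^2 instead of n^4 is what makes the Taylor errors in Stein's
    method negligible. *)
Lemma Ex_row_sum4 i : \int[nu]_x row_sum i x ^+ 4 <= 10 * n%:R ^+ 2 * B.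
Proof.
pose p := [pred a : 'I_n * 'I_n | [&& a.1 != a.2, a.1 != i & a.2 != i]].
pose D x := \sum_j hij i j x ^+ 2.
pose O x := \sum_(a | p a) hij i a.1 x * hij i a.2 x.
have LD : L2 nu D by apply: L2_sum => j _; exact: L4_sqr (L4_hij _ _).
have LO : L2 nu O by apply: L2_sum => a _; exact: L2_hijM.
have DB : \int[nu]_x D x ^+ 2 <= n%:R * (n%:R * B).
  apply: (@le_trans _ _ (\int[nu]_x (n%:R * \sum_j hij i j x ^+ 4))).
    apply: le_Ex; first exact: LD.2.
      by apply: L1Z; apply: L1_sum => j _; exact: (L4_hij _ _).2.
    move=> x; apply: le_trans (sqr_sum_le _) _; rewrite card_ord.
    by under eq_bigr do rewrite -exprM.
  rewrite RintegralZl//; last by apply: L1_sum => j _; exact: (L4_hij _ _).2.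
  rewrite ler_wpM2l// Ex_sum; last by move=> j _; exact: (L4_hij _ _).2.
  rewrite mulr_natl -[X in _ *+ X]card_ord -sumr_const.
  by apply: ler_sum => j _; exact: Ex_hij4.
have OB : \int[nu]_x O x ^+ 2 <= 4%:R * #|{: 'I_n * 'I_n}|%:R * B.
  apply: (Ex_sqr_sum_orth nuE (supp := fun a => [set a.1; a.2]%SET)) => //.
  - by move=> a _; exact: L2_hijM.
  - move=> a j /and3P[a12 a1 a2]; rewrite !inE => /orP[]/eqP ->.
      apply: degenMr; first by apply: degen_hijr; rewrite eq_sym.
      exact: indep_hij.
    rewrite (_ : (fun x => _) = fun x => hij i a.2 x * hij i a.1 x).
      apply: degenMr; first by apply: degen_hijr; rewrite eq_sym.
      by apply: indep_hij => //; rewrite eq_sym.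
    by apply/funext => x; rewrite mulrC.
  - move=> a b j /and3P[a12 a1 a2] pb; rewrite !inE negb_or => ja /andP[j1 j2].
    have ji : j != i by case/orP : ja => /eqP ->.
    by apply: indepM; exact: indep_hij.
  - by move=> a _; exact: Ex_hijM2.
  - by move=> a _; exact: card_same_pair.
rewrite card_prod card_ord natrM in OB.
apply: (@le_trans _ _ (\int[nu]_x (2 * D x ^+ 2 + 2 * O x ^+ 2))).
  apply: le_Ex; first exact: (L4_row_sum i).2.
    by apply: L1D; apply: L1Z; [exact: LD.2|exact: LO.2].
  move=> x; rewrite -[4%N]/(2 * 2)%N exprM row_sum_sqr.
  by rewrite -/(D x) -/(O x); have := sqr_ge0 (D x - O x); nra.
rewrite RintegralD//; try by apply: L1Z; [exact: LD.2|exact: LO.2].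
- rewrite !RintegralZl//; [nra|exact: LO.2|exact: LD.2].
- by apply: L1Z; exact: LD.2.
- by apply: L1Z; exact: LO.2.
Qed.

Definition half_energy (x : V) : R := 2^-1 * \sum_i row_sum i x ^+ 2.

Let pair_neq := [pred a : 'I_n * 'I_n | a.1 != a.2].
Let triple_neq := [pred b : 'I_n * 'I_n * 'I_n |
  [&& b.1.2 != b.2, b.1.2 != b.1.1 & b.2 != b.1.1]].
(** Pieces of the decomposition: [cmean] is the expectation of [half_energy]. Projecting the product
    of [hij i j] and [hij i k] onto the variables j, k gives [Gij j k] once for every row i distinct
    from both, and [mult] counts these rows. *)
Let mult (a : 'I_n * 'I_n) : R := \sum_(i | (a.1 != i) && (a.2 != i)) 1.
Let cmean : R := 2^-1 * \sum_(i : 'I_n) \sum_(j : 'I_n | j != i) c.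
Let q1 (a : 'I_n * 'I_n) x := hij a.1 a.2 x ^+ 2 - c.
Let q2 (b : 'I_n * 'I_n * 'I_n) x :=
  hij b.1.1 b.1.2 x * hij b.1.1 b.2 x - Gij b.1.2 b.2 x.
Let q3 (a : 'I_n * 'I_n) x := mult a * Gij a.1 a.2 x.

(* Hoeffding decomposition of the quadratic form [\sum_i row_sum i ^ 2]. *)
Let half_energy_hoeffding x : 2 * (half_energy x - cmean) =
  \sum_(a | pair_neq a) q1 a x + \sum_(b | triple_neq b) q2 b x +
  \sum_(a | pair_neq a) q3 a x.
Proof.
have E1 : \sum_(a | pair_neq a) q1 a x = \sum_i \sum_j hij i j x ^+ 2 -
    \sum_(i : 'I_n) \sum_(j : 'I_n | j != i) c.
  rewrite /q1 sumrB !pair_big_dep/=; congr (_ - _).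
    rewrite big_mkcond/=; apply: eq_bigr => -[i j] _ /=.
    by case: ifPn => // /negPn/eqP ->; rewrite hijii expr0n.
  by apply: eq_bigl => -[i j] /=; rewrite eq_sym.
have E3 : \sum_(a | pair_neq a) q3 a x =
    \sum_(b | triple_neq b) Gij b.1.2 b.2 x.
  transitivity (\sum_(a | pair_neq a) \sum_(i | (a.1 != i) && (a.2 != i))
      Gij a.1 a.2 x).
    by apply: eq_bigr => a _; rewrite /q3 /mult mulr_suml;
      apply: eq_bigr => i _; rewrite mul1r.
  rewrite pair_big_dep/= (reindex (fun b : 'I_n * 'I_n * 'I_n =>
      ((b.1.2, b.2), b.1.1)))/=; last first.
    exists (fun e : 'I_n * 'I_n * 'I_n => ((e.2, e.1.1), e.1.2)) => [[[? ?] ?]|[[? ?] ?]] //.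
  by apply: eq_bigl => -[[i j] k].
have E2 : \sum_(b | triple_neq b) q2 b x =
    \sum_i \sum_(a : 'I_n * 'I_n | [&& a.1 != a.2, a.1 != i & a.2 != i])
      hij i a.1 x * hij i a.2 x - \sum_(b | triple_neq b) Gij b.1.2 b.2 x.
  rewrite /q2 sumrB; congr (_ - _); rewrite pair_big_dep/=.
  rewrite (reindex (fun b : 'I_n * ('I_n * 'I_n) => ((b.1, b.2.1), b.2.2)))/=.
    by apply: eq_bigl => -[i [j k]].
  by exists (fun e : 'I_n * 'I_n * 'I_n => (e.1.1, (e.1.2, e.2))) => [[? [? ?]]|[[? ?] ?]].
rewrite E1 E2 E3 /half_energy /cmean; under eq_bigr do rewrite row_sum_sqr.
by rewrite big_split/=; lra.
Qed.

Let LP_q1 a : pair_neq a -> L2 nu (q1 a).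
Proof. by move=> _; apply: L2B; [exact: L4_sqr (L4_hij _ _)|exact: L2_cst]. Qed.

Let LP_q2 b : triple_neq b -> L2 nu (q2 b).
Proof. by case/and3P => ? ? ?; apply: L2B; [exact: L2_hijM|exact: L2_Gij]. Qed.

Let LP_q3 a : pair_neq a -> L2 nu (q3 a).
Proof. by move=> ?; apply: L2Z; exact: L2_Gij. Qed.

Let Ex_q1 : \int[nu]_x (\sum_(a | pair_neq a) q1 a x) ^+ 2 <=
  4%:R * #|{: 'I_n * 'I_n}|%:R * B.
Proof.
have D i j : i != j -> degen mu j (fun x => hij i j x ^+ 2 - c).
  move=> ij x; have L := (L4W (L4_h j (tnth x i))).2.
  rewrite (_ : (fun y => _) = fun y => h (tnth x i) y ^+ 2 - c); last first.
    by apply/funext => y; rewrite hij_updr.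
  split; first by apply: L1B => //; exact: L1_cst.
  rewrite RintegralB//; last exact: L1_cst.
  by rewrite Ex_cst; under eq_Rintegral do rewrite expr2; rewrite h_conv G_diag subrr.
apply: (Ex_sqr_sum_orth nuE (supp := fun a => [set a.1; a.2]%SET)) => //.
- move=> a i aa; rewrite !inE => /orP[]/eqP ->; last exact: D.
  rewrite (_ : q1 a = fun x => hij a.2 a.1 x ^+ 2 - c); first by apply: D; rewrite eq_sym.
  by apply/funext => x; rewrite /q1 hijC.
- move=> a b i _ _ _; rewrite !inE negb_or => /andP[? ?] x y.
  by rewrite /q1 indep_hij.
- move=> a aa; have L := L4_sqr (L4_hij a.1 a.2).
  apply: (@le_trans _ _ (\int[nu]_x (hij a.1 a.2 x ^+ 4 - 2 * c * hij a.1 a.2 x ^+ 2 + c ^+ 2))).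
    rewrite le_eqVlt; apply/orP; left; apply/eqP; apply: eq_Rintegral => x _.
    by rewrite /q1; ring.
  have L1' : L1 nu (fun x => 2 * c * hij a.1 a.2 x ^+ 2) by apply: L1Z; exact: L2W.
  have L4' := (L4_hij a.1 a.2).2.
  rewrite RintegralD//; [|exact: L1B|exact: L1_cst].
  rewrite RintegralB// RintegralZl//; last exact: L2W.
  rewrite Ex_hij2// Ex_cst; have := Ex_hij4 a.1 a.2; have := sqr_ge0 c; nra.
- by move=> a _; exact: card_same_pair.
Qed.

Let degen_q2_mid i j k : j != k -> j != i -> k != i ->
  degen mu j (fun x => hij i j x * hij i k x - Gij j k x).
Proof.
move=> jk ji ki; apply: degenB; last exact: degen_Gijl.
by apply: degenMr; [apply: degen_hijr; rewrite eq_sym|exact: indep_hij].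
Qed.

(** [q2] is centred in the row variable because the mean of the product of the two entries is
    exactly the subtracted [Gij], and in each column variable because [h] and [G] are separately
    centred. *)
Let Ex_q2 : \int[nu]_x (\sum_(b | triple_neq b) q2 b x) ^+ 2 <=
  27%:R * #|{: 'I_n * 'I_n * 'I_n}|%:R * (2 * B + 2 * Q).
Proof.
apply: (Ex_sqr_sum_orth nuE (supp := fun b => [set b.1.1; b.1.2; b.2]%SET)) => //.
- by rewrite addr_ge0// mulr_ge0.
- move=> [[i j] k] l /and3P[/= jk ji ki]; rewrite !inE/= /q2/=.
  move=> /orP[/orP[/eqP ->|/eqP ->]|/eqP ->].
  + move=> x; have Lj := L4W (L4_h i (tnth x j)); have Lk := L4W (L4_h i (tnth x k)).
    rewrite (_ : (fun y => _) = fun y =>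
        h (tnth x j) y * h (tnth x k) y - G (tnth x j) (tnth x k)); last first.
      by apply/funext => y; rewrite !hij_updl 1?eq_sym// /Gij !tnth_upd_neq.
    split; first by apply: L1B; [exact: L2M|exact: L1_cst].
    rewrite RintegralB//; [|exact: L2M|exact: L1_cst].
    by rewrite Ex_cst h_conv subrr.
  + exact: degen_q2_mid.
  + rewrite (_ : (fun x => _) = fun x => hij i k x * hij i j x - Gij k j x).
      by apply: degen_q2_mid => //; rewrite eq_sym.
    by apply/funext => x; rewrite mulrC /Gij (GC i).
- move=> a b i _ _ _; rewrite !inE !negb_or => /andP[/andP[? ?] ?] x y.
  by rewrite /q2 !indep_hij// indep_Gij.
- move=> [[i j] k] /and3P[/= jk ji ki].
  have L := L2_hijM i j i k; have LG := L2_Gij jk.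
  apply: (@le_trans _ _ (\int[nu]_x (2 * (hij i j x * hij i k x) ^+ 2 +
      2 * Gij j k x ^+ 2))).
    apply: le_Ex.
    - by apply: (LP_q2 (b := ((i, j), k)) _).2; rewrite /= jk ji ki.
    - by apply: L1D; apply: L1Z; [exact: L.2|exact: LG.2].
    - move=> x; rewrite /q2/=; set u := hij i j x * _; set w := Gij j k x.
      by have := sqr_ge0 (u + w); nra.
  rewrite RintegralD//; [|by apply: L1Z; exact: L.2|by apply: L1Z; exact: LG.2].
  rewrite !RintegralZl//; [|exact: LG.2|exact: L.2].
  have := Ex_hijM2 i j i k; have := Ex_Gij2 jk; lra.
- by move=> [[i j] k] _; exact: card_same_triple.
Qed.

(** Here [mult a] is of order n, and its square contributes n^2 on top of the n^2 pairs: this is the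
    origin of the term n^4 Q. *)
Let Ex_q3 : \int[nu]_x (\sum_(a | pair_neq a) q3 a x) ^+ 2 <=
  4%:R * #|{: 'I_n * 'I_n}|%:R * (n%:R ^+ 2 * Q).
Proof.
apply: (Ex_sqr_sum_orth nuE (supp := fun a => [set a.1; a.2]%SET)) => //.
- by rewrite mulr_ge0// sqr_ge0.
- move=> a i aa; rewrite !inE => /orP[]/eqP ->; apply: degenZ;
    [exact: degen_Gijl|exact: degen_Gijr].
- move=> a b i _ _ _; rewrite !inE negb_or => /andP[? ?] x y.
  by rewrite /q3 indep_Gij.
- move=> a aa; have LG := L2_Gij aa.
  rewrite /q3; under eq_Rintegral do rewrite exprMn.
  rewrite RintegralZl//; last exact: LG.2.
  apply: ler_pM; rewrite ?sqr_ge0//.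
  + by apply: Rintegral_ge0 => x _; rewrite sqr_ge0.
  + have m0 : 0 <= mult a by apply: sumr_ge0.
    rewrite lerXn2r ?nnegrE// /mult sumr_const ler_nat -[leqRHS](card_ord n).
    exact: max_card.
  + exact: Ex_Gij2.
- by move=> a _; exact: card_same_pair.
Qed.

Lemma half_energy_var : (0 < n)%N ->
  \int[nu]_x (half_energy x - 2^-1 * n%:R * (n%:R - 1) * c) ^+ 2 <=
  44 * (n%:R ^+ 3 * B + n%:R ^+ 4 * Q).
Proof.
move=> n0.
have -> : 2^-1 * n%:R * (n%:R - 1) * c = cmean.
  rewrite /cmean -!mulrA; congr (_ * _).
  under eq_bigr => i _.
    rewrite sumr_const (eq_card (B := predC1 i)); last by move=> j; rewrite !inE.
    rewrite cardC1 card_ord. over.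
  rewrite sumr_const card_ord -[LHS]/(n%:R * ((n%:R - 1) * c)) -[RHS]mulr_natl -[X in _ = _ * X]mulr_natl.
  by rewrite -subn1 natrB.
pose S1 x := \sum_(a | pair_neq a) q1 a x.
pose S2 x := \sum_(b | triple_neq b) q2 b x.
pose S3 x := \sum_(a | pair_neq a) q3 a x.
have L1' : L2 nu S1 by apply: L2_sum => a; exact: LP_q1.
have L2' : L2 nu S2 by apply: L2_sum => a; exact: LP_q2.
have L3' : L2 nu S3 by apply: L2_sum => a; exact: LP_q3.
have E x : half_energy x - cmean = 2^-1 * (S1 x + S2 x + S3 x).
  by have := half_energy_hoeffding x; rewrite -/(S1 x) -/(S2 x) -/(S3 x); lra.
(* The square of half a sum of three terms is at most 3/4 of the sum of their squares; 3/4 of 4 + 54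
   is 43.5, rounded up to 44 for both B and Q. *)
apply: (@le_trans _ _ (\int[nu]_x (3 / 4 * S1 x ^+ 2 + 3 / 4 * S2 x ^+ 2 + 3 / 4 * S3 x ^+ 2))).
  apply: le_Ex.
  - apply: (L1_ext (L2Z (2^-1) (L2D (L2D L1' L2') L3')).2) => x.
    by rewrite E.
  - by apply: L1D; [apply: L1D|]; apply: L1Z; [exact: L1'.2|exact: L2'.2|exact: L3'.2].
  - move=> x; rewrite E; have := sqr_ge0 (S1 x - S2 x); have := sqr_ge0 (S1 x - S3 x).
    have := sqr_ge0 (S2 x - S3 x); nra.
have LZ1 := L1Z (3 / 4) L1'.2; have LZ2 := L1Z (3 / 4) L2'.2.
have LZ3 := L1Z (3 / 4) L3'.2.
rewrite RintegralD//; last exact: L1D.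
rewrite RintegralD// !RintegralZl//; [|exact: L3'.2|exact: L2'.2|exact: L1'.2].
have H1 : \int[nu]_x S1 x ^+ 2 <= _ := Ex_q1.
have H2 : \int[nu]_x S2 x ^+ 2 <= _ := Ex_q2.
have H3 : \int[nu]_x S3 x ^+ 2 <= _ := Ex_q3.
rewrite !card_prod !card_ord !natrM in H1 H2 H3.
have n1 : (1 : R) <= n%:R by rewrite ler1n.
set N : R := n%:R in n1 H1 H2 H3 *.
have b1 : N ^+ 2 * B <= N ^+ 3 * B by rewrite ler_wpM2r// ler_weXn2l.
have b2 : N ^+ 3 * Q <= N ^+ 4 * Q by rewrite ler_wpM2r// ler_weXn2l.
have b3 : 0 <= N ^+ 3 * B by rewrite mulr_ge0// exprn_ge0// (le_trans _ n1).
have b4 : 0 <= N ^+ 4 * Q by rewrite mulr_ge0// exprn_ge0// (le_trans _ n1).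
have e1 : 4 * (N * N) * B = 4 * (N ^+ 2 * B) by ring.
have e2 : 27 * (N * N * N) * (2 * B + 2 * Q) = 54 * (N ^+ 3 * B) + 54 * (N ^+ 3 * Q) by ring.
have e3 : 4 * (N * N) * (N ^+ 2 * Q) = 4 * (N ^+ 4 * Q) by ring.
rewrite e1 in H1; rewrite e2 in H2; rewrite e3 in H3.
by move: H1 H2 H3; lra.
Qed.

Lemma L2_half_energy : L2 nu half_energy.
Proof. by apply: L2Z; apply: L2_sum => i _; exact: L4_sqr (L4_row_sum i). Qed.

(* Stein's identity by leaving one variable out: [ustat - row_sum i] does not
   involve the i-th variable, so [row_sum i] is centred given it. *)
Lemma stein_bound (x0 : T) (g g' : R -> R) (C eps K delta : R) : (0 < n)%N ->
  (forall x : R, is_derive x 1 g (g' x)) -> measurable_fun setT g' ->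
  (forall x, `|g x| <= C) -> (forall x, `|g' x| <= C) ->
  (forall a b, `|g' a - g' b| <= eps + K * (a - b) ^+ 2) ->
  0 < eps -> 0 < K -> 0 < delta ->
  `|\int[nu]_x (g' (ustat x) - ustat x * g (ustat x))| <=
  2^-1 * (eps * (n%:R ^+ 2 * c) + K * (10 * n%:R ^+ 3 * B)) +
  C * (`|2^-1 * n%:R * (n%:R - 1) * c - 1| + delta +
       44 * (n%:R ^+ 3 * B + n%:R ^+ 4 * Q) / delta).
Proof.
move=> n0 dg mg' gC g'C g'U e0 K0 d0.
have cg : continuous g.
  by move=> x; apply: differentiable_continuous; apply/derivable1_diffP; case: (dg x).
have mg : measurable_fun setT g by exact: continuous_measurable_fun.
have mtot : measurable_fun setT ustat := L4_ustat.1.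
have C0 : 0 <= C by exact: le_trans (gC 0).
(* First-order Taylor error of g for a step b. As g is only of class C^1, the mean value theorem
   leaves an increment of g', controlled by the modulus [g'U]. *)
have mvt a b : `|g a - g (a - b) - b * g' a| <= `|b| * (eps + K * b ^+ 2).
  suff [z [-> zb]] : exists z, g a - g (a - b) = b * g' z /\ `|z - a| <= `|b|.
    rewrite -mulrBr normrM ler_wpM2l//; apply: le_trans (g'U _ _) _.
    rewrite lerD2l ler_wpM2l// ?(ltW K0)//.
    by rewrite -(real_normK (num_real b)) -(real_normK (num_real (z - a))) lerXn2r ?nnegrE.
  have [b0|b0|->] := ltgtP b 0; last first.
  - by exists a; rewrite !subr0 !subrr mul0r normr0.
  - have ab : a - b < a by rewrite ltrBlDr ltrDl.
    have [z + E] := MVT ab (fun x _ => dg x) (continuous_subspaceT cg).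
    rewrite in_itv/= => /andP[z1 z2]; exists z; rewrite E; split; first ring.
    by rewrite (gtr0_norm b0) ltr0_norm; lra.
  - have ab : a < a - b by rewrite ltrDl oppr_gt0.
    have [z + E] := MVT ab (fun x _ => dg x) (continuous_subspaceT cg).
    rewrite in_itv/= => /andP[z1 z2]; exists z; split.
      by rewrite -opprB E; ring.
    by rewrite (ltr0_norm b0) gtr0_norm; lra.
pose U := half_energy; pose u := 2^-1 * n%:R * (n%:R - 1) * c.
pose A x := g' (ustat x) * (1 - U x).
(* [r i] is [row_sum i] times a Taylor remainder of g, and [s i] is the leave-one-out term, of mean
   zero. The quantity to estimate is [A] plus half the sum of the [r i] minus half the sum of the
   [s i]. *)
pose r i x := row_sum i x * (row_sum i x * g' (ustat x) - g (ustat x) +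
  g (ustat x - row_sum i x)).
pose s i x := g (ustat x - row_sum i x) * row_sum i x.
have mg'W : measurable_fun setT (fun x => g' (ustat x)) by exact: (measurableT_comp mg').
have mgW : measurable_fun setT (fun x => g (ustat x)) by exact: (measurableT_comp mg).
have mW i : measurable_fun setT (row_sum i) := (L4_row_sum i).1.
have mgWi i : measurable_fun setT (fun x => g (ustat x - row_sum i x)).
  by apply: (measurableT_comp mg); exact: measurable_funB.
have LA : L1 nu A.
  apply: (L1_bounded_mul (M := C)) => //.
  by apply: L1B; [exact: L1_cst|exact: L2W L2_half_energy].
have rle i x : `|r i x| <= eps * row_sum i x ^+ 2 + K * row_sum i x ^+ 4.
  have := mvt (ustat x) (row_sum i x); rewrite /r.
  set w := row_sum i x; set g0 := g (ustat x); set g1 := g (_ - _); set g2 := g' _.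
  rewrite -normrN (_ : - (g0 - g1 - w * g2) = w * g2 - g0 + g1); last ring.
  move=> /(ler_wpM2l (normr_ge0 w)); rewrite -normrM => /le_trans; apply.
  by rewrite mulrA -expr2 real_normK ?num_real// le_eqVlt; apply/orP; left; apply/eqP; ring.
have Ldom i : L1 nu (fun x => eps * row_sum i x ^+ 2 + K * row_sum i x ^+ 4).
  by apply: L1D; apply: L1Z; [exact: (L4W (L4_row_sum i)).2|exact: (L4_row_sum i).2].
have Lr i : L1 nu (r i).
  apply: (L1_dom _ (Ldom i) (rle i)).
  apply: measurable_funM => //; apply: measurable_funD => //.
  by apply: measurable_funB => //; exact: measurable_funM.
have Ls i : L1 nu (s i).
  by apply: (L1_bounded_mul (M := C)) => //; exact: L2W (L4W (L4_row_sum i)).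
have Es i : \int[nu]_x s i x = 0.
  apply: (Ex_degen nuE (i := i)) => //.
  rewrite (_ : s i = fun x => row_sum i x * g (ustat x - row_sum i x)).
    apply: degenMr; first exact: degen_row_sum.
    by move=> x y; have := indep_ustatB_row_sum i x y => ->.
  by apply/funext => x; rewrite /s mulrC.
have E x : g' (ustat x) - ustat x * g (ustat x) =
    A x + 2^-1 * \sum_i r i x - 2^-1 * \sum_i s i x.
  have Er : \sum_i r i x - \sum_i s i x =
     g' (ustat x) * \sum_i row_sum i x ^+ 2 - g (ustat x) * \sum_i row_sum i x.
    by rewrite !mulr_sumr -!sumrB; apply: eq_bigr => i _; rewrite /r /s; ring.
  have EW : \sum_i row_sum i x = 2 * ustat x by rewrite /ustat; lra.
  have EU : \sum_i row_sum i x ^+ 2 = 2 * U x by rewrite /U /half_energy; lra.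
  by move: Er; rewrite EW EU /A; nra.
have LR : L1 nu (fun x => 2^-1 * \sum_i r i x) by apply: L1Z; exact: L1_sum.
have LS : L1 nu (fun x => 2^-1 * \sum_i s i x) by apply: L1Z; exact: L1_sum.
under eq_Rintegral do rewrite E.
rewrite RintegralB//; last exact: L1D.
rewrite RintegralD// !RintegralZl//; try exact: L1_sum.
rewrite !Ex_sum// [X in _ - _ * X]big1// mulr0 subr0.
apply: le_trans (ler_normD _ _) _; rewrite addrC; apply: lerD.
  rewrite normrM ger0_norm// ler_wpM2l//.
  apply: le_trans (ler_norm_sum _ _ _) _.
  apply: (@le_trans _ _ (\sum_(i < n) (eps * (n%:R * c) + K * (10 * n%:R ^+ 2 * B)))).
    apply: ler_sum => i _; apply: le_trans (normr_Ex_le (Lr i) (Ldom i) (rle i)) _.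
    rewrite RintegralD//; last 2 first.
    - by apply: L1Z; exact: (L4W (L4_row_sum i)).2.
    - by apply: L1Z; exact: (L4_row_sum i).2.
    rewrite !RintegralZl//; [|exact: (L4_row_sum i).2|exact: (L4W (L4_row_sum i)).2].
    by apply: lerD; rewrite ler_wpM2l// ?(ltW e0) ?(ltW K0)//; [exact: Ex_row_sum2|exact: Ex_row_sum4].
  by rewrite sumr_const card_ord -[leLHS]mulr_natl le_eqVlt; apply/orP; left; apply/eqP; ring.
have LV : L1 nu (fun x => (U x - u) ^+ 2).
  by have [] := L2B L2_half_energy (L2_cst nu u).
have LD : L1 nu (fun x => C * (`|u - 1| + delta + delta^-1 * (U x - u) ^+ 2)).
  by apply: L1Z; apply: L1D; [exact: L1_cst|exact: L1Z].
apply: le_trans (normr_Ex_le LA LD _) _ => [x|].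
  rewrite /A normrM; apply: ler_pM => //.
  rewrite (_ : 1 - U x = - (u - 1) - (U x - u)); last ring.
  apply: le_trans (ler_normB _ _) _; rewrite normrN -addrA lerD2l.
  (* Trading the absolute deviation for a variance at the free scale delta, so that
     [half_energy_var] applies. *)
  have ad : `|U x - u| <= delta + delta^-1 * `|U x - u| ^+ 2.
    set t := `|_|; have t0 : 0 <= t by exact: normr_ge0.
    have [td|td] := leP t delta; first by rewrite (le_trans td)// lerDl mulr_ge0 ?invr_ge0 ?sqr_ge0// ltW.
    apply: (@le_trans _ _ (delta^-1 * t ^+ 2)); last by rewrite lerDr ltW.
    by rewrite [leRHS]mulrC ler_pdivlMr// expr2 ler_wpM2l// ltW.
  by move: ad; rewrite real_normK ?num_real.
rewrite RintegralZl//; last by apply: L1D; [exact: L1_cst|exact: L1Z].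
rewrite ler_wpM2l// RintegralD//; [|exact: L1_cst|exact: L1Z].
rewrite Ex_cst lerD2l RintegralZl// mulrC ler_wpM2r// ?invr_ge0 ?(ltW d0)//.
exact: half_energy_var.
Qed.

End kernel.

(** * Continuous functions of compact support *)

Section compact_support.
Context {R : realType}.
Implicit Types k h : R -> R.

Lemma compact_support_bounded k (M : R) : continuous k ->
  (forall x, M <= `|x| -> k x = 0) -> exists C : R, 0 <= C /\ forall x, `|k x| <= C.
Proof.
move=> ck k0.
have [M0|M0] := ltP M 0.
  exists 0; split=> // x; rewrite k0 ?normr0// (le_trans (ltW M0))//.
have MM : - M <= M by rewrite ge0_cp.
have cn : {within `[- M, M], continuous (fun x => `|k x|)}.
  apply: continuous_subspaceT => x; apply: continuous_comp; [exact: ck|exact: norm_continuous].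
have [c _ cmax] := EVT_max MM cn.
exists `|k c|; split=> // x; have [xM|xM] := leP M `|x|; first by rewrite k0// normr0.
by apply: cmax; rewrite in_itv/= -ler_norml ltW.
Qed.

(** Uniform continuity in a form that integrates: below some scale i the increment is at most eps,
    and beyond it the trivial bound 2 C is absorbed by 2 C / i^2 times the squared distance. Squared
    steps then turn into second and fourth moments of row sums. *)
Lemma compact_support_modulus k (M eps : R) : continuous k ->
  (forall x, M <= `|x| -> k x = 0) -> 0 < eps ->
  exists K, 0 < K /\ forall a b, `|k a - k b| <= eps + K * (a - b) ^+ 2.
Proof.
move=> ck k0 e0; have [C [C0 kC]] := compact_support_bounded ck k0.
pose P (i x : R) := forall y, `|y - x| < i -> `|k y - k x| <= eps.
(* The margin 1 beyond M serves pairs at distance less than 1: when b lies outside the larger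
   interval, both points lie where k vanishes. *)
have : \forall i \near (0:R)^'+, `[- (M + 1), M + 1] `<=` P i.
  have := @segment_compact R (- (M + 1)) (M + 1).
  move=> /compact_near_coveringP; apply => x _.
  have e2 : 0 < eps / 2 by rewrite divr_gt0.
  have /cvgrPdist_lt/(_ _ e2) := ck x.
  move=> /nbhs_ballP[r /= r0 Hr].
  have r2 : 0 < r / 2 by rewrite divr_gt0.
  exists (ball x (r / 2), [set i | i < r / 2]) => /=.
    by split; [exact: nbhsx_ballx|exact: nbhs_right_lt].
  move=> [x' i] /= [xx' ir] y yx'.
  have Hx' : ball x r x' by apply: le_ball xx'; rewrite ler_pdivrMr// ler_pMr ?ler1n.
  have Hy : ball x r y.
    rewrite /ball/= distrC; rewrite /ball/= in xx'.
    rewrite (_ : y - x = (y - x') - (x - x')); last ring.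
    apply: le_lt_trans (ler_normB _ _) _.
    by rewrite (splitr r) ltrD// (lt_trans yx').
  have := Hr _ Hx'; have := Hr _ Hy; rewrite /= => H1 H2.
  rewrite (_ : k y - k x' = (k x - k x') - (k x - k y)); last ring.
  apply: le_trans (ler_normB _ _) _; rewrite (splitr eps) ltW// ltrD//.
move=> H.
have : \forall i \near (0:R)^'+, [/\ 0 < i, i < 1 & `[- (M + 1), M + 1] `<=` P i].
  near=> i; split; near: i => //; [exact: nbhs_right_gt|exact: nbhs_right_lt].
move=> /filter_ex[i [i0 i1 Hi]].
have Kp : 0 <= 2 * C / i ^+ 2 by rewrite divr_ge0 ?sqr_ge0// mulr_ge0.
(* The added 1 keeps the constant positive when C is 0. *)
exists (2 * C / i ^+ 2 + 1); split; first by rewrite ltr_wpDl.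
move=> a b; rewrite mulrDl mul1r addrA.
have [ab|ab] := ltP `|a - b| i.
  apply: (@le_trans _ _ eps); last first.
    by rewrite -addrA lerDl addr_ge0 ?sqr_ge0// mulr_ge0 ?sqr_ge0.
  have [bM|bM] := leP `|b| (M + 1).
    by apply: (Hi b) => //=; rewrite in_itv/= -ler_norml.
  have ba : `|b| - `|a| <= `|a - b| by rewrite distrC; exact: lerB_dist.
  have aM : M <= `|a| by lra.
  have bM' : M <= `|b| by lra.
  by rewrite (k0 _ aM) (k0 _ bM') subrr normr0 ltW.
apply: (@le_trans _ _ (2 * C)).
  by apply: le_trans (ler_normB _ _) _; have := kC a; have := kC b; lra.
have i20 : 0 < i ^+ 2 by rewrite exprn_gt0.
apply: (@le_trans _ _ (2 * C / i ^+ 2 * (a - b) ^+ 2)); last first.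
  by rewrite -[leLHS]addr0 lerD ?sqr_ge0// lerDr ltW.
rewrite -mulrA ler_peMr ?mulr_ge0// mulrC ler_pdivlMr// mul1r.
by rewrite -[leRHS]real_normK ?num_real// lerXn2r ?nnegrE// ltW.
Unshelve. all: by end_near. Qed.

End compact_support.

(** * Stein's equation for the standard normal law *)

Section stein_equation.
Context {R : realType}.
Local Notation lambda := (@lebesgue_measure R).
Local Notation phi := (@normal_pdf R 0 1).
Implicit Types h : R -> R.

(** The Radon-Nikodym derivative of the normal law agrees almost everywhere with [normal_pdf], since
    both have the same integral over every measurable set. *)
Lemma integral_normal_prob01 h (M : R) : measurable_fun setT h ->
  (forall x, `|h x| <= M) ->
  (\int[normal_prob 0 1]_x (h x)%:E = \int[lambda]_x (h x * phi x)%:E)%E.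
Proof.
move=> mh hM.
have ih : (normal_prob 0 1).-integrable setT (EFin \o h).
  exact: (L1_bounded (normal_prob 0 1) mh hM).
rewrite -[LHS](Radon_Nikodym_change_of_variables (normal_prob_dominates 0 1))//=.
under [RHS]eq_integral do rewrite EFinM.
have mEh : measurable_fun setT (EFin \o h) by exact/measurable_EFinP.
apply: ae_eq_integral => //.
- apply: emeasurable_funM => //; apply: (measurable_int lambda).
  by apply: Radon_Nikodym_integrable; exact: normal_prob_dominates.
- apply: emeasurable_funM => //=; apply/measurableT_comp => //=.
  exact: measurable_normal_pdf.
- apply: ae_eqe_mul2l => /=.
  rewrite Radon_NikodymE//=; first exact: normal_prob_dominates.
  move=> abmu; case: cid => /= f [h1 h2 h3].
  apply: integral_ae_eq => //=.
  + by apply/measurableT_comp => //; exact: measurable_normal_pdf.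
  + by move=> E E01 mE; rewrite -h3.
Qed.

(** The solution is F / phi with F the primitive of h phi from minus infinity; in the proof [psi] is
    1 / phi. To the left of the support F is 0, and to its right F is the full integral, which
    vanishes by the mean-zero assumption. So g and g' have compact support and are bounded by
    continuity alone, without Gaussian tail estimates. *)
Lemma stein_solution h (M : R) : continuous h ->
  (forall x, M <= `|x| -> h x = 0) -> \int[normal_prob 0 1]_x h x = 0 ->
  exists g g' : R -> R, exists C : R,
  [/\ forall x : R, is_derive x 1 g (g' x), continuous g',
      (forall x, `|g x| <= C) /\ (forall x, `|g' x| <= C),
      forall x, M <= `|x| -> g' x = 0 & forall x, h x = g' x - x * g x].
Proof.
move=> ch h0 Ih; have [C [C0 hC]] := compact_support_bounded ch h0.
have mh : measurable_fun setT h by exact: continuous_measurable_fun.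
have one0 : (1 : R) != 0 by exact: oner_neq0.
pose f t := h t * phi t.
have cphi : continuous phi by exact: continuous_normal_pdf.
have cf : continuous f by move=> x; apply: cvgM; [exact: ch|exact: cphi].
have intf : lambda.-integrable setT (EFin \o f).
  apply: (@le_integrable _ _ _ lambda setT _ _ (fun x => C%:E * (phi x)%:E)%E) => //.
  - by apply/measurable_EFinP; exact: continuous_measurable_fun.
  - move=> x _ /=; rewrite lee_fin !normrM; apply: ler_wpM2r => //.
    by apply: le_trans (hC x) _; exact: ler_norm.
  - by apply: integrableZl => //; exact: integrable_normal_pdf.
pose F y := \int[lambda]_(t in [set` `]-oo, y]]) f t.
have dF (y : R) : is_derive y 1 F (f y).
  have yy : y < y + 1 by rewrite ltrDl.
  have iy : lambda.-integrable [set` `]-oo, (y + 1)]] (EFin \o f).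
    exact: integrableS intf.
  have [dFy Fy] := @continuous_FTC1 R f (BInfty _ true) y (y + 1) yy iy (ltNyr _) (cf y).
  by apply: DeriveDef => //; rewrite -derive1E.
have F0 y : M <= `|y| -> F y = 0.
  have [y0|y0] := leP 0 y => My.
    transitivity (\int[lambda]_t f t).
      rewrite /F Rintegral_mkcond; apply: eq_Rintegral => t _; rewrite patchE.
      case: ifPn => //; rewrite notin_setE/= in_itv/= => /negP; rewrite -ltNge => yt.
      rewrite /f h0 ?mul0r// (le_trans My)// ger0_norm// (le_trans (ltW yt))//.
      exact: ler_norm.
    rewrite -Ih; apply: (f_equal fine).
    by rewrite (integral_normal_prob01 mh hC).
  rewrite /F; transitivity (\int[lambda]_(t in [set` `]-oo, y]]) (0:R)).
    apply: eq_Rintegral => t; rewrite inE/= in_itv/= => ty.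
    rewrite /f h0 ?mul0r// (le_trans My)// !ltr0_norm// ?lerN2//.
    exact: le_lt_trans y0.
  by rewrite /Rintegral integral0.
pose psi t : R := (normal_peak 1)^-1 * expR (t ^+ 2 / 2).
have phipsi t : phi t * psi t = 1.
  rewrite normal_pdfE// /psi mulrACA divff ?gt_eqF ?normal_peak_gt0//.
  rewrite mul1r /normal_fun -expRD subr0 expr1n [X in expR X](_ : _ = 0) ?expR0//.
  by rewrite mulr2n mulNr -[1 + 1]/(2:R) addNr.
have dpsi (t : R) : is_derive t 1 psi (t * psi t).
  apply: is_derive_eq; rewrite /GRing.scale/=; rewrite /psi; field.
  by rewrite gt_eqF// normal_peak_gt0.
pose g x := F x * psi x.
pose g' x := h x + x * g x.
have dg (x : R) : is_derive x 1 g (g' x).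
  apply: is_derive_eq; rewrite /GRing.scale/= /g' /g /f.
  transitivity (F x * psi x * x + h x * (phi x * psi x)); first by ring.
  by rewrite phipsi; ring.
have cg : continuous g.
  by move=> x; apply: differentiable_continuous; apply/derivable1_diffP; case: (dg x).
have cg' : continuous g'.
  by move=> x; apply: cvgD; [exact: ch|apply: cvgM; [exact: cvg_id|exact: cg]].
have g0 x : M <= `|x| -> g x = 0 by move=> Mx; rewrite /g F0// mul0r.
have g'0 x : M <= `|x| -> g' x = 0 by move=> Mx; rewrite /g' g0// h0// mulr0 addr0.
have [C1 [C10 gC]] := compact_support_bounded cg g0.
have [C2 [C20 g'C]] := compact_support_bounded cg' g'0.
exists g, g', (C1 + C2); split=> //.
- split=> x; first by rewrite (le_trans (gC x))// lerDl.
  by rewrite (le_trans (g'C x))// lerDr.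
- by move=> x; rewrite /g' addrK.
Qed.

End stein_equation.

(** * From Stein test functions to weak convergence *)

Section weak_convergence.
Context {R : realType}.
Local Notation N01 := (normal_prob 0 1 : probability _ R).

(** A piecewise linear bump, written with absolute values so that continuity needs no case
    analysis. *)
Definition cutoff (k : nat) (x : R) : R :=
  (1 + `|k%:R + 1 - `|x| | - `|k%:R - `|x| |) / 2.

Lemma continuous_cutoff k : continuous (cutoff k).
Proof.
have cn (a : R) : continuous (fun x : R => `|a - `|x| |).
  move=> x; apply: (@continuous_comp _ _ _ (fun x : R => a - `|x|)).
    by apply: cvgB; [exact: cvg_cst|exact: norm_continuous].
  exact: norm_continuous.
move=> x; apply: cvgM; last exact: cvg_cst.
by apply: cvgB; [apply: cvgD; [exact: cvg_cst|exact: cn]|exact: cn].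
Qed.

Lemma cutoff1 k x : `|x| <= k%:R -> cutoff k x = 1.
Proof.
by rewrite /cutoff; set y := `|x| => xk; rewrite !ger0_norm; lra.
Qed.

Lemma cutoff0 k x : k%:R + 1 <= `|x| -> cutoff k x = 0.
Proof.
by rewrite /cutoff; set y := `|x| => xk; rewrite !ler0_norm; lra.
Qed.

Lemma cutoff_ge0 k x : 0 <= cutoff k x.
Proof.
have : `|k%:R - `|x| | <= `|k%:R + 1 - `|x| | + 1.
  rewrite (_ : k%:R - `|x| = (k%:R + 1 - `|x|) - 1); last ring.
  by apply: le_trans (ler_normB _ _) _; rewrite normr1.
by rewrite /cutoff; lra.
Qed.

Lemma cutoff_le1 k x : cutoff k x <= 1.
Proof.
have : `|k%:R + 1 - `|x| | <= `|k%:R - `|x| | + 1.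
  rewrite (_ : k%:R + 1 - `|x| = (k%:R - `|x|) + 1); last ring.
  by apply: le_trans (ler_normD _ _) _; rewrite normr1.
by rewrite /cutoff; lra.
Qed.

Lemma Ex_cutoff_cvg (f : R -> R) (B : R) : continuous f ->
  (forall x, `|f x| <= B) ->
  (fun k => \int[N01]_x (cutoff k x * f x)) @ \oo --> \int[N01]_x f x.
Proof.
move=> cf fB; have mf : measurable_fun setT f by exact: continuous_measurable_fun.
have mc k : measurable_fun setT (fun x => cutoff k x * f x).
  by apply: measurable_funM => //; apply: continuous_measurable_fun; exact: continuous_cutoff.
have bc k x : `|cutoff k x * f x| <= B.
  rewrite normrM ger0_norm ?cutoff_ge0// (le_trans _ (fB x))//.
  by rewrite ler_piMl// cutoff_le1.
have Lf : L1 N01 f := L1_bounded N01 mf fB.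
have mEc k : measurable_fun setT (EFin \o (fun x => cutoff k x * f x)).
  exact/measurable_EFinP.
have mEf : measurable_fun setT (EFin \o f) by exact/measurable_EFinP.
have ae1 : {ae N01, forall x, setT x ->
    (fun k => (cutoff k x * f x)%:E) @ \oo --> (EFin \o f) x}.
  apply: aeW => x _; apply: cvg_near_cst.
  exists (Num.truncn `|x|).+1 => // k /= xk.
  rewrite cutoff1 ?mul1r//; apply: ltW; apply: lt_le_trans (truncnS_gt _) _.
  by rewrite ler_nat.
have ae2 : {ae N01, forall x k, setT x ->
    (`|(cutoff k x * f x)%R%:E| <= B%:E)%E}.
  by apply: aeW => x k _; rewrite lee_fin.
have [_ _] := @dominated_convergence _ _ R N01 setT measurableT
  (fun k => EFin \o (fun x => cutoff k x * f x)) (EFin \o f) (EFin \o fun=> B)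
  mEc mEf ae1 (L1_cst N01 B) ae2.
rewrite -Ex_EFin// => /fine_cvgP[_].
exact.
Qed.

(** The uniform second moment gives tightness: a bounded function truncated at level k changes its
    expectation by at most B A / k^2, plus the small recentring constant. The truncated function is
    admissible for [Hh], so k is chosen before n. *)
Lemma weak_cvg_normal (d : measure_display) (Omega : nat -> measurableType d)
    (P : forall n, probability (Omega n) R) (W : forall n, Omega n -> R) (A : R) :
  0 <= A ->
  (\forall n \near \oo, L2 (P n) (W n) /\ \int[P n]_w (W n w) ^+ 2 <= A) ->
  (forall (h : R -> R) (M : R), continuous h -> (forall x, M <= `|x| -> h x = 0) ->
    \int[N01]_x h x = 0 ->
    forall eps, 0 < eps -> \forall n \near \oo, `|\int[P n]_w h (W n w)| <= eps) ->
  forall f : R -> R, continuous f -> (exists M : R, forall x, `|f x| <= M) ->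
    (fun n => (\int[P n]_w (f (W n w))%:E)%E) @ \oo --> (\int[N01]_x (f x)%:E)%E.
Proof.
move=> A0 HW Hh f cf [Mf fM].
have mf : measurable_fun setT f by exact: continuous_measurable_fun.
have Lf : L1 N01 f := L1_bounded N01 mf fM.
rewrite -Ex_EFin//; set m := \int[N01]_x f x.
apply/fine_cvgP; split.
  near=> n; have [[mW _] _] : L2 (P n) (W n) /\ \int[P n]_w (W n w) ^+ 2 <= A by near: n.
  apply: integrable_fin_num => //.
  by apply: (L1_bounded (P n) (M := Mf)) => //; exact: measurableT_comp.
pose ft x := f x - m; pose B := Mf + `|m|.
have cft : continuous ft by move=> x; apply: cvgB; [exact: cf|exact: cvg_cst].
have ftB x : `|ft x| <= B by apply: le_trans (ler_normB _ _) _; rewrite lerD2r.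
have B0 : 0 <= B by exact: le_trans (ftB 0).
have mft : measurable_fun setT ft by exact: continuous_measurable_fun.
have Lft : L1 N01 ft := L1_bounded N01 mft ftB.
have Ift : \int[N01]_x ft x = 0.
  by rewrite RintegralB ?Ex_cst ?subrr//; exact: L1_cst.
have c1 : (fun k => \int[N01]_x (cutoff k x * ft x)) @ \oo --> (0 : R).
  by have := Ex_cutoff_cvg cft ftB; rewrite Ift.
have c2 : (fun k => \int[N01]_x cutoff k x) @ \oo --> (1 : R).
  have n1 (x : R) : `|1 : R| <= 1 by rewrite normr1.
  have := Ex_cutoff_cvg (@cst_continuous _ _ (1 : R)) n1; rewrite Ex_cst.
  rewrite (_ : (fun k => _) = fun k => \int[N01]_x cutoff k x)//.
  by apply/funext => k; apply: eq_Rintegral => x _; rewrite mulr1.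
(* The constant that restores mean zero after truncation. It tends to 0 because [ft] is centred and
   the mass of the cutoff tends to 1. *)
pose beta k := (\int[N01]_x (cutoff k x * ft x)) / \int[N01]_x cutoff k x.
have cb : beta k @[k --> \oo] --> (0 : R).
  rewrite -[X in _ --> X](mul0r (1^-1 : R)); apply: cvgM => //.
  by apply: cvgV => //; exact: oner_neq0.
apply/cvgrPdist_le => eps e0.
have e3 : 0 < eps / 3 by rewrite divr_gt0.
have : \forall k \near \oo, [/\ (0 < k)%N, `|beta k| <= eps / 3,
    B * A / k%:R ^+ 2 <= eps / 3 & \int[N01]_x cutoff k x != 0].
  near=> k; split; near: k; first exact: nbhs_infty_gt.
  - have /cvgrPdist_le/(_ _ e3) := cb.
    by apply: filterS => k /=; rewrite sub0r normrN.
  - near=> k; have k0 : (0 < k)%N by near: k; exact: nbhs_infty_gt.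
    have k1 : (1 : R) <= k%:R by rewrite ler1n.
    have kB : B * A / (eps / 3) <= k%:R by near: k; exact: nbhs_infty_ger.
    rewrite ler_pdivrMr ?exprn_gt0 ?(lt_le_trans _ k1)//.
    rewrite ler_pdivrMr// in kB; apply: le_trans kB _.
    rewrite [leLHS]mulrC; apply: ler_wpM2l; first exact: ltW.
    by rewrite expr2 ler_peMr.
  - have /cvgrPdist_lt/(_ 1 ltr01) := c2.
    by apply: filterS => k /=; apply: contraTneq => ->; rewrite subr0 normr1 ltxx.
move=> /filter_ex[k [k0 bk Bk Ik]].
pose h x := cutoff k x * (ft x - beta k).
have ch : continuous h.
  move=> x; apply: cvgM; first exact: continuous_cutoff.
  by apply: cvgB; [exact: cft|exact: cvg_cst].
have h0 x : k%:R + 1 <= `|x| -> h x = 0 by move=> xk; rewrite /h cutoff0// mul0r.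
have mc : measurable_fun setT (cutoff k).
  by apply: continuous_measurable_fun; exact: continuous_cutoff.
have Lc : L1 N01 (cutoff k).
  by apply: (L1_bounded N01 (M := 1)) => // x; rewrite ger0_norm ?cutoff_ge0// cutoff_le1.
have Lcf : L1 N01 (fun x => cutoff k x * ft x).
  apply: (L1_bounded_mul (M := 1)) => // x.
  by rewrite ger0_norm ?cutoff_ge0// cutoff_le1.
have Ih : \int[N01]_x h x = 0.
  have hE x : h x = cutoff k x * ft x - beta k * cutoff k x by rewrite /h; ring.
  under eq_Rintegral do rewrite hE.
  rewrite RintegralB//; last exact: L1Z.
  by rewrite RintegralZl// /beta divfK// subrr.
have [Ch [Ch0 hC]] := compact_support_bounded ch h0.
near=> n.
have [LW EW] : L2 (P n) (W n) /\ \int[P n]_w (W n w) ^+ 2 <= A by near: n.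
have Hn : `|\int[P n]_w h (W n w)| <= eps / 3 by near: n; exact: (Hh h _ ch h0 Ih).
have mW := LW.1.
have LfW : L1 (P n) (fun w => f (W n w)).
  by apply: (L1_bounded (P n) (M := Mf)) => //; exact: measurableT_comp.
have LhW : L1 (P n) (fun w => h (W n w)).
  apply: (L1_bounded (P n) (M := Ch)) => //; apply: measurableT_comp => //.
  exact: continuous_measurable_fun.
have k20 : 0 < k%:R ^+ 2 :> R by rewrite exprn_gt0// ltr0n.
(* Pointwise Chebyshev: outside [-k, k] the bound B is multiplied by x^2 / k^2, which is at least 1
   there. *)
have diff x : `|ft x - h x| <= B / k%:R ^+ 2 * x ^+ 2 + `|beta k|.
  rewrite (_ : ft x - h x = (1 - cutoff k x) * ft x + cutoff k x * beta k); last by rewrite /h; ring.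
  apply: le_trans (ler_normD _ _) _; apply: lerD; last first.
    by rewrite normrM ger0_norm ?cutoff_ge0// ler_piMl// cutoff_le1.
  have [xk|xk] := leP `|x| k%:R.
    by rewrite cutoff1// subrr mul0r normr0 mulr_ge0 ?sqr_ge0// divr_ge0// ltW.
  rewrite normrM ger0_norm ?subr_ge0 ?cutoff_le1//.
  apply: (@le_trans _ _ B).
    apply: le_trans (ftB x); rewrite ler_piMl//.
    by rewrite lerBlDr lerDl cutoff_ge0.
  rewrite -mulrA ler_peMr// mulrC ler_pdivlMr// mul1r.
  by rewrite -(real_normK (num_real x)) lerXn2r ?nnegrE// ltW.
have LD : L1 (P n) (fun w => B / k%:R ^+ 2 * W n w ^+ 2 + `|beta k|).
  by apply: L1D; [apply: L1Z; exact: LW.2|exact: L1_cst].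
have Lm : L1 (P n) (fun w => ft (W n w)) by apply: L1B => //; exact: L1_cst.
rewrite /= -normrN opprB.
have -> : fine (\int[P n]_w (f (W n w))%:E)%E - m = \int[P n]_w ft (W n w).
  by rewrite [RHS]RintegralB ?Ex_cst//; exact: L1_cst.
have -> : \int[P n]_w ft (W n w) =
    \int[P n]_w (ft (W n w) - h (W n w)) + \int[P n]_w h (W n w).
  by rewrite RintegralB// subrK.
apply: le_trans (ler_normD _ _) _.
have := normr_Ex_le (L1B Lm LhW) LD (fun w => diff (W n w)).
have LZ := L1Z (B / k%:R ^+ 2) LW.2; have Lb := L1_cst (P n) `|beta k|.
rewrite (RintegralD measurableT LZ Lb) (RintegralZl _ measurableT LW.2) Ex_cst.
have : B / k%:R ^+ 2 * \int[P n]_w W n w ^+ 2 <= B * A / k%:R ^+ 2.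
  rewrite mulrAC; apply: ler_wpM2r; first by rewrite invr_ge0 ltW.
  exact: ler_wpM2l.
by move: Hn bk Bk; set a := `|_|; set b := `|_|; set c := `|_|; lra.
Unshelve. all: by end_near. Qed.

End weak_convergence.

(** * Gegenbauer polynomials as formal polynomials *)

Section gegenbauer_algebra.
Context {R : realType}.
Variable lam : R.
Local Notation l := (lam%:P).

Fixpoint gegen_poly_pair (k : nat) : {poly R} * {poly R} :=
  match k with
  | 0 => (1, 2 * l * 'X)
  | k'.+1 =>
      let p := gegen_poly_pair k' in
      (p.2, (k'.+2%:R^-1)%:P *
        (2 * 'X * (k'.+1%:R + l) * p.2 - (k'%:R + 2 * l) * p.1))
  end.

(** Formal polynomials make derivatives algebraic, so identities reduce to [ring]. The lock keeps
    simplification from unfolding the recursion at successors. *)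
Definition geg := locked (fun k => (gegen_poly_pair k).1).

Lemma geg0 : geg 0 = 1. Proof. by rewrite /geg -lock. Qed.

Lemma geg1 : geg 1 = 2 * l * 'X. Proof. by rewrite /geg -lock. Qed.

Lemma gegenbauerE k x : gegenbauer k lam x = (geg k).[x].
Proof.
have hn n : (n%:R : {poly R}).[x] = n%:R by rewrite -polyC_natr hornerC.
rewrite /geg -lock /gegenbauer; suff -> : gegen_pair lam x k =
    ((gegen_poly_pair k).1.[x], (gegen_poly_pair k).2.[x]) by [].
elim: k => [|k IH] /=.
  by rewrite !hornerM !hn hornerC hornerX ?hornerC.
rewrite IH /=; congr (_, _).
by rewrite !(hornerM, hornerD, hornerN, hn, hornerC, hornerX) mulrC.
Qed.

Lemma gegS k : (k%:R + 2) * geg k.+2 =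
  2 * (k%:R + 1 + l) * 'X * geg k.+1 - (k%:R + 2 * l) * geg k.
Proof.
rewrite /geg -lock/= mulrA.
have -> : (k%:R + 2) * (k.+2%:R^-1)%:P = 1 :> {poly R}.
  rewrite -natrD addn2 -polyC_natr -polyCM mulfV// pnatr_eq0//.
by rewrite -[k.+1]addn1 natrD; ring.
Qed.

(** The two identities are proved together. Differentiating the three-term recurrence and
    eliminating the derivative of [geg k] by the first identity gives the second one at k + 1; the
    latter and both identities at k give the first one at k + 1. *)
Lemma geg_deriv k :
  'X * (geg k.+1)^`() - (geg k)^`() = (k%:R + 1) * geg k.+1 /\
  (geg k.+1)^`() - 'X * (geg k)^`() = (k%:R + 2 * l) * geg k.
Proof.
have der_l : l^`() = 0 :> {poly R} by exact: derivC.
have der_n n : (n%:R : {poly R})^`() = 0 by rewrite -polyC_natr derivC.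
elim: k => [|k [I1 I2]].
  rewrite geg0 geg1 -polyC1 derivC !derivM derivX der_l -[2]polyC_natr derivC.
  by split; ring.
have J2 : (geg k.+2)^`() - 'X * (geg k.+1)^`() = (k.+1%:R + 2 * l) * geg k.+1.
  move: (gegS k) I1 I2; move: (geg k) (geg k.+1) (geg k.+2) => a b c S I1 I2.
  have k2 : (k%:R + 2 : {poly R}) != 0.
    by rewrite -natrD -polyC_natr polyC_eq0 pnatr_eq0 addn2.
  apply: (mulfI k2).
  have := congr1 (fun p => p^`()) S => /=.
  rewrite derivB !derivM !derivD !derivM derivX der_l !der_n (der_n 1) => E.
  rewrite -[k.+1%:R]natr1.
  have -> : (k%:R + 2) * (c^`() - 'X * b^`()) =
     ((0 + (0 + 0)) * c + (k%:R + 2) * c^`()) - (k%:R + 2) * ('X * b^`()) by ring.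
  rewrite E.
  have -> : a^`() = 'X * b^`() - (k%:R + 1) * b by rewrite -I1; ring.
  by ring.
split => //.
have -> : (k.+1%:R + 1) * geg k.+2 = (k%:R + 2) * geg k.+2.
  by rewrite -[k.+1%:R]natr1; ring.
rewrite gegS.
have -> : (geg k.+2)^`() = 'X * (geg k.+1)^`() + (k%:R + 1 + 2 * l) * geg k.+1.
  by rewrite -[k.+1%:R]natr1 in J2; rewrite -J2; ring.
have -> : 'X * ('X * (geg k.+1)^`() + (k%:R + 1 + 2 * l) * geg k.+1) - (geg k.+1)^`() =
   'X * ('X * (geg k.+1)^`() - (geg k)^`()) -
   ((geg k.+1)^`() - 'X * (geg k)^`()) + (k%:R + 1 + 2 * l) * 'X * geg k.+1 by ring.
by rewrite I1 I2; ring.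
Qed.

Lemma geg_derivS2 k :
  (geg k.+2)^`() = (geg k)^`() + 2 * (k%:R + 1 + l) * geg k.+1.
Proof.
have [I1 _] := geg_deriv k; have [_] := geg_deriv k.+1.
rewrite -[k.+1%:R]natr1 => J2.
have -> : (geg k.+2)^`() = ((geg k.+2)^`() - 'X * (geg k.+1)^`()) +
  ('X * (geg k.+1)^`() - (geg k)^`()) + (geg k)^`() by ring.
by rewrite I1 J2; ring.
Qed.

(** Gegenbauer's differential equation, from differentiating both identities of [geg_deriv]. It
    makes [geg k] an eigenfunction of the zonal Laplacian with eigenvalue -k (k + 2 lam), which
    drives orthogonality. *)
Lemma geg_ode k : (1 - 'X ^+ 2) * (geg k)^`()^`() =
  (2 * l + 1) * 'X * (geg k)^`() - k%:R * (k%:R + 2 * l) * geg k.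
Proof.
case: k => [|k].
  by rewrite geg0 -polyC1 !derivC; ring.
have [] := geg_deriv k; move: (geg k) (geg k.+1) => a b I1 I2.
have der_l : l^`() = 0 :> {poly R} by exact: derivC.
have der_n n : (n%:R : {poly R})^`() = 0 by rewrite -polyC_natr derivC.
have D1 := congr1 (fun p => p^`()) I1; have D2 := congr1 (fun p => p^`()) I2.
rewrite /= !derivB !derivM !derivD ?derivM derivX ?der_l ?der_n in D1 D2.
rewrite (der_n 1) in D1.
have -> : (1 - 'X ^+ 2) * b^`()^`() =
  (b^`()^`() - (1 * a^`() + 'X * a^`()^`())) + (a^`() + 'X * a^`()^`()) -
  'X * ((1 * b^`() + 'X * b^`()^`()) - a^`()^`()) + 'X * b^`() - 'X * a^`()^`() by ring.
rewrite D1 D2 -[k.+1%:R]natr1.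
have -> : a^`() = 'X * b^`() - (k%:R + 1) * b by rewrite -I1; ring.
by ring.
Qed.

End gegenbauer_algebra.

(** * The unit sphere and its orthogonal transformations *)

Section sphere.
Context {R : realType} {m : nat}.
Local Notation T := (m.+1.-tuple R).
Local Notation S := (@unit_sphere R m).
Implicit Types (x y z : T) (i j k : 'I_m.+1).

Lemma innerC x y : inner x y = inner y x.
Proof. by apply: eq_bigr => k _; rewrite mulrC. Qed.

Lemma measurable_inner d (V : measurableType d) (f g : V -> T) :
  measurable_fun setT f -> measurable_fun setT g ->
  measurable_fun setT (fun v => inner (f v) (g v)).
Proof.
move=> /measurable_fun_tnthP mf /measurable_fun_tnthP mg.
apply: measurable_sum => k; apply: measurable_funM; [exact: mf|exact: mg].
Qed.

Lemma measurable_sphere : measurable S.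
Proof.
have mi : measurable_fun setT (fun x : T => inner x x).
  by apply: measurable_inner; exact: measurable_id.
rewrite (_ : S = setT `&` (fun x => inner x x) @^-1` [set 1]); last first.
  by rewrite setTI; apply/seteqP; split.
exact: mi.
Qed.

Definition pole : T := [tuple (k == ord0)%:R | k < m.+1].

Lemma pole_sphere : S pole.
Proof.
rewrite /unit_sphere/= /inner (bigD1 ord0)//= tnth_mktuple eqxx mulr1 big1 ?addr0//.
by move=> k /negbTE k0; rewrite tnth_mktuple k0 mulr0.
Qed.

(** The law charges only the sphere, yet its points range over all tuples. Composing with [sproj]
    alters nothing almost everywhere and lets boundedness and zonal identities hold at every
    point. *)
Definition sproj (x : T) : T := if x \in S then x else pole.

Lemma sproj_sphere x : S (sproj x).
Proof. by rewrite /sproj; case: ifPn => [/set_mem//|_]; exact: pole_sphere. Qed.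

Lemma sproj_id x : S x -> sproj x = x.
Proof. by move=> /mem_set Sx; rewrite /sproj Sx. Qed.

Lemma measurable_sproj : measurable_fun setT sproj.
Proof.
apply: measurable_fun_if => //.
apply: (measurable_fun_bool true); rewrite setTI.
rewrite (_ : _ @^-1` _ = S); first exact: measurable_sphere.
by apply/seteqP; split => x /=; [move/set_mem|move/mem_set].
Qed.

Lemma sphere_coord x k : S x -> `|tnth x k| <= 1.
Proof.
move=> Sx; rewrite -(@expr_le1 _ 2)// real_normK ?num_real// -[leRHS]Sx /inner.
rewrite (bigD1 k)//= -expr2 lerDl sumr_ge0// => j _.
by rewrite -expr2 sqr_ge0.
Qed.

Lemma tnth_mat_act Q x k : tnth (mat_act Q x) k = \sum_j Q k j * tnth x j.
Proof. by rewrite tnth_mktuple. Qed.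

Lemma measurable_mat_act Q : measurable_fun setT (@mat_act R m.+1 Q).
Proof.
apply/measurable_fun_tnthP => k.
rewrite (_ : _ \o _ = fun x => \sum_j Q k j * tnth x j); last first.
  by apply/funext => x /=; rewrite tnth_mat_act.
apply: measurable_sum => j; apply: measurable_funM => //; exact: measurable_tnth.
Qed.

Lemma inner_mat_act Q x y : orthogonal_mx Q ->
  inner (mat_act Q x) (mat_act Q y) = inner x y.
Proof.
move=> oQ; rewrite /inner.
transitivity (\sum_a \sum_b (Q^T *m Q) a b * (tnth x a * tnth y b)).
  transitivity (\sum_k \sum_a \sum_b (Q k a * Q k b) * (tnth x a * tnth y b)).
    apply: eq_bigr => k _; rewrite !tnth_mat_act mulr_suml; apply: eq_bigr => a _.
    by rewrite mulr_sumr; apply: eq_bigr => b _; ring.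
  rewrite exchange_big/=; apply: eq_bigr => a _; rewrite exchange_big/=.
  apply: eq_bigr => b _; rewrite mxE mulr_suml; apply: eq_bigr => k _.
  by rewrite mxE.
rewrite oQ; apply: eq_bigr => a _; rewrite (bigD1 a)//= big1 ?addr0.
  by rewrite mxE eqxx mul1r.
by move=> b ba; rewrite mxE eq_sym (negbTE ba) mul0r.
Qed.

Lemma mat_act_sphere Q x : orthogonal_mx Q -> S x -> S (mat_act Q x).
Proof. by move=> oQ Sx; rewrite /unit_sphere/= inner_mat_act. Qed.

(* The witness is the reflection exchanging [x] and [y]. *)
Lemma sphere_transitive x y : S x -> S y ->
  exists2 Q, orthogonal_mx Q & mat_act Q x = y.
Proof.
move=> Sx Sy; have [->|xy] := eqVneq x y.
  exists 1%:M; first by rewrite /orthogonal_mx trmx1 mulmx1.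
  apply: eq_from_tnth => k; rewrite tnth_mat_act (bigD1 k)//= big1 ?addr0.
    by rewrite mxE eqxx mul1r.
  by move=> b bk; rewrite mxE eq_sym (negbTE bk) mul0r.
pose w k := tnth x k - tnth y k; pose s := \sum_k w k ^+ 2.
have s0 : s != 0.
  apply: contraNneq xy => s0; apply/eqP/eq_from_tnth => k.
  have /eqP := s0; rewrite psumr_eq0 => [/allP/(_ k)|j _]; last exact: sqr_ge0.
  by rewrite mem_index_enum sqrf_eq0 subr_eq0 => /(_ isT)/eqP.
have sE : s = 2 - 2 * inner x y.
  have -> : s = inner x x + inner y y - 2 * inner x y.
    rewrite /inner mulr_sumr -big_split -sumrB/=; apply: eq_bigr => k _.
    by rewrite /w; ring.
  by rewrite Sx Sy; ring.
pose Q : 'M[R]_m.+1 := \matrix_(a, b) ((a == b)%:R - 2 * w a * w b / s).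
exists Q.
  apply/matrixP => a b; rewrite !mxE.
  transitivity (\sum_j ((j == a)%:R * ((j == b)%:R - 2 * w j * w b / s) -
     (2 * w j * w a / s) * (j == b)%:R + 4 * w a * w b / s ^+ 2 * w j ^+ 2)).
    by apply: eq_bigr => j _; rewrite !mxE; field.
  rewrite big_split/= sumrB -mulr_sumr -/s.
  rewrite (bigD1 a)//= eqxx big1 ?addr0; last by move=> j /negbTE ->; rewrite mul0r.
  rewrite (bigD1 b)//= eqxx big1 ?addr0; last by move=> j /negbTE ->; rewrite mulr0.
  by rewrite -[true%:R]/(1 : R); field.
apply: eq_from_tnth => k; rewrite tnth_mat_act.
transitivity (\sum_j ((k == j)%:R * tnth x j - 2 * w k / s * (w j * tnth x j))).
  by apply: eq_bigr => j _; rewrite mxE; field.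
rewrite sumrB -mulr_sumr (bigD1 k)//= eqxx mul1r big1 ?addr0; last first.
  by move=> j jk; rewrite eq_sym (negbTE jk) mul0r.
have -> : \sum_j w j * tnth x j = inner x x - inner x y.
  by rewrite /inner -sumrB; apply: eq_bigr => j _; rewrite /w; ring.
rewrite Sx (_ : 1 - inner x y = s / 2); last by rewrite sE; field.
by rewrite /w; field.
Qed.

End sphere.

(** * Invariant laws and differentiation along planar rotations *)

Section sphere_measure.
Context {R : realType} {m : nat}.
Local Notation T := (m.+1.-tuple R).
Local Notation S := (@unit_sphere R m).
Implicit Types (x y z : T) (i j k : 'I_m.+1).
Variable mu : probability T R.
Hypothesis muS : mu S = 1%E.
Hypothesis mu_inv : forall Q : 'M[R]_m.+1, orthogonal_mx Q ->
  forall A, measurable A -> mu A = mu (mat_act Q @^-1` A).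

Lemma integral_sproj (F : T -> \bar R) : measurable_fun setT F ->
  (\int[mu]_z F z = \int[mu]_z F (sproj z))%E.
Proof.
move=> mF; apply: ae_eq_integral => //.
  by apply: (measurableT_comp mF); exact: measurable_sproj.
exists (~` S); split.
- by apply: measurableC; exact: measurable_sphere.
- by rewrite [LHS](probability_setC mu measurable_sphere) muS subee.
- by move=> z /= H Sz; apply: H => _; rewrite sproj_id.
Qed.

Lemma ge0_integral_rot Q (F : T -> \bar R) : orthogonal_mx Q ->
  measurable_fun setT F -> (forall z, 0 <= F z)%E ->
  (\int[mu]_z F (mat_act Q z) = \int[mu]_z F z)%E.
Proof.
move=> oQ mF F0; have mQ := measurable_mat_act Q.
transitivity (\int[pushforward mu (mat_act Q)]_z F z)%E.
  by rewrite ge0_integral_pushforward// preimage_setT.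
by apply: eq_measure_integral => A mA _; rewrite [RHS](mu_inv oQ mA).
Qed.

Lemma integral_rot Q (F : T -> \bar R) : orthogonal_mx Q ->
  measurable_fun setT F ->
  (\int[mu]_z F (mat_act Q z) = \int[mu]_z F z)%E.
Proof.
move=> oQ mF; rewrite integralE [RHS]integralE; congr (_ - _)%E.
- have mFp : measurable_fun setT (F^\+)%E by exact: measurable_funepos.
  by rewrite -(ge0_integral_rot oQ mFp)//; apply: eq_integral => z _; rewrite funepos_comp.
- have mFn : measurable_fun setT (F^\-)%E by exact: measurable_funeneg.
  by rewrite -(ge0_integral_rot oQ mFn)//; apply: eq_integral => z _; rewrite funeneg_comp.
Qed.

Lemma integral_rot_sproj Q (F : T -> \bar R) : orthogonal_mx Q ->
  measurable_fun setT F ->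
  (\int[mu]_z F (mat_act Q (sproj z)) = \int[mu]_z F (sproj z))%E.
Proof.
move=> oQ mF; rewrite -integral_sproj// -(integral_rot oQ mF).
rewrite -(@integral_sproj (fun z => F (mat_act Q z)))//.
by apply: (measurableT_comp mF); exact: measurable_mat_act.
Qed.

Lemma integral_zonal (phi : R -> \bar R) x x' : measurable_fun setT phi ->
  S x -> S x' ->
  (\int[mu]_z phi (inner x (sproj z)) = \int[mu]_z phi (inner x' (sproj z)))%E.
Proof.
move=> mphi Sx Sx'; have [Q oQ Qx] := sphere_transitive Sx Sx'.
rewrite -(@integral_rot_sproj Q (fun z => phi (inner x' z)))//.
  by apply: eq_integral => z _; rewrite -Qx inner_mat_act.
apply: (measurableT_comp mphi); apply: measurable_inner; first exact: measurable_cst.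
exact: measurable_id.
Qed.

(** The rotation of angle theta in the plane of coordinates i and j, for t = tan (theta / 2). In
    this parametrisation the remainders are rational functions of t. *)
Definition rot_mx i j (t : R) : 'M[R]_m.+1 :=
  1%:M + ((1 - t ^+ 2) / (1 + t ^+ 2) - 1) *: (delta_mx i i + delta_mx j j) +
  (2 * t / (1 + t ^+ 2)) *: (delta_mx j i - delta_mx i j).

Let rot_den (t : R) : 1 + t ^+ 2 != 0.
Proof. by rewrite gt_eqF// ltr_pwDl// sqr_ge0. Qed.

(** With A the projection on the plane and J its quarter turn, A A = A, A J = J A = J and J J = - A.
    The product of the transpose with the matrix is 1 + (2 c + c^2 + s^2) A, where c is the cosine
    minus 1 and s the sine; the bracket vanishes. *)
Lemma rot_mx_orthogonal i j t : i != j -> orthogonal_mx (rot_mx i j t).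
Proof.
move=> ij; have ji : j != i by rewrite eq_sym.
pose A : 'M[R]_m.+1 := delta_mx i i + delta_mx j j.
pose J : 'M[R]_m.+1 := delta_mx j i - delta_mx i j.
have AT : A^T = A by rewrite linearD/= !trmx_delta.
have JT : J^T = - J by rewrite linearB/= !trmx_delta opprB.
have AA : A *m A = A.
  by rewrite mulmxDl !mulmxDr !mul_delta_mx !mul_delta_mx_0// addr0 add0r.
have AJ : A *m J = J.
  by rewrite mulmxDl !mulmxBr !mul_delta_mx !mul_delta_mx_0// sub0r subr0 addrC.
have JA : J *m A = J.
  by rewrite mulmxBl !mulmxDr !mul_delta_mx !mul_delta_mx_0// addr0 add0r.
have JJ : J *m J = - A.
  by rewrite mulmxBl !mulmxBr !mul_delta_mx !mul_delta_mx_0// sub0r subr0 opprD addrC.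
rewrite /orthogonal_mx /rot_mx -/A -/J; clearbody A J; set c := _ - 1; set s := _ / _.
have cs : 2 * c + c ^+ 2 + s ^+ 2 = 0.
  by rewrite /c /s; field; exact: rot_den.
clearbody c s.
rewrite !linearD/= !linearZ/= trmx1 AT JT scalerN.
rewrite mulmx1 !mulmxDl !mul1mx !mulNmx -!scalemxAl AA AJ JA JJ.
apply/matrixP => a b; rewrite !mxE.
move: (A a b) (J a b) => u v.
by rewrite [RHS](_ : _ = (a == b)%:R + (2 * c + c ^+ 2 + s ^+ 2) * u); [ring|rewrite cs mul0r addr0].
Qed.

Definition prot i j t z : T := mat_act (rot_mx i j t) z.

Lemma tnth_prot i j t z k : tnth (prot i j t z) k = tnth z k +
  ((1 - t ^+ 2) / (1 + t ^+ 2) - 1) *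
     ((k == i)%:R * tnth z i + (k == j)%:R * tnth z j) +
  (2 * t / (1 + t ^+ 2)) * ((k == j)%:R * tnth z i - (k == i)%:R * tnth z j).
Proof.
rewrite tnth_mat_act /rot_mx; set c := _ - 1; set s := _ / _.
transitivity (\sum_a ((k == a)%:R * tnth z a +
   c * ((k == i)%:R * ((a == i)%:R * tnth z a) + (k == j)%:R * ((a == j)%:R * tnth z a)) +
   s * ((k == j)%:R * ((a == i)%:R * tnth z a) - (k == i)%:R * ((a == j)%:R * tnth z a)))).
  apply: eq_bigr => a _; rewrite !mxE -!mulnb !natrM; ring.
have D b : \sum_a (a == b)%:R * tnth z a = tnth z b.
  rewrite (bigD1 b)//= eqxx mul1r big1 ?addr0//.
  by move=> a /negbTE ->; rewrite mul0r.
rewrite !big_split/= -!mulr_sumr big_split/= sumrB -!mulr_sumr !D.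
by rewrite -[in RHS](D k); under eq_bigr do rewrite eq_sym.
Qed.

(* [u'] is, up to the speed 2 of the parametrisation, the derivative of [u]
   along the planar rotations of the coordinates i and j. *)
Definition tang i j (u u' : T -> R) := [/\ measurable_fun setT u,
  measurable_fun setT u' & exists B : R, 0 <= B /\ forall z, S z ->
  [/\ `|u z| <= B, `|u' z| <= B & forall t, `|t| <= 1 ->
      `|u (prot i j t z) - u z - t * u' z| <= B * t ^+ 2]].

Lemma tang_ext i j u u' v' : tang i j u u' -> u' =1 v' -> tang i j u v'.
Proof. by move=> H /funext <-. Qed.

Lemma tang_eq i j u u' v v' : tang i j u u' -> u =1 v -> u' =1 v' -> tang i j v v'.
Proof. by move=> H /funext <- /funext <-. Qed.

Lemma tang_cst i j (c : R) : tang i j (fun=> c) (fun=> 0).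
Proof.
split=> //; exists `|c|; split=> // z _; split=> //; first by rewrite normr0.
by move=> t _; rewrite subrr mulr0 subr0 normr0 mulr_ge0// sqr_ge0.
Qed.

Lemma tang_coord i j k : tang i j (fun z => tnth z k)
  (fun z => 2 * ((k == j)%:R * tnth z i - (k == i)%:R * tnth z j)).
Proof.
split; first exact: measurable_tnth.
  apply: measurable_funM => //; apply: measurable_funB;
    by apply: measurable_funM => //; exact: measurable_tnth.
exists 8; split=> // z Sz.
have b0 (b : bool) : `|b%:R : R| <= 1 by case: b; rewrite ?normr1 ?normr0.
have bz (b : bool) a : `|b%:R * tnth z a| <= 1.
  by rewrite normrM mulr_ile1//; exact: sphere_coord.
set p := (k == j)%:R * tnth z i; set q := (k == i)%:R * tnth z j.
have pq : `|p - q| <= 2.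
  by apply: le_trans (ler_normB _ _) _; rewrite -[2]/(1 + 1) lerD ?bz.
split.
- by rewrite (le_trans (sphere_coord _ Sz))//; lra.
- by rewrite normrM ger0_norm//; lra.
move=> t t1; rewrite tnth_prot -/p -/q; set e := _ * tnth z i + _.
have e2 : `|e| <= 2.
  by apply: le_trans (ler_normD _ _) _; rewrite -[2]/(1 + 1) lerD ?bz.
(* Exact remainder: the cosine minus 1 is -2 t^2 / (1 + t^2), and the sine minus 2 t is -2 t^3 / (1
   + t^2). Each is at most 2 t^2 in absolute value and multiplies a quantity bounded by 2, whence
   the constant 8. *)
rewrite (_ : _ - _ - _ = - (2 * t ^+ 2 / (1 + t ^+ 2)) * e -
   2 * t ^+ 3 / (1 + t ^+ 2) * (p - q)); last by field; exact: rot_den.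
have t20 := sqr_ge0 t.
have d1 : (1 + t ^+ 2)^-1 <= 1 by rewrite invf_le1 ?lerDl// ltr_pwDl.
have d0 : 0 <= (1 + t ^+ 2)^-1 by rewrite invr_ge0 addr_ge0.
have tt0 : 0 <= 2 * t ^+ 2 by apply: mulr_ge0.
have q0 : 0 <= 2 * t ^+ 2 / (1 + t ^+ 2) by apply: mulr_ge0.
apply: le_trans (ler_normB _ _) _; rewrite [8 * _](_ : _ = 4 * t ^+ 2 + 4 * t ^+ 2); last by ring.
apply: lerD.
- rewrite normrM normrN (ger0_norm q0).
  rewrite (_ : 4 * t ^+ 2 = 2 * t ^+ 2 * 2); last by ring.
  by apply: ler_pM => //; rewrite ler_piMr.
- rewrite normrM (_ : 4 * t ^+ 2 = 2 * t ^+ 2 * 2); last by ring.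
  apply: ler_pM => //; rewrite normrM [X in _ * X]ger0_norm//.
  apply: le_trans (_ : `|2 * t ^+ 3| <= _); first by rewrite ler_piMr.
  rewrite normrM ger0_norm// ler_wpM2l// exprS normrM [X in _ * X]ger0_norm//.
  by rewrite ler_piMl.
Qed.

Lemma tangD i j u u' v v' : tang i j u u' -> tang i j v v' ->
  tang i j (fun z => u z + v z) (fun z => u' z + v' z).
Proof.
move=> [mu_ mu' [B [B0 H]]] [mv mv' [C [C0 K]]].
split; [exact: measurable_funD|exact: measurable_funD|].
exists (B + C); split; first exact: addr_ge0.
move=> z Sz; have [h1 h2 h3] := H z Sz; have [k1 k2 k3] := K z Sz; split.
- by apply: le_trans (ler_normD _ _) _; exact: lerD.
- by apply: le_trans (ler_normD _ _) _; exact: lerD.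
- move=> t t1.
  rewrite (_ : _ - _ - _ = (u (prot i j t z) - u z - t * u' z) +
     (v (prot i j t z) - v z - t * v' z)); last ring.
  by rewrite mulrDl; apply: le_trans (ler_normD _ _) _; apply: lerD; [exact: h3|exact: k3].
Qed.

Lemma tangM i j u u' v v' : tang i j u u' -> tang i j v v' ->
  tang i j (fun z => u z * v z) (fun z => u' z * v z + u z * v' z).
Proof.
move=> [mu_ mu' [B' [B0' H']]] [mv mv' [C' [C0' K']]].
split; [exact: measurable_funM|by apply: measurable_funD; exact: measurable_funM|].
pose B := B' + C'; have B0 : 0 <= B by exact: addr_ge0.
have le1 a : a <= B' -> a <= B by move=> h; rewrite (le_trans h)// lerDl.
have le2 a : a <= C' -> a <= B by move=> h; rewrite (le_trans h)// lerDr.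
have nM (a b p q : R) : `|a| <= p -> `|b| <= q -> `|a * b| <= p * q.
  by move=> h1 h2; rewrite normrM ler_pM.
(* The remainder of a product splits into four terms, contributing 1 + 2 + 2 + 1 times B^2 t^2 when
   |t| is at most 1. *)
exists (6 * B ^+ 2); split; first by rewrite mulr_ge0// sqr_ge0.
move=> z Sz; have [h1 h2 h3] := H' z Sz; have [k1 k2 k3] := K' z Sz.
have BB := sqr_ge0 B; split.
- by apply: le_trans (nM _ _ _ _ (le1 _ h1) (le2 _ k1)) _; nra.
- apply: le_trans (ler_normD _ _) _.
  have := nM _ _ _ _ (le1 _ h2) (le2 _ k1); have := nM _ _ _ _ (le1 _ h1) (le2 _ k2).
  by set a := `|_|; set b := `|_|; nra.
- move=> t t1; have t20 := sqr_ge0 t.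
  have t21 : t ^+ 2 <= 1 by rewrite -(real_normK (num_real t)) expr_le1.
  have r1 : `|u (prot i j t z) - u z - t * u' z| <= B * t ^+ 2.
    by apply: le_trans (h3 t t1) _; rewrite ler_wpM2r// lerDl.
  have r2 : `|v (prot i j t z) - v z - t * v' z| <= B * t ^+ 2.
    by apply: le_trans (k3 t t1) _; rewrite ler_wpM2r// lerDr.
  move: (le1 _ h1) (le1 _ h2) (le2 _ k1) (le2 _ k2) r1 r2.
  have -> : u (prot i j t z) * v (prot i j t z) - u z * v z -
      t * (u' z * v z + u z * v' z) =
    t ^+ 2 * (u' z * v' z) +
    (u z + t * u' z) * (v (prot i j t z) - v z - t * v' z) +
    (u (prot i j t z) - u z - t * u' z) * (v z + t * v' z) +
    (u (prot i j t z) - u z - t * u' z) * (v (prot i j t z) - v z - t * v' z) by ring.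
  move: (u (prot i j t z) - u z - t * u' z) (v (prot i j t z) - v z - t * v' z) => r s.
  move: (u z) (u' z) (v z) (v' z) => a a' b b' ha ha' hb hb' hr hs.
  have tle (p q : R) : `|p| <= B -> `|q| <= B -> `|p + t * q| <= 2 * B.
    move=> hp hq; apply: le_trans (ler_normD _ _) _.
    rewrite (_ : 2 * B = B + 1 * B); last ring.
    by apply: lerD => //; exact: nM.
  apply: le_trans (ler_normD _ _) _; rewrite (_ : 6 * B ^+ 2 * t ^+ 2 =
    t ^+ 2 * (B * B) + 2 * B * (B * t ^+ 2) + B * t ^+ 2 * (2 * B) +
    B * t ^+ 2 * (B * 1)); last ring.
  apply: lerD; last first.
    by apply: nM => //; apply: le_trans hs _; rewrite ler_wpM2l.
  apply: le_trans (ler_normD _ _) _; apply: lerD; last by apply: nM => //; exact: tle.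
  apply: le_trans (ler_normD _ _) _; apply: lerD; last by apply: nM => //; exact: tle.
  by rewrite normrM ger0_norm// ler_wpM2l//; exact: nM.
Qed.

Lemma tang_sum i j (I : Type) (s : seq I) (u u' : I -> T -> R) :
  (forall a, tang i j (u a) (u' a)) ->
  tang i j (fun z => \sum_(a <- s) u a z) (fun z => \sum_(a <- s) u' a z).
Proof.
move=> H; elim: s => [|a s IH].
  by apply: (tang_eq (tang_cst i j 0)) => z; rewrite big_nil.
by apply: (tang_eq (tangD (H a) IH)) => z; rewrite big_cons.
Qed.

Lemma tang_scale i j (c : R) u u' : tang i j u u' ->
  tang i j (fun z => c * u z) (fun z => c * u' z).
Proof.
by move=> H; apply: (tang_ext (tangM (tang_cst i j c) H)) => z; rewrite mul0r add0r.
Qed.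

Lemma tang_inner i j x : tang i j (inner x)
  (fun z => 2 * (tnth x j * tnth z i - tnth x i * tnth z j)).
Proof.
have H k := tang_scale (tnth x k) (tang_coord i j k).
apply: (tang_ext (tang_sum (index_enum _) H)) => z /=.
have D b c : \sum_a tnth x a * ((a == b)%:R * c) = tnth x b * c.
  rewrite (bigD1 b)//= eqxx mul1r big1 ?addr0//.
  by move=> a /negbTE ->; rewrite mul0r mulr0.
rewrite -!D -sumrB mulr_sumr; apply: eq_bigr => a _; ring.
Qed.

Lemma tang_horner i j x (p : {poly R}) : tang i j (fun z => p.[inner x z])
  (fun z => p^`().[inner x z] * (2 * (tnth x j * tnth z i - tnth x i * tnth z j))).
Proof.
elim/poly_ind: p => [|p c IH].
  rewrite (_ : (fun z => _) = fun=> 0); last by apply/funext => z; rewrite horner0.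
  by apply: (tang_ext (tang_cst i j 0)) => z; rewrite deriv0 horner0 mul0r.
rewrite (_ : (fun z => _) = fun z => p.[inner x z] * inner x z + c); last first.
  by apply/funext => z; rewrite hornerMXaddC.
apply: (tang_ext (tangD (tangM IH (tang_inner i j x)) (tang_cst i j c))) => z /=.
by rewrite derivMXaddC hornerD hornerMX; ring.
Qed.

Lemma L1_sphere_bounded (u : T -> R) (B : R) : measurable_fun setT u ->
  (forall z, S z -> `|u z| <= B) -> L1 mu (fun z => u (sproj z)).
Proof.
move=> mu_ uB; apply: (L1_bounded mu (M := B)).
  by apply: (measurableT_comp mu_); exact: measurable_sproj.
by move=> z; apply: uB; exact: sproj_sphere.
Qed.

Lemma tang_L1 i j u u' : tang i j u u' -> L1 mu (fun z => u (sproj z)).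
Proof.
by move=> [mu_ _ [B [_ H]]]; apply: (@L1_sphere_bounded _ B) => // z Sz; have [] := H z Sz.
Qed.

Lemma tang_L1' i j u u' : tang i j u u' -> L1 mu (fun z => u' (sproj z)).
Proof.
by move=> [_ mu' [B [_ H]]]; apply: (@L1_sphere_bounded _ B) => // z Sz; have [] := H z Sz.
Qed.

(** Invariance gives u and its rotated version the same integral, so t times the integral of u' is
    at most B t^2 in absolute value. Dividing by t and letting t tend to 0 replaces differentiation
    under the integral sign. *)
Lemma tang_int0 i j u u' : i != j -> tang i j u u' ->
  \int[mu]_z u' (sproj z) = 0.
Proof.
move=> ij H; have L := tang_L1 H; have L' := tang_L1' H.
case: H => mu_ mu' [B [B0 H]].
have key t : 0 < t -> t <= 1 -> `|\int[mu]_z u' (sproj z)| <= B * t.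
  move=> t0 t1; have oQ := rot_mx_orthogonal t ij.
  have t1' : `|t| <= 1 by rewrite gtr0_norm.
  have LQ : L1 mu (fun z => u (prot i j t (sproj z))).
    apply: (@L1_sphere_bounded (fun z => u (prot i j t z)) B).
      by apply: (measurableT_comp mu_); exact: measurable_mat_act.
    by move=> z Sz; have [|] := H (prot i j t z) => //; exact: mat_act_sphere.
  have EQ : \int[mu]_z u (prot i j t (sproj z)) = \int[mu]_z u (sproj z).
    apply: (f_equal fine); rewrite (integral_rot_sproj oQ (F := EFin \o u))//.
    exact/measurable_EFinP.
  have : `|\int[mu]_z (u (prot i j t (sproj z)) - u (sproj z) - t * u' (sproj z))| <=
      \int[mu]_z (B * t ^+ 2).
    apply: normr_Ex_le; [|exact: L1_cst|].
      by apply: L1B; [exact: L1B|exact: L1Z].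
    by move=> z; have [_ _] := H _ (sproj_sphere z); exact.
  rewrite Ex_cst RintegralB//; [|exact: L1B|exact: L1Z].
  rewrite RintegralB// EQ subrr sub0r normrN RintegralZl// normrM gtr0_norm//.
  by rewrite expr2 mulrCA ler_pM2l.
apply/eqP; rewrite -normr_le0; apply/ler_addgt0Pr => e e0; rewrite add0r.
pose t := Num.min 1 (e / (B + 1)).
have B1 : 0 < B + 1 by rewrite ltr_wpDl.
have t0 : 0 < t by rewrite lt_min ltr01 divr_gt0.
have t1 : t <= 1 by rewrite ge_min lexx.
apply: le_trans (key t t0 t1) _.
have te : t <= e / (B + 1) by rewrite ge_min lexx orbT.
apply: le_trans (ler_wpM2l B0 te) _.
rewrite mulrCA; apply: ler_piMr; first exact: ltW.
by rewrite ler_pdivrMr// mul1r lerDl.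
Qed.

End sphere_measure.

(** * Integration by parts for zonal polynomials *)

Section zonal_pairing.
Context {R : realType} {m : nat}.
Local Notation T := (m.+1.-tuple R).
Local Notation S := (@unit_sphere R m).
Implicit Types (x y z : T) (i j k : 'I_m.+1) (p q f g : {poly R}).
Variable mu : probability T R.
Hypothesis muS : mu S = 1%E.
Hypothesis mu_inv : forall Q : 'M[R]_m.+1, orthogonal_mx Q ->
  forall A, measurable A -> mu A = mu (mat_act Q @^-1` A).

Definition zpair x y p q : R :=
  \int[mu]_z (p.[inner x (sproj z)] * q.[inner y (sproj z)]).

(** The boundedness contained in [tang] is all that matters here, hence the arbitrary pair of
    indices. *)
Lemma zpair_L1 x y p q :
  L1 mu (fun z => p.[inner x (sproj z)] * q.[inner y (sproj z)]).
Proof. exact: (tang_L1 mu (tangM (tang_horner ord0 ord0 x p) (tang_horner ord0 ord0 y q))). Qed.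

Lemma zpair_int x y p q (c : R) :
  \int[mu]_z (c * (p.[inner x (sproj z)] * q.[inner y (sproj z)])) = c * zpair x y p q.
Proof. exact: RintegralZl measurableT (zpair_L1 x y p q). Qed.

Lemma zpairC x y p q : zpair x y p q = zpair y x q p.
Proof. by apply: eq_Rintegral => z _; rewrite mulrC. Qed.

Lemma zpairDl x y p p' q : zpair x y (p + p') q = zpair x y p q + zpair x y p' q.
Proof.
rewrite /zpair -RintegralD//; [|exact: zpair_L1|exact: zpair_L1].
by apply: eq_Rintegral => z _; rewrite hornerD mulrDl.
Qed.

Lemma zpairZl x y (c : R) p q : zpair x y (c%:P * p) q = c * zpair x y p q.
Proof.
rewrite /zpair -RintegralZl//; last exact: zpair_L1.
by apply: eq_Rintegral => z _; rewrite hornerM hornerC mulrA.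
Qed.

Lemma zpairDr x y p q q' : zpair x y p (q + q') = zpair x y p q + zpair x y p q'.
Proof. by rewrite zpairC zpairDl ![zpair y x _ _]zpairC. Qed.

Lemma zpairZr x y (c : R) p q : zpair x y p (c%:P * q) = c * zpair x y p q.
Proof. by rewrite zpairC zpairZl [zpair y x _ _]zpairC. Qed.

Lemma zpair0l x y q : zpair x y 0 q = 0.
Proof. by rewrite -(mul0r (0 : {poly R})) -polyC0 zpairZl mul0r. Qed.

Lemma zpair0r x y p : zpair x y p 0 = 0.
Proof. by rewrite zpairC zpair0l. Qed.

(** The weights x_i y_j combine the coordinate rotations into the infinitesimal rotation in the
    plane of x and y. The formula says that the derivative of f(x.z) g(y.z) along it integrates to
    0. *)
Lemma zpair_first_order x y f g : S x -> S y ->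
  inner x y * zpair x y (f^`() * 'X) g - zpair x y f^`() (g * 'X) +
  zpair x y (f * 'X) g^`() - inner x y * zpair x y f (g^`() * 'X) = 0.
Proof.
move=> Sx Sy; set rho := inner x y.
pose D i j z := f^`().[inner x z] * (2 * (tnth x j * tnth z i - tnth x i * tnth z j)) *
    g.[inner y z] + f.[inner x z] *
    (g^`().[inner y z] * (2 * (tnth y j * tnth z i - tnth y i * tnth z j))).
have tD i j := tangM (tang_horner i j x f) (tang_horner i j y g).
have LD i j : L1 mu (fun z => D i j (sproj z)) := tang_L1' mu (tD i j).
have ID i j : \int[mu]_z D i j (sproj z) = 0.
  have [->|ij] := eqVneq i j; last exact: (tang_int0 muS mu_inv ij (tD i j)).
  rewrite -[RHS](Ex_cst mu); apply: eq_Rintegral => z _.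
  by rewrite /D; ring.
have sumD z : \sum_i \sum_j tnth x i * tnth y j * D i j z =
   2 * ((f^`().[inner x z] * g.[inner y z]) * (inner x z * rho - inner y z) +
        (f.[inner x z] * g^`().[inner y z]) * (inner x z - inner y z * rho)).
  have E i j : tnth x i * tnth y j * D i j z =
     2 * (f^`().[inner x z] * g.[inner y z]) * ((tnth x i * tnth z i) * (tnth x j * tnth y j)) -
     2 * (f^`().[inner x z] * g.[inner y z]) * ((tnth x i * tnth x i) * (tnth y j * tnth z j)) +
     2 * (f.[inner x z] * g^`().[inner y z]) * ((tnth x i * tnth z i) * (tnth y j * tnth y j)) -
     2 * (f.[inner x z] * g^`().[inner y z]) * ((tnth x i * tnth y i) * (tnth y j * tnth z j)).
    by rewrite /D; ring.
  under eq_bigr do under eq_bigr do rewrite E.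
  under eq_bigr do rewrite sumrB big_split/= sumrB -!mulr_sumr.
  rewrite sumrB big_split/= sumrB -!mulr_sumr -!mulr_suml.
  have -> : \sum_i tnth x i * tnth z i = inner x z by [].
  have -> : \sum_i tnth x i * tnth y i = rho by [].
  have -> : \sum_i tnth x i * tnth x i = 1 by exact: Sx.
  have -> : \sum_i tnth y i * tnth y i = 1 by exact: Sy.
  have -> : \sum_i tnth y i * tnth z i = inner y z by [].
  by ring.
have : \int[mu]_z (\sum_i \sum_j tnth x i * tnth y j * D i j (sproj z)) = 0.
  rewrite Ex_sum => [|i _]; last by apply: L1_sum => j _; exact: L1Z.
  rewrite big1// => i _; rewrite Ex_sum => [|j _]; last exact: L1Z.
  by rewrite big1// => j _; rewrite (RintegralZl _ measurableT (LD i j)) [X in _ * X](ID i j) mulr0.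
under eq_Rintegral do rewrite sumD.
have -> : \int[mu]_z (2 * ((f^`().[inner x (sproj z)] * g.[inner y (sproj z)]) *
      (inner x (sproj z) * rho - inner y (sproj z)) +
      (f.[inner x (sproj z)] * g^`().[inner y (sproj z)]) *
      (inner x (sproj z) - inner y (sproj z) * rho))) =
  \int[mu]_z (2 * rho * ((f^`() * 'X).[inner x (sproj z)] * g.[inner y (sproj z)]) -
    2 * (f^`().[inner x (sproj z)] * (g * 'X).[inner y (sproj z)]) +
    2 * ((f * 'X).[inner x (sproj z)] * g^`().[inner y (sproj z)]) -
    2 * rho * (f.[inner x (sproj z)] * (g^`() * 'X).[inner y (sproj z)])).
  by apply: eq_Rintegral => z _; rewrite !hornerMX; ring.
have L := zpair_L1 x y.
rewrite RintegralB//; [|by do ?[apply: L1B|apply: L1D]; exact: L1Z|exact: L1Z].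
rewrite RintegralD//; [|by apply: L1B; exact: L1Z|exact: L1Z].
rewrite RintegralB//; [|exact: L1Z|exact: L1Z].
by rewrite !zpair_int; lra.
Qed.

(** Green's formula on the sphere of dimension m: the first two terms pair the tangential gradients
    of f(x.z) and g(y.z), and the last one pairs f with the Laplacian of the zonal function g. It
    comes from summing, over all coordinate planes, the rotation derivative of f times the rotation
    derivative of g. *)
Lemma zpair_second_order x y f g : S x -> S y ->
  inner x y * zpair x y f^`() g^`() - zpair x y (f^`() * 'X) (g^`() * 'X) +
  zpair x y f ((1 - 'X ^+ 2) * g^`()^`() - m%:R%:P * ('X * g^`())) = 0.
Proof.
move=> Sx Sy; set rho := inner x y.
pose w i j z := tnth y j * tnth z i - tnth y i * tnth z j.
(* The factor [i != j] matters: [w i i] is identically 0, whereas the formula for the derivative of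
   [w i j] does not vanish on the diagonal. It is also why the dimension m appears instead of m +
   1. *)
pose D i j z := f^`().[inner x z] * (2 * (tnth x j * tnth z i - tnth x i * tnth z j)) *
    (g^`().[inner y z] * w i j z) + f.[inner x z] *
    (g^`()^`().[inner y z] * (2 * w i j z) * w i j z +
     g^`().[inner y z] * ((i != j)%:R * (2 * (- (tnth y j * tnth z j) - tnth y i * tnth z i)))).
have tw i j : i != j -> tang i j (w i j)
    (fun z => (i != j)%:R * (2 * (- (tnth y j * tnth z j) - tnth y i * tnth z i))).
  move=> ij; apply: (tang_eq (tangD (tang_scale (tnth y j) (tang_coord i j i))
     (tang_scale (- tnth y i) (tang_coord i j j)))) => z; first by rewrite /w; ring.
  rewrite !eqxx (negbTE ij) eq_sym (negbTE ij).
  by rewrite -[true%:R]/(1 : R) -[false%:R]/(0 : R); ring.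
have tD i j : i != j -> tang i j
    (fun z => f.[inner x z] * (g^`().[inner y z] * w i j z)) (D i j).
  by move=> ij; exact: (tangM (tang_horner i j x f) (tangM (tang_horner i j y g^`()) (tw i j ij))).
have D0 i z : D i i z = 0.
  by rewrite /D /w eqxx -[(~~ true)%:R]/(0 : R); ring.
have LD i j : L1 mu (fun z => D i j (sproj z)).
  have [->|ij] := eqVneq i j; last exact: (tang_L1' mu (tD i j ij)).
  by apply: (L1_ext (L1_cst mu 0)) => z; rewrite D0.
have ID i j : \int[mu]_z D i j (sproj z) = 0.
  have [->|ij] := eqVneq i j; last exact: (tang_int0 muS mu_inv ij (tD i j ij)).
  by rewrite -[RHS](Ex_cst mu); apply: eq_Rintegral => z _; rewrite D0.
have sumD z : S z -> \sum_i \sum_j D i j z =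
   4 * (f^`().[inner x z] * g^`().[inner y z] * (rho - inner x z * inner y z) +
    f.[inner x z] * (g^`()^`().[inner y z] * (1 - inner y z ^+ 2) -
       m%:R * (inner y z * g^`().[inner y z]))).
  move=> Sz.
  have E i j : D i j z =
     2 * (f^`().[inner x z] * g^`().[inner y z]) *
       (((tnth z i * tnth z i) * (tnth x j * tnth y j) -
         (tnth y i * tnth z i) * (tnth x j * tnth z j)) +
        ((tnth x i * tnth y i) * (tnth z j * tnth z j) -
         (tnth x i * tnth z i) * (tnth y j * tnth z j))) +
     2 * (f.[inner x z] * g^`()^`().[inner y z]) *
       (((tnth z i * tnth z i) * (tnth y j * tnth y j) -
         (tnth y i * tnth z i) * (tnth y j * tnth z j)) +
        ((tnth y i * tnth y i) * (tnth z j * tnth z j) -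
         (tnth y i * tnth z i) * (tnth y j * tnth z j))) -
     2 * (f.[inner x z] * g^`().[inner y z]) *
       (((i != j)%:R * (tnth y j * tnth z j)) + (i != j)%:R * (tnth y i * tnth z i)).
    by rewrite /D /w; ring.
  have sum_neq (a : 'I_m.+1 -> R) : \sum_i \sum_j (i != j)%:R * a j = m%:R * \sum_j a j.
    rewrite exchange_big/= mulr_sumr; apply: eq_bigr => j _; rewrite -mulr_suml.
    congr (_ * _); rewrite -natr_sum; congr (_%:R).
    transitivity (\sum_(i < m.+1 | i != j) 1)%N.
      by rewrite [RHS]big_mkcond; apply: eq_bigr => i _; case: (i != j).
    by rewrite sum1_card cardC1 card_ord.
  have sum_neq' (a : 'I_m.+1 -> R) : \sum_i \sum_j (i != j)%:R * a i = m%:R * \sum_j a j.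
    by rewrite exchange_big -sum_neq; apply: eq_bigr => j _; apply: eq_bigr => i _; rewrite eq_sym.
  under eq_bigr do under eq_bigr do rewrite E.
  under eq_bigr do rewrite sumrB big_split/= -!mulr_sumr !big_split/= !sumrN -!mulr_sumr.
  rewrite sumrB big_split/= -!mulr_sumr !big_split/= !sumrN -!mulr_suml sum_neq sum_neq'.
  have -> : \sum_i tnth x i * tnth z i = inner x z by [].
  have -> : \sum_i tnth x i * tnth y i = rho by [].
  have -> : \sum_i tnth z i * tnth z i = 1 by exact: Sz.
  have -> : \sum_i tnth y i * tnth y i = 1 by exact: Sy.
  have -> : \sum_i tnth y i * tnth z i = inner y z by [].
  by ring.
have : \int[mu]_z (\sum_i \sum_j D i j (sproj z)) = 0.
  rewrite Ex_sum => [|i _]; last by apply: L1_sum => j _.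
  by rewrite big1// => i _; rewrite Ex_sum// big1.
under eq_Rintegral do rewrite (sumD _ (sproj_sphere _)).
set h := (1 - 'X ^+ 2) * _ - _.
have -> : \int[mu]_z (4 * (f^`().[inner x (sproj z)] * g^`().[inner y (sproj z)] *
      (rho - inner x (sproj z) * inner y (sproj z)) +
      f.[inner x (sproj z)] * (g^`()^`().[inner y (sproj z)] *
        (1 - inner y (sproj z) ^+ 2) -
      m%:R * (inner y (sproj z) * g^`().[inner y (sproj z)])))) =
  \int[mu]_z (4 * rho * (f^`().[inner x (sproj z)] * g^`().[inner y (sproj z)]) -
    4 * ((f^`() * 'X).[inner x (sproj z)] * (g^`() * 'X).[inner y (sproj z)]) +
    4 * (f.[inner x (sproj z)] * h.[inner y (sproj z)])).
  apply: eq_Rintegral => z _; rewrite !hornerMX /h hornerD hornerN !hornerM.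
  by rewrite hornerD hornerN hornerXn hornerX !hornerC; ring.
have L := zpair_L1 x y.
rewrite RintegralD//; [|by apply: L1B; exact: L1Z|exact: L1Z].
rewrite RintegralB//; [|exact: L1Z|exact: L1Z].
by rewrite !zpair_int; lra.
Qed.

End zonal_pairing.

(** * Orthogonality and convolution of Gegenbauer polynomials *)

Section gegenbauer_convolution.
Context {R : realType} {m : nat}.
Local Notation T := (m.+1.-tuple R).
Local Notation S := (@unit_sphere R m).
Implicit Types (x y z : T).
Variable mu : probability T R.
Hypothesis muS : mu S = 1%E.
Hypothesis mu_inv : forall Q : 'M[R]_m.+1, orthogonal_mx Q ->
  forall A, measurable A -> mu A = mu (mat_act Q @^-1` A).
Hypothesis m2 : (2 <= m)%N.
Variable lam : R.
Hypothesis lamE : 2 * lam + 1 = m%:R.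
Local Notation C := (geg lam).
Local Notation zpair := (zpair mu).

Let lam_gt0 : 0 < lam.
Proof.
have : (1 : R) < m%:R by rewrite ltr1n.
by rewrite -lamE; lra.
Qed.

Let der1 : (1 : {poly R})^`() = 0.
Proof. exact: derivC. Qed.

Let hor1 c : (1 : {poly R}).[c] = 1.
Proof. exact: hornerC. Qed.

(** Self-adjointness of the Laplacian: exchanging the roles of the two polynomials in Green's
    formula leaves the gradient terms unchanged, so the difference of eigenvalues annihilates the
    pairing. That difference is (k - l) (k + l + 2 lam), with a positive last factor. *)
Lemma zpair_geg_orth x y k l : S x -> S y -> k != l -> zpair x y (C k) (C l) = 0.
Proof.
move=> Sx Sy kl.
have L n : (1 - 'X ^+ 2) * (C n)^`()^`() - m%:R%:P * ('X * (C n)^`()) =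
    (- (n%:R * (n%:R + 2 * lam)))%:P * C n.
  rewrite geg_ode -lamE !polyCD polyCN !polyCM !polyCD !polyCM !polyC_natr polyC1; ring.
have H1 := zpair_second_order muS mu_inv (C k) (C l) Sx Sy.
have H2 := zpair_second_order muS mu_inv (C l) (C k) Sy Sx.
rewrite L zpairZr in H1; rewrite L zpairZr in H2.
rewrite innerC ![zpair y x _ _]zpairC in H2.
have : (k%:R * (k%:R + 2 * lam) - l%:R * (l%:R + 2 * lam)) * zpair x y (C k) (C l) = 0.
  by move: H1 H2; set a := zpair _ _ _ _; set b := zpair _ _ _ _; set c := zpair _ _ _ _; nra.
move=> /eqP; rewrite mulf_eq0 => /orP[|/eqP//].
rewrite (_ : _ - _ = (k%:R - l%:R) * (k%:R + l%:R + 2 * lam)); last by ring.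
rewrite mulf_eq0 subr_eq0 eqr_nat (negbTE kl)/= gt_eqF//.
by rewrite ltr_wpDl ?addr_ge0// mulr_gt0.
Qed.

Let deriv_geg1 : (C 1)^`() = (2 * lam)%:P * C 0.
Proof.
have [_] := geg_deriv lam 0.
rewrite geg0 der1 mulr0 subr0 => ->.
by rewrite polyCM !polyC_natr add0r.
Qed.

Let deriv_gegSS k : (C k.+2)^`() = (C k)^`() + (2 * (k%:R + 1 + lam))%:P * C k.+1.
Proof. by rewrite geg_derivS2 polyCM !polyCD !polyC_natr polyC1. Qed.

(** Descending by two, the derivative of [C a] is a combination of C (a-1), C (a-3), and so on, all
    of index smaller than b. *)
Lemma zpair_deriv_geg_ge x y a b : S x -> S y -> (a <= b)%N ->
  zpair x y (C a)^`() (C b) = 0.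
Proof.
move=> Sx Sy; elim/ltn_ind: a => -[|[|a]] IH ab.
- by rewrite geg0 der1 zpair0l.
- by rewrite deriv_geg1 zpairZl zpair_geg_orth ?mulr0// neq_ltn ab.
- rewrite deriv_gegSS zpairDl zpairZl zpair_geg_orth//; last by rewrite neq_ltn ab.
  by rewrite mulr0 addr0 IH// ltnW// ltnW.
Qed.

Lemma zpair_deriv_gegS x y k : S x -> S y ->
  zpair x y (C k.+1)^`() (C k) = 2 * (k%:R + lam) * zpair x y (C k) (C k).
Proof.
move=> Sx Sy; case: k => [|k]; first by rewrite deriv_geg1 zpairZl add0r.
rewrite deriv_gegSS zpairDl zpairZl zpair_deriv_geg_ge//.
by rewrite add0r -[k.+1%:R]natr1.
Qed.

(** Both sides satisfy the Gegenbauer three-term recurrence at rho with the same first two values.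
    For the left side, multiplication by rho is provided by [main], and the result is expanded by
    the recurrence for 'X times a Gegenbauer polynomial. *)
Lemma zpair_geg_conv x y k : S x -> S y ->
  (k%:R + lam) * zpair x y (C k) (C k) = lam * (C k).[inner x y].
Proof.
move=> Sx Sy; set rho := inner x y.
have hC n : (n%:R : {poly R}).[rho] = n%:R by rewrite -polyC_natr hornerC.
have xC0 : (2 * lam)%:P * (C 0 * 'X) = C 1.
  by rewrite geg0 geg1 polyCM polyC_natr; ring.
have xCS n : (2 * (n%:R + 1 + lam))%:P * (C n.+1 * 'X) =
    (n%:R + 2)%:P * C n.+2 + (n%:R + 2 * lam)%:P * C n.
  have := gegS lam n.
  rewrite !(polyCM, polyCD, polyC_natr, polyC1) => E.
  have -> : (n%:R + 2) * C n.+2 = 2 * (n%:R + 1 + lam%:P) * 'X * C n.+1 -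
     (n%:R + 2 * lam%:P) * C n by [].
  by ring.
have recS n : zpair x y (C n.+2 * 'X) (C n)^`() = 0.
  have n0 : 2 * (n.+1%:R + 1 + lam) != 0.
    by rewrite gt_eqF// mulr_gt0// ltr_wpDl// addr_ge0.
  apply: (mulfI n0); rewrite mulr0 -zpairZl xCS zpairDl !zpairZl.
  rewrite ![zpair x y _ (C n)^`()]zpairC !zpair_deriv_geg_ge ?mulr0 ?addr0//.
  lia.
have recD n : zpair x y (C n.+2) ((C n)^`() * 'X) = 0.
  case: n => [|n]; first by rewrite geg0 der1 mul0r zpair0r.
  have [I1 _] := geg_deriv lam n.
  have -> : (C n.+1)^`() * 'X = (C n)^`() + (n%:R + 1)%:P * C n.+1.
    by rewrite polyCD polyC_natr polyC1 -I1; ring.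
  rewrite zpairDr zpairZr zpair_geg_orth//; last lia.
  by rewrite zpairC zpair_deriv_geg_ge ?mulr0 ?addr0//; lia.
have rec1 n : zpair x y ((C n.+2)^`() * 'X) (C n) = 2 * (n%:R + lam) * zpair x y (C n) (C n).
  have [I1 _] := geg_deriv lam n.+1.
  have -> : (C n.+2)^`() * 'X = (C n.+1)^`() + (n.+1%:R + 1)%:P * C n.+2.
    by rewrite polyCD polyC_natr polyC1 -I1; ring.
  rewrite zpairDl zpairZl zpair_deriv_gegS// (@zpair_geg_orth x y n.+2 n) ?mulr0 ?addr0//.
  lia.
(* In the first-order formula for C (n+2) and C n, the two terms involving the derivative of C n
   vanish by orthogonality. What remains turns a factor rho outside the integral into a factor 'X
   inside. *)
have main n : rho * (2 * (n%:R + lam) * zpair x y (C n) (C n)) =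
    zpair x y (C n.+2)^`() (C n * 'X).
  have := zpair_first_order muS mu_inv (C n.+2) (C n) Sx Sy.
  by rewrite recS recD rec1 -/rho; lra.
have base0 : zpair x y (C 0) (C 0) = 1.
  rewrite geg0 /zpair -[RHS](Ex_cst mu); apply: eq_Rintegral => z _.
  by rewrite !hor1 mulr1.
elim/ltn_ind: k => -[|[|k]] IH.
- by rewrite base0 geg0 hor1 add0r.
- have l0 : 2 * lam != 0 by rewrite gt_eqF// mulr_gt0.
  apply: (mulfI l0); have H := main 0%N; rewrite base0 add0r in H.
  have E := congr1 (zpair x y (C 2)^`()) xC0.
  rewrite zpairZr zpair_deriv_gegS// -H in E.
  have -> : (C 1).[rho] = 2 * lam * rho by rewrite geg1 !hornerM hC hornerC hornerX.
  transitivity (lam * (2 * (1%:R + lam) * zpair x y (C 1) (C 1))); first by ring.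
  by rewrite -E; ring.
- have E := congr1 (zpair x y (C k.+3)^`()) (xCS k).
  rewrite zpairZr zpairDr !zpairZr -main in E.
  rewrite (@zpair_deriv_gegS x y k.+2)// (deriv_gegSS k.+1) zpairDl zpairZl in E.
  rewrite (@zpair_deriv_gegS x y k)// (@zpair_geg_orth x y k.+2 k) ?mulr0 ?addr0 // in E; last lia.
  have hrec := congr1 (fun p => lam * p.[rho]) (xCS k).
  rewrite /= hornerD !hornerM !hornerC hornerX in hrec.
  have IH1 := IH k.+1 (leqnn _); have IH0 := IH k (leqnSn _).
  rewrite -!mulrA IH1 IH0 in E.
  have k2 : k%:R + 2 != 0 :> R by rewrite gt_eqF// ltr_wpDl.
  apply: (mulfI k2); move: E hrec.
  set t := (k.+2%:R + lam) * _; set c0 := (C k).[rho].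
  set c1 := (C k.+1).[rho]; set c2 := (C k.+2).[rho].
  move: t c0 c1 c2 => t c0 c1 c2 E hrec.
  have -> : (k%:R + 2) * t = ((k%:R + 2) * (2 * t) + (k%:R + 2 * lam) * (2 * (lam * c0))) / 2 -
    (k%:R + 2 * lam) * (lam * c0) by field.
  rewrite -E.
  have -> : (k%:R + 2) * (lam * c2) = lam * ((k%:R + 2) * c2 + (k%:R + 2 * lam) * c0) -
    (k%:R + 2 * lam) * (lam * c0) by ring.
  by rewrite -hrec; field.
Qed.

End gegenbauer_convolution.

(** * The zonal kernel of psi and its convolution square *)

Section zonal_kernel.
Context {R : realType} {m : nat}.
Local Notation T := (m.+1.-tuple R).
Local Notation S := (@unit_sphere R m).
Implicit Types (x y z : T) (mu nu : probability T R).

Definition sphere_uniform mu := mu S = 1%E /\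
  forall Q : 'M[R]_m.+1, orthogonal_mx Q ->
  forall A, measurable A -> mu A = mu (mat_act Q @^-1` A).

(* Uniqueness of the invariant law, tested on zonal functions. *)
Lemma zonal_unique mu nu (phi : R -> \bar R) x y :
  sphere_uniform mu -> sphere_uniform nu -> measurable_fun setT phi ->
  (forall t, 0 <= phi t)%E -> S x -> S y ->
  (\int[mu]_z phi (inner x (sproj z)) = \int[nu]_z phi (inner y (sproj z)))%E.
Proof.
move=> [muS muI] [nuS nuI] mphi phi0 Sx Sy.
(* By invariance the integral does not depend on the fixed point, so it may be averaged over that
   point under the other law. Both sides then become one double integral, by Tonelli and the
   symmetry of [inner]. *)
have cstE (la la' : probability T R) w : sphere_uniform la -> S w ->
    (\int[la]_z phi (inner w (sproj z)) =
     \int[la']_w \int[la]_z phi (inner (sproj w) (sproj z)))%E.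
  move=> [laS laI] Sw.
  transitivity (\int[la']_w' cst (\int[la]_z phi (inner w (sproj z)))%E w')%E.
    by rewrite integral_cst// [X in (_ * X)%E](probability_setT la') mule1.
  apply: eq_integral => w' _ /=.
  exact: (integral_zonal laS laI mphi Sw (sproj_sphere w')).
rewrite (cstE mu nu)// (cstE nu mu)//.
rewrite (fubini_tonelli (m1 := nu) (m2 := mu) (fun p => phi (inner (sproj p.1) (sproj p.2))))//=.
- apply: eq_integral => z _; apply: eq_integral => w _; by rewrite innerC.
- apply: (measurableT_comp mphi); apply: measurable_inner.
    by apply: (measurableT_comp measurable_sproj); exact: measurable_fst.
  by apply: (measurableT_comp measurable_sproj); exact: measurable_snd.
Qed.

Hypothesis m2 : (2 <= m)%N.
Variable lam : R.
Hypothesis lamE : 2 * lam + 1 = m%:R.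
Local Notation C := (geg lam).

Let lam_gt0 : 0 < lam.
Proof.
have : (1 : R) < m%:R by rewrite ltr1n.
by rewrite -lamE; lra.
Qed.

Definition geg_sum (a : nat -> R) (K : nat) : {poly R} :=
  \sum_(1 <= k < K.+1) (a k)%:P * C k.

Lemma geg_sumS a K : geg_sum a K.+1 = geg_sum a K + (a K.+1)%:P * C K.+1.
Proof. by rewrite /geg_sum big_nat_recr. Qed.

(** The sums start at index 1, so l = 0 is covered as well; as C 0 = 1, that case is what makes the
    kernel and its convolution centred. *)
Lemma zpair_geg_sum_gt mu x y a K l : sphere_uniform mu -> S x -> S y ->
  (l = 0%N) \/ (K < l)%N -> zpair mu x y (geg_sum a K) (C l) = 0.
Proof.
move=> [muS muI] Sx Sy; elim: K => [|K IH] Kl.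
  by rewrite /geg_sum big_geq// zpair0l.
rewrite geg_sumS zpairDl IH; last by case: Kl => [->|Kl]; [left|right; exact: ltnW].
rewrite zpairZl (zpair_geg_orth muS muI m2 lamE) ?mulr0 ?addr0//.
by case: Kl => [->//|Kl]; rewrite neq_ltn Kl.
Qed.

Lemma zpair_geg_sum mu x y a b K : sphere_uniform mu -> S x -> S y ->
  zpair mu x y (geg_sum a K) (geg_sum b K) =
  \sum_(1 <= k < K.+1) a k * b k * (lam / (k%:R + lam)) * (C k).[inner x y].
Proof.
move=> H Sx Sy; elim: K => [|K IH].
  by rewrite /geg_sum !big_geq// zpair0l.
rewrite !geg_sumS big_nat_recr//= -IH zpairDl !zpairDr !zpairZl !zpairZr.
rewrite (zpair_geg_sum_gt _ H)//; last by right.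
rewrite [zpair mu x y (C _) (geg_sum _ _)]zpairC (zpair_geg_sum_gt _ H)//; last by right.
rewrite !mulr0 addr0 add0r; congr (_ + _).
have := zpair_geg_conv H.1 H.2 m2 lamE K.+1 Sx Sy => E.
have k0 : K.+1%:R + lam != 0 by rewrite gt_eqF// ltr_wpDl.
have -> : zpair mu x y (C K.+1) (C K.+1) = lam * (C K.+1).[inner x y] / (K.+1%:R + lam).
  by rewrite -E [RHS]mulrC mulKf.
by ring.
Qed.

Variables (mu0 : probability T R) (psi : R -> R) (u : nat -> R) (c B Q : R).
Hypothesis U0 : sphere_uniform mu0.
Hypothesis mpsi : measurable_fun setT psi.

(** With coefficients written (1 + k / lam) u_k, the factor lam / (k + lam) of the convolution
    formula cancels one normalisation. So u_k is the eigenvalue on harmonics of degree k, and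
    convolution squares it, which gives [G_sum]. *)
Definition psi_sum K := geg_sum (fun k => (1 + k%:R / lam) * u k) K.
Definition G_sum K := geg_sum (fun k => (1 + k%:R / lam) * u k ^+ 2) K.

Hypothesis psi_L2 : (\int[mu0]_z ((psi (inner pole (sproj z))) ^+ 2)%:E = c%:E)%E.
Hypothesis psi_L4 : (\int[mu0]_z ((psi (inner pole (sproj z))) ^+ 4)%:E <= B%:E)%E.
Hypothesis psi_cvg : (fun K => (\int[mu0]_z ((psi (inner pole (sproj z)) -
  (psi_sum K).[inner pole (sproj z)]) ^+ 2)%:E)%E) @ \oo --> 0%E.
Hypothesis Q_ub : forall K,
  \sum_(1 <= k < K.+1) u k ^+ 4 * ((1 + k%:R / lam) * (C k).[1]) <= Q.

Definition zker x y : R := psi (inner (sproj x) (sproj y)).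
Definition zconv x y : R := \int[mu0]_z (zker x z * zker y z).

Let measurable_sinner : measurable_fun setT (fun p : T * T => inner (sproj p.1) (sproj p.2)).
Proof.
apply: measurable_inner.
  by apply: (measurableT_comp measurable_sproj); exact: measurable_fst.
by apply: (measurableT_comp measurable_sproj); exact: measurable_snd.
Qed.

Lemma measurable_zker : measurable_fun setT (fun p : T * T => zker p.1 p.2).
Proof. exact: (measurableT_comp mpsi). Qed.

Let measurable_zinner x : measurable_fun setT (fun z : T => inner x (sproj z)).
Proof.
apply: measurable_inner; first exact: measurable_cst.
exact: measurable_sproj.
Qed.

Let measurable_zker1 x : measurable_fun setT (zker x).
Proof. exact: (measurableT_comp mpsi). Qed.

Lemma zkerC x y : zker x y = zker y x.
Proof. by rewrite /zker innerC. Qed.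

Let zE mu (phi : R -> R) x : sphere_uniform mu -> measurable_fun setT phi ->
  (forall t, 0 <= phi t) ->
  (\int[mu]_z (phi (inner (sproj x) (sproj z)))%:E =
   \int[mu0]_z (phi (inner pole (sproj z)))%:E)%E.
Proof.
move=> H mphi phi0.
have mE : measurable_fun setT (EFin \o phi) by exact/measurable_EFinP.
have E0 t : (0 <= (EFin \o phi) t)%E by rewrite lee_fin.
exact: (zonal_unique H U0 mE E0 (sproj_sphere x) pole_sphere).
Qed.

Lemma zker_L4 mu x : sphere_uniform mu -> (\int[mu]_z (zker x z ^+ 4)%:E <= B%:E)%E.
Proof.
move=> H; rewrite (@zE mu (fun t => psi t ^+ 4))//; first exact: measurable_funX.
by move=> t; rewrite exprn_even_ge0.
Qed.

Lemma zker_int2 mu x : sphere_uniform mu -> (\int[mu]_z (zker x z ^+ 2)%:E = c%:E)%E.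
Proof.
move=> H; rewrite (@zE mu (fun t => psi t ^+ 2))//; first exact: measurable_funX.
by move=> t; rewrite sqr_ge0.
Qed.

Lemma L2_zker mu x : sphere_uniform mu -> L2 mu (zker x).
Proof.
move=> H; split; first exact: measurable_zker1.
apply: (@ge0_L1 _ _ _ _ _ c); first exact: measurable_funX.
  by move=> z; rewrite sqr_ge0.
by rewrite zker_int2.
Qed.

Lemma Ex_zker2 mu x : sphere_uniform mu -> \int[mu]_z zker x z ^+ 2 = c.
Proof. by move=> H; rewrite /Rintegral zker_int2. Qed.

Let pK K x z := (psi_sum K).[inner (sproj x) (sproj z)].
Let rK K x z := zker x z - pK K x z.

Let L2_horner mu p x : L2 mu (fun z => p.[inner x (sproj z)]).
Proof.
have [mp _ [D [D0 H]]] := tang_horner ord0 ord0 x p.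
apply: (L2_bounded mu (M := D)).
  by apply: (measurableT_comp mp); exact: measurable_sproj.
by move=> z; have [] := H _ (sproj_sphere z).
Qed.

Let L2_rK mu K x : sphere_uniform mu -> L2 mu (rK K x).
Proof. by move=> H; apply: L2B; [exact: L2_zker|exact: L2_horner]. Qed.

Let e K := \int[mu0]_z rK K pole z ^+ 2.

Let Ex_rK2 mu K x : sphere_uniform mu -> \int[mu]_z rK K x z ^+ 2 = e K.
Proof.
move=> H; apply: (f_equal fine).
have mq : measurable_fun setT (fun t => (psi t - (psi_sum K).[t]) ^+ 2).
  apply: measurable_funX; apply: measurable_funB => //.
  by apply: continuous_measurable_fun; exact: continuous_horner.
rewrite (@zE mu (fun t => (psi t - (psi_sum K).[t]) ^+ 2))//; last first.
  by move=> t; rewrite sqr_ge0.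
rewrite -(@zE mu0 (fun t => (psi t - (psi_sum K).[t]) ^+ 2) pole)//.
by move=> t; rewrite sqr_ge0.
Qed.

Let e_cvg : e K @[K --> \oo] --> (0 : R).
Proof.
have /fine_cvgP[_] := psi_cvg; apply: cvg_trans; apply: near_eq_cvg.
by near=> K; rewrite /= /e /rK /zker /pK sproj_id//; exact: pole_sphere.
Unshelve. all: by end_near. Qed.

Let c_ge0 : 0 <= c.
Proof. by rewrite -(Ex_zker2 pole U0); apply: Rintegral_ge0 => z _; rewrite sqr_ge0. Qed.

Let e_ge0 K : 0 <= e K.
Proof. by apply: Rintegral_ge0 => z _; rewrite sqr_ge0. Qed.

Let amgm (eta a b : R) : 0 < eta -> `|a * b| <= eta * a ^+ 2 + eta^-1 * b ^+ 2.
Proof.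
move=> e0; have /mulfV ee : eta != 0 by rewrite gt_eqF.
have i0 : 0 < eta^-1 by rewrite invr_gt0.
rewrite -subr_ge0; set w := eta * _ + _ - _.
rewrite -(pmulr_rge0 _ e0).
have -> : eta * w = (eta * a) ^+ 2 + b ^+ 2 - `|(eta * a) * b|.
  have -> : `|eta * a * b| = eta * `|a * b| by rewrite -mulrA normrM (gtr0_norm e0).
  by rewrite /w mulrBr mulrDr [eta * (eta^-1 * _)]mulrA ee; ring.
by have := ler_normM2 (eta * a) b; lra.
Qed.

(** Write the kernel as a polynomial part plus a remainder [rK]. Each cross term carries a
    remainder, and the weighted arithmetic-geometric inequality bounds it by the integrals c and
    [e K], which depend neither on the points nor on the uniform law chosen. The estimate is
    therefore uniform. *)
Let conv_diff mu K x y eta : sphere_uniform mu -> 0 < eta ->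
  `|\int[mu]_z (zker x z * zker y z) - (G_sum K).[inner (sproj x) (sproj y)]| <=
  2 * eta * c + (2 / eta + 1) * e K.
Proof.
move=> H e0.
have Lx := L2_zker x H; have Ly := L2_zker y H.
have Lrx := L2_rK K x H; have Lry := L2_rK K y H.
have -> : (G_sum K).[inner (sproj x) (sproj y)] = \int[mu]_z (pK K x z * pK K y z).
  rewrite -/(zpair mu (sproj x) (sproj y) (psi_sum K) (psi_sum K)).
  rewrite (zpair_geg_sum _ _ _ H); [|exact: sproj_sphere|exact: sproj_sphere].
  rewrite /G_sum /geg_sum horner_sum; apply: eq_bigr => k _.
  rewrite hornerM hornerC; congr (_ * _).
  have k0 : k%:R + lam != 0 by rewrite gt_eqF// ltr_wpDl.
  by field; rewrite k0 gt_eqF.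
rewrite -RintegralB//; [|exact: L2M|by apply: L2M; exact: L2_horner].
have LD : L1 mu (fun z => eta * zker y z ^+ 2 + eta^-1 * rK K x z ^+ 2 +
    (eta * zker x z ^+ 2 + eta^-1 * rK K y z ^+ 2) +
    2^-1 * (rK K x z ^+ 2 + rK K y z ^+ 2)).
  have := (Lx.2, Ly.2, Lrx.2, Lry.2) => -[[[? ?] ?] ?].
  by apply: L1D; [apply: L1D; apply: L1D; exact: L1Z|apply: L1Z; exact: L1D].
apply: le_trans (normr_Ex_le _ LD _) _.
- by apply: L1B; [exact: L2M|apply: L2M; exact: L2_horner].
- move=> z.
  have -> : zker x z * zker y z - pK K x z * pK K y z =
      zker y z * rK K x z + zker x z * rK K y z - rK K x z * rK K y z.
    by rewrite /rK; ring.
  apply: le_trans (ler_normB _ _) _; apply: lerD.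
    by apply: le_trans (ler_normD _ _) _; apply: lerD; exact: amgm.
  rewrite ler_norml; have := sqr_ge0 (rK K x z - rK K y z).
  by have := sqr_ge0 (rK K x z + rK K y z); rewrite sqrrB sqrrD; lra.
- have := (Lx.2, Ly.2, Lrx.2, Lry.2) => -[[[l1 l2] l3] l4].
  have zl1 := L1Z eta l1; have zl2 := L1Z eta l2.
  have zl3 := L1Z eta^-1 l3; have zl4 := L1Z eta^-1 l4.
  rewrite (RintegralD measurableT (L1D (L1D zl2 zl3) (L1D zl1 zl4)) (L1Z 2^-1 (L1D l3 l4))).
  rewrite (RintegralD measurableT (L1D zl2 zl3) (L1D zl1 zl4)).
  rewrite (RintegralD measurableT zl2 zl3) (RintegralD measurableT zl1 zl4).
  rewrite (RintegralZl _ measurableT (L1D l3 l4)) (RintegralD measurableT l3 l4).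
  rewrite !RintegralZl// !Ex_rK2// !Ex_zker2//.
  by rewrite le_eqVlt; apply/orP; left; apply/eqP; field; rewrite gt_eqF.
Qed.

Let conv_unif eps : 0 < eps -> \forall K \near \oo, forall mu x y,
  sphere_uniform mu ->
  `|\int[mu]_z (zker x z * zker y z) - (G_sum K).[inner (sproj x) (sproj y)]| <= eps.
Proof.
(* This eta makes 2 eta c at most eps / 2; the 1 added to c covers c = 0. K is then taken so large
   that the other term is at most eps / 2. *)
move=> e0; pose eta := eps / (4 * (c + 1)).
have c1 : 0 < c + 1 by rewrite ltr_wpDl.
have eta0 : 0 < eta by rewrite divr_gt0// mulr_gt0.
pose D := 2 / eta + 1; have D0 : 0 < D by rewrite addr_gt0// divr_gt0.
have eD : 0 < eps / (2 * D) by rewrite divr_gt0// mulr_gt0.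
near=> K => mu x y H; apply: le_trans (conv_diff K x y H eta0) _.
have eK : e K <= eps / (2 * D).
  near: K; have /cvgrPdist_le/(_ _ eD) := e_cvg.
  by apply: filterS => K /=; rewrite sub0r normrN ger0_norm.
have h1 : D * e K <= eps / 2.
  apply: le_trans (ler_wpM2l (ltW D0) eK) _.
  by rewrite le_eqVlt; apply/orP; left; apply/eqP; field; rewrite gt_eqF.
have h2 : 2 * eta * c <= eps / 2.
  rewrite /eta (_ : 2 * _ * c = eps / 2 * (c / (c + 1))); last by field; rewrite gt_eqF.
  by rewrite ler_piMr ?ler_pdivrMr ?mul1r ?lerDl// divr_ge0// ltW.
by rewrite -/D; lra.
Unshelve. all: by end_near. Qed.

Let le0_eps (a : R) : (forall eps, 0 < eps -> `|a| <= eps) -> a = 0.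
Proof.
move=> H; apply/eqP; rewrite -normr_le0; apply/ler_addgt0Pr => eps e0.
by rewrite add0r; exact: H.
Qed.

(** Under every uniform law the convolution is the uniform limit of the same polynomials [G_sum], so
    it cannot depend on the law. *)
Lemma zker_conv mu x y : sphere_uniform mu ->
  \int[mu]_z (zker x z * zker y z) = zconv x y.
Proof.
move=> H; apply/eqP; rewrite -subr_eq0; apply/eqP; apply: le0_eps => eps eps0.
have e2 : 0 < eps / 2 by rewrite divr_gt0.
have /filter_ex[K HK] := conv_unif e2.
have := HK mu x y H; have := HK mu0 x y U0; rewrite -/(zconv x y).
set g := (G_sum K).[_] => h1 h2.
rewrite (_ : _ - _ = (\int[mu]_z (zker x z * zker y z) - g) - (zconv x y - g)); last by ring.
by apply: le_trans (ler_normB _ _) _; lra.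
Qed.

Lemma zconv_diag x : zconv x x = c.
Proof. by rewrite -(Ex_zker2 x U0); apply: eq_Rintegral => z _; rewrite expr2. Qed.

Lemma zker_int0 mu x : sphere_uniform mu -> \int[mu]_z zker x z = 0.
Proof.
move=> H; apply: le0_eps => eps eps0.
have e2 : 0 < eps / 2 by rewrite divr_gt0.
have e4 : 0 < (eps / 2) ^+ 2 by rewrite exprn_gt0.
have /cvgrPdist_le/(_ _ e4)/filter_ex[K] := e_cvg.
rewrite sub0r normrN (ger0_norm (e_ge0 K)) => eK.
have Lr := L2_rK K x H; have Lz := L2_zker x H.
have p0 : \int[mu]_z pK K x z = 0.
  have := zpair_geg_sum_gt (fun k => (1 + k%:R / lam) * u k) (K := K) H
    (sproj_sphere x) (sproj_sphere x) (or_introl erefl).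
  move=> <-; apply: eq_Rintegral => z _.
  by rewrite geg0 -polyC1 hornerC mulr1.
have -> : \int[mu]_z zker x z = \int[mu]_z rK K x z.
  rewrite /rK RintegralB//; [|exact: L2W|by apply: L2W; exact: L2_horner].
  by rewrite -/(pK K x) p0 subr0.
have LD : L1 mu (fun z => eps / 2 + (eps / 2)^-1 * rK K x z ^+ 2).
  by apply: L1D; [exact: L1_cst|apply: L1Z; exact: Lr.2].
apply: le_trans (normr_Ex_le (L2W Lr) LD _) _.
  by move=> z; have := amgm 1 (rK K x z) e2; rewrite mul1r expr1n mulr1.
rewrite (RintegralD measurableT (L1_cst mu _) (L1Z _ Lr.2)).
rewrite (RintegralZl _ measurableT Lr.2) Ex_cst Ex_rK2//.
have : (eps / 2)^-1 * e K <= eps / 2 by rewrite mulrC ler_pdivrMr// -expr2.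
by lra.
Qed.

Lemma measurable_zconv : measurable_fun setT (fun p : T * T => zconv p.1 p.2).
Proof.
apply: (@measurable_fun_cvg _ _ _ setT
  (fun K (p : T * T) => (G_sum K).[inner (sproj p.1) (sproj p.2)])).
  move=> K; apply: measurableT_comp => //.
  by apply: continuous_measurable_fun; exact: continuous_horner.
move=> [x y] _; apply/cvgrPdist_le => eps e0 /=.
by apply: filterS (conv_unif e0) => K /(_ mu0 x y U0).
Qed.

Let zconv_le eps mu x : sphere_uniform mu -> 0 < eps ->
  exists2 K, L2 mu (fun y => (G_sum K).[inner (sproj x) (sproj y)]) &
  forall y, `|zconv x y - (G_sum K).[inner (sproj x) (sproj y)]| <= eps.
Proof.
move=> H e0; have /filter_ex[K HK] := conv_unif e0; exists K; first exact: L2_horner.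
by move=> y; exact: HK mu0 x y U0.
Qed.

Let measurable_zconv1 x : measurable_fun setT (zconv x).
Proof.
apply: (measurableT_comp measurable_zconv (g := fun z => (x, z))).
exact: measurable_fun_pair.
Qed.

Lemma zconv_int0 mu x : sphere_uniform mu -> \int[mu]_y zconv x y = 0.
Proof.
move=> H; apply: le0_eps => eps e0.
have [K LK HK] := zconv_le x H e0.
have Lz : L1 mu (zconv x).
  apply: (L1_dom (measurable_zconv1 x) (L1D (L1_norm (L2W LK)) (L1_cst mu eps))) => y /=.
  have := HK y; set g := _.[_] => h; have -> : zconv x y = g + (zconv x y - g) by ring.
  by apply: le_trans (ler_normD _ _) _; rewrite lerD2l.
have g0 : \int[mu]_y (G_sum K).[inner (sproj x) (sproj y)] = 0.
  have := zpair_geg_sum_gt (fun k => (1 + k%:R / lam) * u k ^+ 2) (K := K) H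
    (sproj_sphere x) (sproj_sphere x) (or_introl erefl).
  by move=> <-; apply: eq_Rintegral => z _; rewrite geg0 -polyC1 hornerC mulr1.
rewrite -[X in `|X|]subr0 -[X in _ - X]g0 -RintegralB//; last exact: L2W.
apply: le_trans (normr_Ex_le (L1B Lz (L2W LK)) (L1_cst mu eps) HK) _.
by rewrite Ex_cst.
Qed.

(** For the polynomials [G_sum] the squared integral is a finite Parseval sum, bounded by Q through
    the value at 1. Uniform approximation carries the bound over to [zconv], and (a + b)^2 <= 2 a^2
    + 2 b^2 accounts for the factor 2. *)
Lemma zconv_L2 mu x : sphere_uniform mu ->
  (\int[mu]_y (zconv x y ^+ 2)%:E <= (2 * Q)%:E)%E.
Proof.
move=> H; apply/lee_addgt0Pr => eps e0.
(* Being at most 1 gives d^2 <= d, and d <= eps / 2 makes twice the squared error at most eps. *)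
pose d := Num.min 1 (eps / 2).
have d0 : 0 < d by rewrite lt_min ltr01 divr_gt0.
have d1 : d <= 1 by rewrite ge_min lexx.
have de : d <= eps / 2 by rewrite ge_min lexx orbT.
have [K LK HK] := zconv_le x H d0.
set g := fun y => (G_sum K).[inner (sproj x) (sproj y)] in LK HK.
have gQ : \int[mu]_y g y ^+ 2 <= Q.
  have Sx := sproj_sphere x.
  have -> : \int[mu]_y g y ^+ 2 = zpair mu (sproj x) (sproj x) (G_sum K) (G_sum K).
    by apply: eq_Rintegral => y _; rewrite /g expr2.
  rewrite (zpair_geg_sum _ _ _ H)// Sx; apply: le_trans (Q_ub K).
  rewrite le_eqVlt; apply/orP; left; apply/eqP; apply: eq_bigr => k _.
  have k0 : k%:R + lam != 0 by rewrite gt_eqF// ltr_wpDl.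
  by field; rewrite k0 gt_eqF.
have LD : L1 mu (fun y => 2 * g y ^+ 2 + eps).
  by apply: L1D; [apply: L1Z; exact: LK.2|exact: L1_cst].
apply: (@le_trans _ _ (\int[mu]_y (2 * g y ^+ 2 + eps)%:E)%E).
  apply: ge0_le_integral => //.
  - by move=> y _; rewrite lee_fin sqr_ge0.
  - by apply/measurable_EFinP; apply: measurable_funX; exact: measurable_zconv1.
  - exact: measurable_int LD.
  - move=> y _; rewrite lee_fin.
    have d2 : (zconv x y - g y) ^+ 2 <= d.
      rewrite -(real_normK (num_real _)) expr2; apply: le_trans (_ : d * d <= _).
        by apply: ler_pM.
      by rewrite ler_piMr// ltW.
    by have := sqr_ge0 (zconv x y - g y - g y); move: d2 de; nra.
rewrite -(Ex_EFin LD) -EFinD lee_fin.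
rewrite (RintegralD measurableT (L1Z 2 LK.2) (L1_cst mu eps)) Ex_cst.
by rewrite (RintegralZl _ measurableT LK.2); lra.
Qed.

End zonal_kernel.

(** * Values at 1 and the dimension of spherical harmonics *)

Section dimension.
Context {R : realType}.

(** Here p is 2 lam - 1. At the point 1 the three-term recurrence collapses to a two-term one
    ([step]), which is the recurrence of the binomial coefficients. *)
Lemma geg_at1 (p k : nat) (lam : R) : 2 * lam = p.+1%:R ->
  (geg lam k).[1] = 'C(k + p, k)%:R.
Proof.
move=> lamE.
have hn n : (n%:R : {poly R}).[1] = n%:R by rewrite -polyC_natr hornerC.
have rec n : (n%:R + 2) * (geg lam n.+2).[1] =
    (2 * n%:R + 2 + p.+1%:R) * (geg lam n.+1).[1] - (n%:R + p.+1%:R) * (geg lam n).[1].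
  have := congr1 (fun q => q.[1]) (gegS lam n) => /=.
  rewrite !(hornerM, hornerD, hornerN, hn, hornerC, hornerX, hn 1) => ->.
  by rewrite -lamE; ring.
have g0 : (geg lam 0).[1] = 1 by rewrite geg0 -polyC1 hornerC.
have g1 : (geg lam 1).[1] = p.+1%:R.
  by rewrite geg1 !(hornerM, hn, hornerC, hornerX) mulr1 lamE.
have step n : (n%:R + 1) * (geg lam n.+1).[1] = (n%:R + p.+1%:R) * (geg lam n).[1].
  elim: n => [|n IH]; first by rewrite g0 g1 !add0r mul1r mulr1.
  have := rec n; rewrite -IH -[n.+1%:R]natr1 => E.
  transitivity ((n%:R + 2) * (geg lam n.+2).[1]); first by ring.
  by rewrite E; ring.
elim: k => [|k IH]; first by rewrite g0 bin0.
have k0 : k%:R + 1 != 0 :> R by rewrite natr1 pnatr_eq0.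
apply: (mulfI k0); rewrite step IH natr1 -natrD -!natrM; congr (_%:R).
by rewrite addnS addSn -mul_bin_diag.
Qed.

(** The left side is the reproducing kernel of degree k harmonics on the diagonal. This turns the
    Parseval sum for [G] into the eighth-power sum of the assumptions. *)
Lemma dkdE (m k : nat) (lam : R) : (2 <= m)%N -> 2 * lam + 1 = m%:R -> (0 < k)%N ->
  (1 + k%:R / lam) * (geg lam k).[1] = (dkd k m)%:R.
Proof.
case: m => [|[|p]]// _ lamE; case: k => // j _.
have lamE' : 2 * lam = p.+1%:R by apply: (addIr 1); rewrite lamE natr1.
rewrite (geg_at1 _ lamE') /dkd.
have -> : (p.+2 + j.+1 - 2 = j.+1 + p)%N by lia.
have -> : (p.+2 + j.+1 - 1 = (j.+1 + p).+1)%N by lia.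
have -> : (p.+2 - 1 = p.+1)%N by lia.
have -> : 'C(j.+1 + p, j.+1) = 'C(j.+1 + p, p).
  by rewrite -[RHS]bin_sub ?leq_addl// addnK.
have -> : 'C((j.+1 + p).+1, p.+1) = ('C(j.+1 + p, p.+1) + 'C(j.+1 + p, p))%N.
  exact: binS.
move: ('C(j.+1 + p, p.+1)) ('C(j.+1 + p, p)) (mul_bin_left (j.+1 + p) p) => b c E.
rewrite !natrD.
have p0 : p.+1%:R != 0 :> R by rewrite pnatr_eq0.
have -> : b%:R = j.+1%:R * c%:R / p.+1%:R :> R.
  rewrite -[in RHS]natrM (_ : (j.+1 * c = p.+1 * b)%N) ?natrM; last by rewrite E addnK.
  by rewrite [RHS]mulrC mulKf.
have -> : lam = p.+1%:R / 2 by rewrite -lamE'; field.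
by move: (p.+1%:R) p0 => p1 p0; field.
Qed.

End dimension.

Lemma sum_sym_pairs (R : realFieldType) (n : nat) (F : 'I_n -> 'I_n -> R) :
  (forall i j, F i j = F j i) -> (forall i, F i i = 0) ->
  2^-1 * \sum_i \sum_j F i j = \sum_(i < n) \sum_(j < n | (i < j)%N) F i j.
Proof.
move=> FC F0.
have E : \sum_i \sum_j F i j = \sum_(i < n) \sum_(j < n | (i < j)%N) F i j +
    \sum_(i < n) \sum_(j < n | (j < i)%N) F i j.
  rewrite -big_split/=; apply: eq_bigr => i _.
  rewrite (bigID (fun j : 'I_n => (i < j)%N))/=; congr (_ + _).
  rewrite (bigD1 i) ?ltnn//= F0 add0r; apply: eq_bigl => j.
  by rewrite -leqNgt ltn_neqAle andbC; congr (_ && _).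
have E' : \sum_(i < n) \sum_(j < n | (j < i)%N) F i j =
    \sum_(i < n) \sum_(j < n | (i < j)%N) F i j.
  rewrite (exchange_big_dep predT)//=; apply: eq_bigr => i _.
  by apply: eq_bigr => j _.
by rewrite E E'; field.
Qed.

(** * One sample: normalisation and explicit error bound *)

Section one_sample.
Context {R : realType} {d0 : measure_display} {Omega : measurableType d0}.
Variables (P : probability Omega R) (m n : nat) (X : nat -> Omega -> m.+1.-tuple R).
Variables (v : nat -> nat -> R) (psi : R -> R) (s2 C q : R).
Local Notation T := (m.+1.-tuple R).
Local Notation S := (@unit_sphere R m).
Hypothesis m2 : (2 <= m)%N.
Hypothesis n2 : (2 <= n)%N.
Hypothesis indX : mutually_independent P n X.
Hypothesis unifX : forall i, (i < n)%N -> uniform_on_sphere P (X i).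
Hypothesis mpsi : measurable_fun setT psi.
Hypothesis psi_cvg : (fun K => (\int[P]_w ((psi (inner (X 0 w) (X 1 w))
  - psi_partial v m K (inner (X 0 w) (X 1 w))) ^+ 2)%:E)%E) @ \oo --> 0%E.
Hypothesis s20 : 0 < s2.
Hypothesis psi2 : (\int[P]_w ((psi (inner (X 0 w) (X 1 w))) ^+ 2)%:E = (s2 / 2)%:E)%E.
Hypothesis psi4 :
  (\int[P]_w ((psi (inner (X 0 w) (X 1 w))) ^+ 4)%:E <= (C * s2 ^+ 2)%:E)%E.
Hypothesis C0 : 0 <= C.
Hypothesis v8 : forall K,
  \sum_(1 <= k < K.+1) (v k m) ^+ 8 * (dkd k m)%:R <= q * s2 ^+ 2.
Hypothesis q0 : 0 <= q.

Let mX (i : 'I_n) : measurable_fun setT (X i).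
Proof. by have [] := unifX (ltn_ord i). Qed.

Let mu := marginal P mX.
Let nu := joint_law P mX.
Let nuE : resampled nu mu := joint_law_resampled mX indX.

Let muU i : sphere_uniform (mu i).
Proof.
by have [_ XS XQ] := unifX (ltn_ord i); split=> // Q oQ A mA; exact: XQ.
Qed.

Let i0 : 'I_n := Ordinal (ltnW n2).
Let i1 : 'I_n := Ordinal n2.

Let V (w : Omega) : n.-tuple T := [tuple X i w | i < n].
Let mV : measurable_fun setT V := measurable_joint mX.

Let ae_sphere : {ae P, forall w, forall i : 'I_n, S (X i w)}.
Proof.
apply: filter_forall => i; have [_ XS _] := unifX (ltn_ord i).
have mS : measurable (X i @^-1` S).
  by rewrite -[X in measurable X]setTI; apply: mX => //; exact: measurable_sphere.
exists (~` (X i @^-1` S)); split; first exact: measurableC.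
- by rewrite [LHS](probability_setC P mS) [X in (_ - X)%E]XS subee.
- by move=> w.
Qed.

Let ge0_integral_nu (F : n.-tuple T -> R) : measurable_fun setT F ->
  (forall x, 0 <= F x) -> (\int[P]_w (F (V w))%:E = \int[nu]_x (F x)%:E)%E.
Proof.
move=> mF F0; rewrite [RHS]ge0_integral_pushforward// ?preimage_setT//.
- exact/measurable_EFinP.
- by move=> x _; rewrite lee_fin.
Qed.

(** Sample indices start at 0, so [X 0] and [X 1] are the first two vectors. Resampling the second
    makes the inner integral zonal, hence constant in the first, which may be moved to the pole.
    Assumptions on psi thereby take a one-variable form. *)
Let pair_law (phi : R -> R) : measurable_fun setT phi -> (forall t, 0 <= phi t) ->
  (\int[P]_w (phi (inner (X 0 w) (X 1 w)))%:E =
   \int[mu i0]_z (phi (inner pole (sproj z)))%:E)%E.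
Proof.
move=> mphi phi0.
pose F (x : n.-tuple T) := phi (inner (sproj (tnth x i0)) (sproj (tnth x i1))).
have mF : measurable_fun setT F.
  apply: (measurableT_comp mphi); apply: measurable_inner;
    by apply: (measurableT_comp measurable_sproj); exact: measurable_tnth.
have mEphi : measurable_fun setT (EFin \o phi) by exact/measurable_EFinP.
transitivity (\int[P]_w (F (V w))%:E)%E.
  apply: ae_eq_integral => //.
  - by apply: (measurableT_comp mEphi); apply: measurable_inner;
      first [exact: (mX i0)|exact: (mX i1)].
  - by apply/measurable_EFinP; exact: measurableT_comp.
  - apply: filterS ae_sphere => w Sw _.
    by rewrite /F !tnth_mktuple !sproj_id.
rewrite ge0_integral_nu//; last by move=> x; exact: phi0.
have mEF : measurable_fun setT (EFin \o F) by exact/measurable_EFinP.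
rewrite (resample_ge0 nuE i1 mEF); last by move=> x; rewrite lee_fin; exact: phi0.
transitivity (\int[nu]_x cst (\int[mu i0]_z (phi (inner pole (sproj z)))%:E)%E x)%E.
  apply: eq_integral => x _; rewrite /F /=.
  under eq_integral do rewrite tnth_upd_eq tnth_upd_neq//.
  apply: (@zonal_unique _ _ (mu i1) (mu i0) (EFin \o phi)) => //.
  - exact: sproj_sphere.
  - exact: pole_sphere.
by rewrite integral_cst// [X in (_ * X)%E](probability_setT nu) mule1.
Qed.

Let lam : R := (m%:R - 1) / 2.
Let lamE : 2 * lam + 1 = m%:R.
Proof. by rewrite /lam; field. Qed.

(** The constant 2 / (n sigma_n) is absorbed into the kernel, so that the normalised statistic is
    the U-statistic of a psi. Then c = 2 / n^2, B = 16 C / n^4 and Q = 32 q / n^4, and the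
    eigenvalues become a v_k^2. *)
Let a : R := 2 / n%:R / Num.sqrt s2.
Let psi' t := a * psi t.
Let u k := a * v k m ^+ 2.

Let n_gt0 : 0 < n%:R :> R.
Proof. by rewrite ltr0n; lia. Qed.

Let sqrt_gt0 : 0 < Num.sqrt s2.
Proof. by rewrite sqrtr_gt0. Qed.

Let a2E : a ^+ 2 = 4 / n%:R ^+ 2 / s2.
Proof.
rewrite /a !exprMn !exprVn sqr_sqrtr ?ltW//.
by congr (_ / _ / _); ring.
Qed.

Let a4E : a ^+ 4 = 16 / n%:R ^+ 4 / s2 ^+ 2.
Proof.
rewrite -[4%N]/(2 * 2)%N exprM a2E; field.
by rewrite !gt_eqF.
Qed.

Let psi'_measurable : measurable_fun setT psi'.
Proof. exact: measurable_funM. Qed.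

Let psi'_L2 :
  (\int[mu i0]_z ((psi' (inner pole (sproj z))) ^+ 2)%:E = (2 / n%:R ^+ 2)%:E)%E.
Proof.
rewrite -(@pair_law (fun t => psi' t ^+ 2)); last 2 first.
- exact: measurable_funX.
- by move=> t; rewrite sqr_ge0.
transitivity (\int[P]_w ((a ^+ 2)%:E * (psi (inner (X 0 w) (X 1 w)) ^+ 2)%:E))%E.
  by apply: eq_integral => w _; rewrite -EFinM /psi' exprMn.
rewrite ge0_integralZl//.
- rewrite psi2 -EFinM a2E; congr (_%:E); field.
  by rewrite !gt_eqF.
- apply/measurable_EFinP; apply: measurable_funX; apply: (measurableT_comp mpsi).
  by apply: measurable_inner; [exact: (mX i0)|exact: (mX i1)].
- by move=> w _; rewrite lee_fin sqr_ge0.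
- by rewrite lee_fin sqr_ge0.
Qed.

Let psi'_L4 : (\int[mu i0]_z ((psi' (inner pole (sproj z))) ^+ 4)%:E <=
  (16 * C / n%:R ^+ 4)%:E)%E.
Proof.
rewrite -(@pair_law (fun t => psi' t ^+ 4)); last 2 first.
- exact: measurable_funX.
- by move=> t; rewrite exprn_even_ge0.
rewrite (_ : (\int[P]_w _ = \int[P]_w ((a ^+ 4)%:E * (psi (inner (X 0 w) (X 1 w)) ^+ 4)%:E))%E).
  rewrite ge0_integralZl//.
  - apply: le_trans (lee_pmul _ _ (lexx _) psi4) _.
    + by rewrite lee_fin exprn_even_ge0.
    + by apply: integral_ge0 => w _; rewrite lee_fin exprn_even_ge0.
    + rewrite -EFinM a4E lee_fin le_eqVlt; apply/orP; left; apply/eqP; field.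
      by rewrite !gt_eqF.
  - apply/measurable_EFinP; apply: measurable_funX; apply: (measurableT_comp mpsi).
    by apply: measurable_inner; [exact: (mX i0)|exact: (mX i1)].
  - by move=> w _; rewrite lee_fin exprn_even_ge0.
  - by rewrite lee_fin exprn_even_ge0.
by apply: eq_integral => w _; rewrite -EFinM /psi' exprMn.
Qed.

Let psi_sumE K t : (psi_sum lam u K).[t] = a * psi_partial v m K t.
Proof.
rewrite /psi_sum /geg_sum horner_sum /psi_partial mulr_sumr; apply: eq_bigr => k _.
rewrite hornerM hornerC /psi_term m2 gegenbauerE -/lam /u.
have -> : 2 * k%:R / (m%:R - 1) = k%:R / lam.
  have m10 : m%:R - 1 != 0 :> R by rewrite subr_eq0 pnatr_eq1; lia.
  by rewrite /lam; field.
by ring.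
Qed.

Let psi'_cvg : (fun K => (\int[mu i0]_z ((psi' (inner pole (sproj z)) -
  (psi_sum lam u K).[inner pole (sproj z)]) ^+ 2)%:E)%E) @ \oo --> 0%E.
Proof.
have fa : (a ^+ 2)%:E \is a fin_num by [].
have := cvgeZl fa psi_cvg; rewrite mule0.
apply: cvg_trans; apply: near_eq_cvg; near=> K.
have mp : measurable_fun setT (fun t => (psi_sum lam u K).[t]).
  by apply: continuous_measurable_fun; exact: continuous_horner.
have mpp : measurable_fun setT (psi_partial v m K).
  rewrite (_ : psi_partial v m K = fun t => a^-1 * (psi_sum lam u K).[t]).
    exact: measurable_funM.
  have a0 : a != 0 by rewrite gt_eqF// !divr_gt0.
  by apply/funext => t; rewrite psi_sumE mulKf.
rewrite -(@pair_law (fun t => (psi' t - (psi_sum lam u K).[t]) ^+ 2)); last 2 first.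
- by apply: measurable_funX; exact: measurable_funB.
- by move=> t; rewrite sqr_ge0.
rewrite -ge0_integralZl//.
- apply: eq_integral => w _; rewrite -EFinM psi_sumE /psi'; congr (_%:E); ring.
- apply/measurable_EFinP; apply: measurable_funX.
  apply: (measurableT_comp (f := fun t => psi t - psi_partial v m K t)).
    exact: measurable_funB.
  by apply: measurable_inner; [exact: (mX i0)|exact: (mX i1)].
- by move=> w _; rewrite lee_fin sqr_ge0.
- by rewrite lee_fin sqr_ge0.
Unshelve. all: by end_near. Qed.

Let Q_ub K : \sum_(1 <= k < K.+1) u k ^+ 4 * ((1 + k%:R / lam) * (geg lam k).[1]) <=
  16 * q / n%:R ^+ 4.
Proof.
have -> : \sum_(1 <= k < K.+1) u k ^+ 4 * ((1 + k%:R / lam) * (geg lam k).[1]) =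
    a ^+ 4 * \sum_(1 <= k < K.+1) (v k m) ^+ 8 * (dkd k m)%:R.
  rewrite mulr_sumr !big_nat; apply: eq_bigr => k /andP[k1 _].
  by rewrite (dkdE m2 lamE k1) /u exprMn -exprM mulrA.
apply: le_trans (ler_wpM2l _ (v8 K)) _; first by rewrite exprn_even_ge0.
rewrite a4E le_eqVlt; apply/orP; left; apply/eqP; field.
by rewrite !gt_eqF.
Qed.

Local Notation h := (zker psi').
Local Notation G := (zconv (mu i0) psi').

Definition Wstat (w : Omega) : R := (Num.sqrt s2)^-1 * Tstat n psi X w.

Let W_ustat w : (forall i : 'I_n, S (X i w)) -> Wstat w = ustat h (V w).
Proof.
move=> Sw; rewrite /ustat /row_sum sum_sym_pairs => [|i j|i]; last 2 first.
- by apply: hijC; exact: zkerC.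
- exact: hijii.
rewrite /Wstat /Tstat mulrA mulr_sumr; apply: eq_bigr => i _.
rewrite mulr_sumr; apply: eq_bigr => j ij.
rewrite hij_neq; last by rewrite neq_ltn ij.
by rewrite /zker !tnth_mktuple !sproj_id// /psi' /a; ring.
Qed.

Let ae_W : {ae P, forall w, Wstat w = ustat h (V w)}.
Proof. by apply: filterS ae_sphere => w; exact: W_ustat. Qed.

Let measurable_W : measurable_fun setT Wstat.
Proof.
apply: measurable_funM => //; apply: measurable_funM => //.
apply: measurable_sum => i.
rewrite (_ : (fun w => _) = fun w => \sum_(j < n)
    (i < j)%N%:R * psi (inner (X i w) (X j w))); last first.
  apply/funext => w; rewrite big_mkcond; apply: eq_bigr => j _.
  by case: (i < j)%N; rewrite ?mul1r ?mul0r.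
apply: measurable_sum => j; apply: measurable_funM => //.
apply: (measurableT_comp mpsi).
by apply: measurable_inner; [exact: (mX i)|exact: (mX j)].
Qed.

Let B_ge0 : 0 <= 16 * C / n%:R ^+ 4.
Proof. by rewrite divr_ge0 ?mulr_ge0// exprn_ge0// ltW. Qed.

Let Q_ge0 : 0 <= 2 * (16 * q / n%:R ^+ 4).
Proof. by rewrite mulr_ge0// divr_ge0 ?mulr_ge0// exprn_ge0// ltW. Qed.

Let h_L4 i x := zker_L4 (muU i0) psi'_measurable psi'_L4 x (muU i).
Let h_m := measurable_zker (m := m) psi'_measurable.

Let measurable_ustat : measurable_fun setT (ustat h : n.-tuple T -> R).
Proof. exact: (L4_ustat nuE h_m h_L4 B_ge0).1. Qed.

Let Ex_W (F : R -> R) (M : R) : measurable_fun setT F -> (forall t, `|F t| <= M) ->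
  \int[P]_w F (Wstat w) = \int[nu]_x F (ustat h x).
Proof.
move=> mF FM; apply: (f_equal fine).
have mFu : measurable_fun setT (fun x => F (ustat h x)) :=
  measurableT_comp mF measurable_ustat.
have mFV : measurable_fun setT (fun w => F (ustat h (V w))) :=
  measurableT_comp mFu mV.
transitivity (\int[P]_w (F (ustat h (V w)))%:E)%E.
  apply: ae_eq_integral => //.
  - by apply/measurable_EFinP; exact: measurableT_comp.
  - exact/measurable_EFinP.
  - by apply: filterS ae_W => w -> _.
rewrite [RHS]integral_pushforward ?preimage_setT//.
- exact/measurable_EFinP.
- exact: (L1_bounded P mFV (fun w => FM _)).
Qed.

Let h_conv i x y := zker_conv m2 lamE (muU i0) psi'_measurable psi'_L2 psi'_cvg x y (muU i).
Let h_int0 i x := zker_int0 m2 lamE (muU i0) psi'_measurable psi'_L2 psi'_cvg x (muU i).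
Let G_m := measurable_zconv m2 lamE (muU i0) psi'_measurable psi'_L2 psi'_cvg.
Let G_diag x := zconv_diag (muU i0) psi'_measurable psi'_L2 x.
Let G_int0 i x := zconv_int0 m2 lamE (muU i0) psi'_measurable psi'_L2 psi'_cvg x (muU i).
Let G_L2 i x := zconv_L2 m2 lamE (muU i0) psi'_measurable psi'_L2 psi'_cvg Q_ub x (muU i).

Lemma Wstat_L2 : L2 P Wstat /\ \int[P]_w Wstat w ^+ 2 <= 2.
Proof.
have L := L4W (L4_ustat nuE h_m h_L4 B_ge0).
have E2 := Ex_ustat2 nuE h_m (@zkerC _ _ psi') h_int0 h_conv G_diag h_L4 B_ge0 pole.
have EW : (\int[P]_w (Wstat w ^+ 2)%:E <= 2%:E)%E.
  apply: (@le_trans _ _ (\int[P]_w (ustat h (V w) ^+ 2)%:E)%E).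
    rewrite le_eqVlt; apply/orP; left; apply/eqP; apply: ae_eq_integral => //.
    - by apply/measurable_EFinP; exact: measurable_funX.
    - by apply/measurable_EFinP; apply: measurable_funX;
      exact: (measurableT_comp measurable_ustat mV).
    - by apply: filterS ae_W => w -> _.
  rewrite (@ge0_integral_nu (fun x => ustat h x ^+ 2)); last 2 first.
  - exact: measurable_funX.
  - by move=> x; rewrite sqr_ge0.
  rewrite -(Ex_EFin L.2) lee_fin; apply: le_trans E2 _.
  by rewrite mulrC divfK// gt_eqF// exprn_gt0.
have W2 w : 0 <= Wstat w ^+ 2 by rewrite sqr_ge0.
have mW2 : measurable_fun setT (fun w => Wstat w ^+ 2) by exact: measurable_funX.
by split; [split => //; exact: ge0_L1 EW|exact: ge0_Ex_le EW].
Qed.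

(** [stein_bound] at these c, B and Q. The mean of [half_energy] is 1 - 1/n, whence the term Cg / n;
    80 is half of 10 times 16, while 704 and 1408 are 44 times 16 and 44 times 32. *)
Lemma Wstat_stein (f g g' : R -> R) (M Cg eps K delta : R) :
  measurable_fun setT f -> (forall t, `|f t| <= M) ->
  (forall t, f t = g' t - t * g t) ->
  (forall x : R, is_derive x 1 g (g' x)) -> measurable_fun setT g' ->
  (forall x, `|g x| <= Cg) -> (forall x, `|g' x| <= Cg) ->
  (forall a b, `|g' a - g' b| <= eps + K * (a - b) ^+ 2) ->
  0 < eps -> 0 < K -> 0 < delta ->
  `|\int[P]_w f (Wstat w)| <= eps + Cg * delta +
    (80 * K * C + Cg + Cg * (704 * C / delta)) * n%:R^-1 +
    Cg * (1408 / delta) * q.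
Proof.
move=> mf fM fE dg mg' gC g'C g'U e0 K0 de0.
rewrite (Ex_W mf fM); under eq_Rintegral do rewrite fE.
apply: le_trans (stein_bound nuE h_m G_m (@zkerC _ _ psi') h_int0 h_conv G_diag
  h_L4 G_L2 G_int0 B_ge0 Q_ge0 pole (ltnW n2) dg mg' gC g'C g'U e0 K0 de0) _.
have nn : n%:R != 0 :> R by rewrite gt_eqF.
have -> : 2^-1 * n%:R * (n%:R - 1) * (2 / n%:R ^+ 2) - 1 = - n%:R^-1 :> R by field.
rewrite normrN gtr0_norm ?invr_gt0//.
rewrite le_eqVlt; apply/orP; left; apply/eqP; field.
by rewrite nn gt_eqF.
Qed.

End one_sample.

(** * Passage to the limit along the sequence of samples *)

Theorem theorem1 (R : realType) (dn : nat -> nat)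
  (d0 : measure_display) (Omega : nat -> measurableType d0)
  (P : forall n, probability (Omega n) R)
  (X : forall n, nat -> Omega n -> (dn n).+1.-tuple R)
  (v : nat -> nat -> R) (psi : nat -> R -> R) :
  (* d_n positive integers, d_n -> oo *)
  (forall n, (0 < dn n)%N) ->
  (forall M : nat, exists N : nat, forall n, (N <= n)%N -> (M <= dn n)%N) ->
  (* X_{n,1..n} mutually independent, uniform on S^{d_n} *)
  (forall n, mutually_independent (P n) n (X n)) ->
  (forall n i, (i < n)%N -> uniform_on_sphere (P n) (X n i)) ->
  (* psi_n is the L^2 sum of its defining series *)
  (forall n, measurable_fun setT (psi n)) ->
  (forall n, (2 <= n)%N ->
     (fun K => (\int[P n]_w
        ((psi n (inner (X n 0 w) (X n 1 w))
          - psi_partial v (dn n) K (inner (X n 0 w) (X n 1 w))) ^+ 2)%:E)%E)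
     @ \oo --> 0%E) ->
  (* (i) *)
  (forall n, (\sum_(1 <= k <oo) ((v k (dn n)) ^+ 4 * (dkd k (dn n))%:R)%:E
               < +oo)%E) ->
  (forall n, (2 <= n)%N ->
     (\int[P n]_w ((psi n (inner (X n 0 w) (X n 1 w))) ^+ 2)%:E
      = \sum_(1 <= k <oo) ((v k (dn n)) ^+ 4 * (dkd k (dn n))%:R)%:E)%E) ->
  (* sigma_n > 0 (implicit: sigma_n^{-1}, sigma_n^{-4} are used) *)
  (forall n, (0 < \sum_(1 <= k <oo) ((v k (dn n)) ^+ 4 * (dkd k (dn n))%:R)%:E)%E) ->
  let sigma2 := fun n =>
    2 * fine (\sum_(1 <= k <oo) ((v k (dn n)) ^+ 4 * (dkd k (dn n))%:R)%:E)%E in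
  (* (ii) *)
  ((fun n => ((sigma2 n) ^-2)%:E *
      \sum_(1 <= k <oo) ((v k (dn n)) ^+ 8 * (dkd k (dn n))%:R)%:E)%E
     @ \oo --> 0%E) ->
  (exists C : R, \forall n \near \oo,
     (((sigma2 n) ^-2)%:E *
       \int[P n]_w ((psi n (inner (X n 0 w) (X n 1 w))) ^+ 4)%:E
      <= C%:E)%E) ->
  (* conclusion: sigma_n^{-1} T_n converges weakly to N(0,1) *)
  forall f : R -> R, continuous f -> (exists M : R, forall x, `|f x| <= M) ->
    (fun n => (\int[P n]_w
        (f ((Num.sqrt (sigma2 n))^-1 * Tstat n (psi n) (X n) w))%:E)%E)
    @ \oo --> (\int[normal_prob 0 1]_x (f x)%:E)%E.
Proof.
move=> _ dinf indX unifX mpsi psi_cvg fin4 psi2 pos4 sigma2 H8 [C HC] f cf bf.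
pose S8 n := (\sum_(1 <= k <oo) ((v k (dn n)) ^+ 8 * (dkd k (dn n))%:R)%:E)%E.
have S8_ge0 n : (0 <= S8 n)%E.
  by apply: nneseries_ge0 => k _ _; rewrite lee_fin mulr_ge0// exprn_even_ge0.
(* The normalised eighth-power sum, which tends to 0 by assumption. [fine] is faithful only for
   those n where the product is finite, that is eventually. *)
pose q n := fine (((sigma2 n) ^-2)%:E * S8 n)%E.
have /fine_cvgP[S8fin qcvg] := H8.
have s20 n : 0 < sigma2 n.
  by rewrite mulr_gt0// fine_gt0// pos4 fin4.
have q0 n : 0 <= q n.
  by rewrite fine_ge0// mule_ge0// lee_fin invr_ge0 sqr_ge0.
pose good n := [/\ (2 <= dn n)%N, (2 <= n)%N,
  (\int[P n]_w ((psi n (inner (X n 0 w) (X n 1 w))) ^+ 4)%:E <=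
     (C * sigma2 n ^+ 2)%:E)%E, 0 <= C & forall K,
  \sum_(1 <= k < K.+1) (v k (dn n)) ^+ 8 * (dkd k (dn n))%:R <= q n * sigma2 n ^+ 2].
have ngood : \forall n \near \oo, good n.
  (* From dimension 2 on, [psi_term] takes its Gegenbauer branch and lam = (d - 1) / 2 is
     positive. *)
  have [N HN] := dinf 2%N.
  near=> n.
  have s22 : 0 < sigma2 n ^+ 2 by rewrite exprn_gt0.
  have I4 : (0 <= \int[P n]_w ((psi n (inner (X n 0 w) (X n 1 w))) ^+ 4)%:E)%E.
    by apply: integral_ge0 => w _; rewrite lee_fin exprn_even_ge0.
  have HCn : (((sigma2 n) ^-2)%:E *
      \int[P n]_w ((psi n (inner (X n 0 w) (X n 1 w))) ^+ 4)%:E <= C%:E)%E by near: n.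
  split.
  - by apply: HN; near: n; exact: nbhs_infty_ge.
  - by near: n; exact: nbhs_infty_ge.
  - by rewrite mulrC EFinM -lee_pdivrMl.
  - rewrite -lee_fin (le_trans _ HCn)// mule_ge0// lee_fin invr_ge0 ltW//.
  - move=> K; have Sf : (((sigma2 n) ^-2)%:E * S8 n)%E \is a fin_num by near: n.
    have SE : S8 n = (q n * sigma2 n ^+ 2)%:E.
      rewrite EFinM /q fineK// muleC muleA -EFinM divff ?mul1e//.
      by rewrite gt_eqF.
    rewrite -lee_fin -SE -sumEFin; apply: nneseries_lim_ge => k _.
    by rewrite lee_fin mulr_ge0// exprn_even_ge0.
have psi2' n : (2 <= n)%N ->
    (\int[P n]_w ((psi n (inner (X n 0 w) (X n 1 w))) ^+ 2)%:E = (sigma2 n / 2)%:E)%E.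
  move=> n2; rewrite psi2// /sigma2 mulrC mulKf// fineK// fin_real//.
  by rewrite (lt_trans _ (pos4 n)) ?ltNy0//= fin4.
pose W n (w : Omega n) := Wstat n (X n) (psi n) (sigma2 n) w.
apply: (@weak_cvg_normal R d0 Omega P W 2) => //.
  apply: filterS ngood => n [d2 n2 h4 C0 h8].
  exact: (Wstat_L2 d2 n2 (indX n) (unifX n) (mpsi n) (psi_cvg n n2) (s20 n)
    (psi2' n n2) h4 C0 (q0 n)).
move=> h M ch h0 Ih eps e0.
have [g [g' [Cg [dg cg' [gC g'C] g'0 hE]]]] := stein_solution ch h0 Ih.
have [Ch [_ hC]] := compact_support_bounded ch h0.
have Cg0 : 0 <= Cg by exact: le_trans (gC 0).
have e4 : 0 < eps / 4 by rewrite divr_gt0.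
have [K [K0 HK]] := compact_support_modulus cg' g'0 e4.
(* The error eps splits as eps/4 for the modulus of g', eps/4 for Cg delta and eps/2 for the rest. K
   and delta are fixed before n, so the constants [A1] and [A2] do not depend on n and the rest
   tends to 0. *)
pose delta := eps / (4 * (Cg + 1)).
have Cg1 : 0 < Cg + 1 by rewrite ltr_wpDl.
have de0 : 0 < delta by rewrite divr_gt0// mulr_gt0.
pose A1 := 80 * K * C + Cg + Cg * (704 * C / delta).
pose A2 := Cg * (1408 / delta).
have Lcvg : (fun n => A1 * n%:R^-1 + A2 * q n) @ \oo --> (0 : R).
  rewrite -[X in _ --> X](addr0 (0 : R)); apply: cvgD.
    rewrite -[X in _ --> X](mulr0 A1); apply: cvgM; first exact: cvg_cst.
    by apply/gtr0_cvgV0; [near=> n; rewrite ltr0n; near: n; exact: nbhs_infty_gt|exact: cvgr_idn].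
  rewrite -[X in _ --> X](mulr0 A2); apply: cvgM; first exact: cvg_cst.
  exact: qcvg.
have e2 : 0 < eps / 2 by rewrite divr_gt0.
have /cvgrPdist_le/(_ _ e2) HL := Lcvg.
near=> n.
have [d2 n2 h4 C0 h8] : good n by near: n.
have Ln : `|0 - (A1 * n%:R^-1 + A2 * q n)| <= eps / 2 by near: n.
have mh : measurable_fun setT h by exact: continuous_measurable_fun.
have mg' : measurable_fun setT g' by exact: continuous_measurable_fun.
apply: le_trans (Wstat_stein d2 n2 (indX n) (unifX n) (mpsi n) (psi_cvg n n2) (s20 n)
    (psi2' n n2) h4 C0 h8 (q0 n) mh hC hE dg mg' gC g'C HK e4 K0 de0) _.
rewrite -/A1 -/A2 -addrA.
have : Cg * delta <= eps / 4.
  rewrite /delta (_ : Cg * _ = eps / 4 * (Cg / (Cg + 1))); last by field; rewrite gt_eqF.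
  by rewrite ler_piMr ?(ltW e4)// ler_pdivrMr// mul1r lerDl.
move: Ln; rewrite sub0r normrN => /(le_trans (ler_norm _)).
by lra.
Unshelve. all: by end_near. Qed.
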